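(* For each $f\in C_0(\mathbb R^d)$, $$\lim_{\varepsilon\to 0^+}T^\varepsilon(t)f=T^0(t)f\quad\text{in } C_0(\mathbb R^d),\qquad t\ge 0 .$$ Moreover, this convergence is uniform on bounded time intervals.
   Context: Let $d\ge 1$ and $\mathbb T^d=[0,1]^d$ be the unit torus; functions on $\mathbb T^d$ are identified with $\mathbb Z^d$-periodic functions on $\mathbb R^d$. Let $a\in C(\mathbb R^d)$ with $a(x)=a(-x)$, $a(x)\ge 0$, $\int_{\mathbb R^d}a(x)\,dx>0$, and $a(x)\le \frac{C}{1+|x|^{d+\delta}}$ for some constants $C$ and $\delta>2$. Let $\lambda,\mu\in C(\mathbb R^d)$ be $\mathbb Z^d$-periodic with $0<\alpha_1\le\lambda(x),\mu(x)\le\alpha_2<\infty$. $C_0(\mathbb R^d)$ is the Banach space of continuous functions on $\mathbb R^d$ vanishing at infinity, with the sup norm. For $\varepsilon>0$, $L^\varepsilon$ is the bounded operator on $C_0(\mathbb R^d)$ $$(L^{\varepsilon}u)(x)=\frac{1}{\varepsilon^{d+2}}\int_{\mathbb R^d}a\Big(\frac{x-y}{\varepsilon}\Big)\lambda\Big(\frac{x}{\varepsilon}\Big)\mu\Big(\frac{y}{\varepsilon}\Big)\big(u(y)-u(x)\big)\,dy ,$$ and $T^\varepsilon(t)$ is the semigroup in $C_0(\mathbb R^d)$ generated by $L^\varepsilon$. Let $\varkappa_1=(\varkappa_1^1,\dots,\varkappa_1^d)\in (L^2(\mathbb T^d))^d$ be the periodic solution, with zero average of each component over $\mathbb T^d$,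 of $$\int_{\mathbb R^d}a(\xi-q)\mu(q)\big(\varkappa_1(q)-\varkappa_1(\xi)\big)\,dq=\int_{\mathbb R^d}a(\xi-q)(\xi-q)\mu(q)\,dq,\qquad \xi\in\mathbb T^d .$$ The constant matrix $\Theta=\{\Theta^{ij}\}$ is defined by $$\Theta^{ij}\int_{\mathbb T^d}\frac{\mu(\xi)}{\lambda(\xi)}\,d\xi=\int_{\mathbb T^d}\int_{\mathbb R^d}\tfrac12(\xi-q)^i(\xi-q)^ja(\xi-q)\mu(q)\mu(\xi)\,dq\,d\xi-\int_{\mathbb T^d}\int_{\mathbb R^d}a(\xi-q)\mu(q)\mu(\xi)(\xi-q)^i\varkappa_1^j(q)\,dq\,d\xi ;$$ it is positive definite (only its symmetric part matters below). $T^0(t)$ is the semigroup in $C_0(\mathbb R^d)$ generated by $L^0=\sum_{i,j}\Theta^{ij}\frac{\partial^2}{\partial x^i\partial x^j}$ (the closure in $C_0(\mathbb R^d)$ of this operator defined on the Schwartz space $\mathcal S(\mathbb R^d)$, which is a core). *)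

(* Defs.v *)
From HB Require Import structures.
From mathcomp Require Import all_boot all_order all_algebra.
From mathcomp Require Import all_classical all_reals all_analysis.
Set Implicit Arguments.
Unset Strict Implicit.
Unset Printing Implicit Defensive.
Import Order.TTheory GRing.Theory Num.Theory.
Import numFieldNormedType.Exports.

Local Open Scope classical_set_scope.
Local Open Scope ring_scope.

(* R^n is 'rV[R]_n; its sigma-algebra is the product of the Borel ones. *)
Definition measure_rV_display : measure_display. Proof. by []. Qed.

Section measurable_rV.
Context {R : realType} (n : nat).

Let coord (i : 'I_n) (x : 'rV[R]_n) : R := x 0 i.

Let rV_set0 : g_sigma_preimage coord set0.
Proof. exact: sigma_algebra0. Qed.

Let rV_setC A : g_sigma_preimage coord A -> g_sigma_preimage coord (~` A).
Proof. exact: sigma_algebraC. Qed.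

Let rV_bigcup (F : _^nat) : (forall i, g_sigma_preimage coord (F i)) ->
  g_sigma_preimage coord (\bigcup_i (F i)).
Proof. exact: sigma_algebra_bigcup. Qed.

HB.instance Definition _ := @isMeasurable.Build measure_rV_display
  'rV[R]_n (g_sigma_preimage coord) rV_set0 rV_setC rV_bigcup.

End measurable_rV.

Lemma measurable_rV_coord (R : realType) n (i : 'I_n) :
  measurable_fun [set: 'rV[R]_n] (fun x => x 0 i).
Proof.
move=> _ Y mY; rewrite setTI; apply: sub_sigma_algebra => /=.
rewrite -bigcup_seq/=; exists i => /=; first by rewrite mem_index_enum.
by exists Y => //; rewrite setTI.
Qed.

Lemma measurable_fun_rVP (R : realType) d (T : measurableType d) n
    (f : T -> 'rV[R]_n) :
  measurable_fun [set: T] f <->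
  forall i, measurable_fun [set: T] (fun t => f t 0 i).
Proof.
split=> [mf i|mf].
  exact: (measurableT_comp (@measurable_rV_coord R n i) mf).
have : g_sigma_preimage (fun i t => f t 0 i) `<=` measurable.
  apply: smallest_sub; first exact: sigma_algebra_measurable.
  rewrite -bigcup_seq; apply: bigcup_sub => i _ A [B mB <-]; exact: mf.
rewrite (_ : g_sigma_preimage _ = preimage_set_system [set: T] f
    (g_sigma_preimage (fun i (x : 'rV[R]_n) => x 0 i))); last first.
  exact: (g_sigma_preimage_comp (fun i (x : 'rV[R]_n) => x 0 i) f).
by move=> pS _ A mA; apply: pS; exists A.
Qed.

Definition cons_rV (R : realType) n (p : measurableTypeR R * 'rV[R]_n) : 'rV[R]_n.+1 :=
  row_mx (const_mx p.1 : 'rV_1) p.2.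

Lemma cons_rV0 (R : realType) n (p : measurableTypeR R * 'rV[R]_n) : cons_rV p 0 0 = p.1.
Proof.
have -> : (0 : 'I_n.+1) = lshift n (0 : 'I_1) by exact/val_inj.
by rewrite (row_mxEl (const_mx p.1 : 'rV_1)) mxE.
Qed.

Lemma cons_rVS (R : realType) n (p : measurableTypeR R * 'rV[R]_n) i :
  cons_rV p 0 (lift 0 i) = p.2 0 i.
Proof.
have -> : lift 0 i = rshift 1 i by exact/val_inj.
exact: (row_mxEr (const_mx p.1 : 'rV_1)).
Qed.

Lemma measurable_cons_rV (R : realType) n :
  measurable_fun [set: measurableTypeR R * 'rV[R]_n] (@cons_rV R n).
Proof.
apply/measurable_fun_rVP => i; case: (unliftP 0 i) => [j ->|->].
- rewrite (_ : (fun _ => _) = (fun x : 'rV[R]_n => x 0 j) \o snd).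
    exact: (measurableT_comp (@measurable_rV_coord R n j) measurable_snd).
  by apply/funext => p; rewrite cons_rVS.
- by rewrite (_ : (fun _ => _) = fst) //; apply/funext => p; rewrite cons_rV0.
Qed.

Section cons_measure.
Context (R : realType) (n : nat).
Variable m : {sigma_finite_measure set 'rV[R]_n -> \bar R}.

Definition cons_measure : set 'rV[R]_n.+1 -> \bar R :=
  pushforward (@lebesgue_measure R \x m)%E (@cons_rV R n).

Let mcons A : measurable A -> measurable (@cons_rV R n @^-1` A).
Proof.
by move=> mA; rewrite -[X in measurable X]setTI; exact: measurable_cons_rV.
Qed.

Let cons_measure0 : cons_measure set0 = 0%E.
Proof. by rewrite /cons_measure /pushforward preimage_set0 measure0. Qed.

Let cons_measure_ge0 A : (0 <= cons_measure A)%E.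
Proof. exact: (measure_ge0 (@lebesgue_measure R \x m)%E). Qed.

Let cons_measure_sigma_additive : semi_sigma_additive cons_measure.
Proof.
move=> F mF tF mUF; rewrite /cons_measure /pushforward preimage_bigcup.
apply: measure_semi_sigma_additive => [k||]; first exact: mcons.
- apply/trivIsetP => i j _ _ ij; rewrite -preimage_setI.
  by move/trivIsetP : tF => /(_ _ _ _ _ ij) ->//; rewrite preimage_set0.
- by rewrite -preimage_bigcup; exact: mcons.
Qed.

HB.instance Definition _ := isMeasure.Build _ _ _ cons_measure
  cons_measure0 cons_measure_ge0 cons_measure_sigma_additive.

Let cons_measure_sigma_finite : sigma_finite setT cons_measure.
Proof.
have /sigma_finiteP[F [TF ndF Foo]] := sigma_finiteT (@lebesgue_measure R).
have /sigma_finiteP[G [TG ndG Goo]] := sigma_finiteT m.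
pose hd (x : 'rV[R]_n.+1) : measurableTypeR R := x 0 0.
pose tl (x : 'rV[R]_n.+1) : 'rV[R]_n := \row_i x 0 (lift 0 i).
have mhd : measurable_fun setT hd by exact: measurable_rV_coord.
have mtl : measurable_fun setT tl.
  apply/measurable_fun_rVP => i.
  rewrite (_ : (fun _ => _) = fun x : 'rV[R]_n.+1 => x 0 (lift 0 i)).
    exact: measurable_rV_coord.
  by apply/funext => x; rewrite mxE.
exists (fun k => (hd @^-1` F k) `&` (tl @^-1` G k)).
  apply/seteqP; split=> // x _.
  have [i _ Fi] : (\bigcup_k F k) (hd x) by rewrite -TF.
  have [j _ Gj] : (\bigcup_k G k) (tl x) by rewrite -TG.
  exists (maxn i j) => //; split.
  - by have /subsetPset := ndF _ _ (leq_maxl i j); exact.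
  - by have /subsetPset := ndG _ _ (leq_maxr i j); exact.
move=> k; have [mF Fk] := Foo k; have [mG Gk] := Goo k; split.
  apply: measurableI; rewrite -[X in measurable X]setTI; [exact: mhd|exact: mtl].
rewrite /cons_measure /pushforward.
rewrite (_ : _ @^-1` _ = F k `*` G k); last first.
  have tlK p : tl (cons_rV p) = p.2 by apply/rowP => i; rewrite mxE cons_rVS.
  by apply/seteqP; split=> -[a x] /=; rewrite /hd tlK cons_rV0.
by rewrite product_measure1E// lte_mul_pinfty// ge0_fin_numE.
Qed.

HB.instance Definition _ := Measure_isSigmaFinite.Build _ _ _ cons_measure
  cons_measure_sigma_finite.

End cons_measure.

(* Lebesgue measure on R^n, as the iterated product of the one on R; see
   lebesgue_rV_box below for its value on boxes. *)
Fixpoint lebesgue_rV (R : realType) (n : nat) :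
    {sigma_finite_measure set 'rV[R]_n -> \bar R} :=
  match n with
  | 0%N => \d_(0 : 'rV[R]_0)
  | n'.+1 => cons_measure (lebesgue_rV R n')
  end.

Definition box (R : realType) n (a b : 'rV[R]_n) : set 'rV[R]_n :=
  [set x | forall i, a 0 i <= x 0 i <= b 0 i].

Lemma measurable_box (R : realType) n (a b : 'rV[R]_n) : measurable (box a b).
Proof.
have -> : box a b = \bigcap_(i in [set: 'I_n])
    ((fun x : 'rV[R]_n => x 0 i) @^-1` `[a 0 i, b 0 i]%classic).
  apply/seteqP; split=> x /= xab i.
    by move=> _ /=; rewrite in_itv/=; exact: xab.
  by have := xab i Logic.I; rewrite /= in_itv.
apply: fin_bigcap_measurable => [|i _]; first exact: finite_finset.
rewrite -[X in measurable X]setTI; exact: measurable_rV_coord.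
Qed.

Lemma lebesgue_rV_box (R : realType) n (a b : 'rV[R]_n) :
  (forall i, a 0 i <= b 0 i) ->
  lebesgue_rV R n (box a b) = (\prod_i (b 0 i - a 0 i))%:E.
Proof.
elim: n a b => [|n IH] a b ab.
  by rewrite big_ord0 /= diracE mem_set//; case.
rewrite big_ord_recl /= /cons_measure /pushforward.
pose tl (x : 'rV[R]_n.+1) : 'rV[R]_n := \row_i x 0 (lift 0 i).
rewrite (_ : _ @^-1` _ =
    (`[a 0 0, b 0 0]%classic : set (measurableTypeR R)) `*` box (tl a) (tl b)).
  rewrite product_measure1E; [|exact: measurable_itv|exact: measurable_box].
  rewrite [X in (X * _)%E](_ : _ =
    lebesgue_measure (`[a 0 0, b 0 0]%classic : set R))//.
  rewrite IH => [|i]; last by rewrite !mxE.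
  rewrite lebesgue_measure_itv/= lte_fin -EFinB EFinM.
  rewrite (eq_bigr (fun i => b 0 (lift 0 i) - a 0 (lift 0 i))); last first.
    by move=> i _; rewrite !mxE.
  by case: ltgtP (ab 0) => // -> _; rewrite subrr !mul0e.
apply/seteqP; split=> [[t x] xab|[t x] [/= + xab] i].
  split=> /=; first by have := xab 0; rewrite cons_rV0 in_itv.
  by move=> i; have := xab (lift 0 i); rewrite cons_rVS !mxE.
rewrite in_itv /= => tab; case: (unliftP 0 i) => [j ->|->].
  by have := xab j; rewrite cons_rVS !mxE.
by rewrite cons_rV0.
Qed.

Section C0.
Context (R : realType) (n : nat).

(* `|x| is the library's max norm on row vectors; any norm gives the same
   notion. *)
Definition vanishing_at_infinity (u : 'rV[R]_n -> R) :=
  forall e : R, 0 < e -> exists M : R, forall x, M < `|x| -> `|u x| < e.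

Definition C0_pred : {pred 'rV[R]_n -> R} :=
  mem [set u | continuous u /\ vanishing_at_infinity u].

Record C0 := MkC0 { C0_fun :> 'rV[R]_n -> R; _ : C0_fun \in C0_pred }.

HB.instance Definition _ := [isSub for C0_fun].
HB.instance Definition _ := [Choice of C0 by <:].

Lemma C0P (u : C0) : continuous u /\ vanishing_at_infinity u.
Proof. by case: u => u /=; rewrite inE. Qed.

Lemma C0_submod_closed : submod_closed C0_pred.
Proof.
split.
  rewrite inE; split; first exact: cst_continuous.
  by move=> e e0; exists 0 => x _; rewrite normr0.
move=> a u v; rewrite !inE => -[cu u0] [cv v0]; split.
  move=> x; apply: continuousD; last exact: cv.
  by apply: continuousZr; exact: cu.
move=> e e0.
have ea : 0 < e / 2 / (`|a| + 1) by rewrite !divr_gt0 // ltr_wpDl.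
have [M1 h1] := u0 _ ea.
have [M2 h2] : exists M, forall x, M < `|x| -> `|v x| < e / 2.
  by apply: v0; rewrite divr_gt0.
exists (Num.max M1 M2) => x; rewrite gt_max => /andP[/h1 ux /h2 vx].
rewrite [e]splitr (le_lt_trans (ler_normD _ _))// ler_ltD//.
rewrite normrM (le_trans (_ : _ <= (`|a| + 1) * `|u x|)) //.
  by rewrite ler_wpM2r// lerDl.
by rewrite mulrC -ler_pdivlMr ?ltW// ltr_wpDl.
Qed.

HB.instance Definition _ := GRing.isSubmodClosed.Build _ _ C0_pred
  C0_submod_closed.
HB.instance Definition _ := [SubChoice_isSubLmodule of C0 by <:].

Definition C0_norm (u : C0) : R := sup (range (fun x => `|u x|)).

Lemma C0_bounded (u : C0) : has_ubound (range (fun x => `|u x|)).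
Proof.
have [cu u0] := C0P u; have [M uM] := u0 1 ltr01.
pose B : set 'rV[R]_n := [set x | `|x| <= M].
have cB : compact B.
  apply: bounded_closed_compact.
    exists M; split; first exact: num_real.
    by move=> N MN x xM; exact: le_trans xM (ltW MN).
  apply: (@closed_comp _ _ (fun x : 'rV[R]_n => `|x|) [set t | t <= M]).
    by move=> x _; exact: norm_continuous.
  exact: closed_le.
have /compact_bounded [K [_ uK]] : compact (u @` B).
  apply: continuous_compact => //; exact: continuous_subspaceT.
exists (Num.max 1 (K + 1)) => _ [x _ <-]; rewrite le_max.
have [xM|xM] := leP `|x| M; last by rewrite ltW ?uM.
by apply/orP; right; apply: (uK (K + 1)); [rewrite ltrDl|exists x].
Qed.

Lemma C0_normP (u : C0) x : `|u x| <= C0_norm u.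
Proof. by apply: ub_le_sup; [exact: C0_bounded|exists x]. Qed.

Lemma C0_norm_le (u : C0) (b : R) : (forall x, `|u x| <= b) -> C0_norm u <= b.
Proof.
move=> ub; apply: ge_sup; first by exists `|u 0|; exists 0.
by move=> _ [x _ <-].
Qed.

Let C0_normD u v : C0_norm (u + v) <= C0_norm u + C0_norm v.
Proof.
apply: C0_norm_le => x.
by rewrite (le_trans (ler_normD (u x) (v x)))// lerD// C0_normP.
Qed.

Let C0_normZ_le (l : R) u : C0_norm (l *: u) <= `|l| * C0_norm u.
Proof.
apply: C0_norm_le => x.
by rewrite (_ : (l *: u) x = l * u x)// normrM ler_wpM2l// C0_normP.
Qed.

Let C0_normZ (l : R) u : C0_norm (l *: u) = `|l| * C0_norm u.
Proof.
apply/eqP; rewrite eq_le C0_normZ_le /=.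
have [->|l0] := eqVneq l 0.
  by rewrite normr0 mul0r (le_trans _ (C0_normP _ 0)).
rewrite -ler_pdivlMl ?normr_gt0// -normfV.
by rewrite -{1}[u](scalerK l0) C0_normZ_le.
Qed.

Let C0_norm_eq0 u : C0_norm u = 0 -> u = 0.
Proof.
move=> u0; apply/val_inj/funext => x /=; apply/eqP.
by rewrite -normr_le0 -u0 C0_normP.
Qed.

HB.instance Definition _ := Lmodule_isNormed.Build R C0
  C0_normD C0_normZ C0_norm_eq0.

End C0.

(* Strongly continuous one-parameter semigroups of bounded operators and their
   generators; only the values T t with 0 <= t are meaningful. *)
Section semigroup.
Context (R : realType) (X : normedModType R).
Implicit Types (T : R -> X -> X) (A : set (X * X)).

Record strongly_continuous_semigroup T : Prop := {
  semigroup_linear : forall t, 0 <= t -> linear (T t);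
  semigroup_bounded : forall t, 0 <= t -> continuous (T t);
  semigroup0 : forall u, T 0 u = u;
  semigroupD : forall s t, 0 <= s -> 0 <= t ->
    forall u, T (s + t) u = T s (T t u);
  semigroup_cvg0 : forall u, T t u @[t --> 0^'+] --> u
}.

(* An unbounded operator is represented by its graph. *)
Definition generator T : set (X * X) :=
  [set uv | h^-1 *: (T h uv.1 - uv.1) @[h --> 0^'+] --> uv.2].

Definition generated_by T A :=
  strongly_continuous_semigroup T /\ generator T = A.

End semigroup.

Section nonlocal.
Context (R : realType) (d : nat).
Notation Rd := 'rV[R]_d.
Local Notation leb := (lebesgue_rV R d).
Implicit Types (a lambda mu u f : Rd -> R) (kappa : Rd -> Rd).

Definition eucl_norm (x : Rd) : R := Num.sqrt (\sum_i x 0 i ^+ 2).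

Definition Zd_periodic (V : Type) (f : Rd -> V) :=
  forall (x : Rd) (k : 'rV[int]_d), f (x + map_mx intr k) = f x.

Definition torus : set Rd := box 0 (const_mx 1).

Definition Leps a lambda mu (eps : R) u (x : Rd) : R :=
  (eps ^+ (d + 2))^-1 *
  \int[leb]_y (a (eps^-1 *: (x - y)) * lambda (eps^-1 *: x) *
               mu (eps^-1 *: y) * (u y - u x)).

Definition Leps_graph a lambda mu (eps : R) : set (C0 R d * C0 R d) :=
  [set uv : C0 R d * C0 R d | forall x, uv.2 x = Leps a lambda mu eps uv.1 x].

(* kappa is a representative, defined on all of R^d, of the L^2 solution of the
   cell problem; as such it satisfies the equation almost everywhere. *)
Record corrector a mu kappa : Prop := {
  corrector_periodic : Zd_periodic kappa;
  corrector_measurable : measurable_fun [set: Rd] kappa;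
  corrector_L2 : forall i,
    leb.-integrable torus (fun q => (kappa q 0 i ^+ 2)%:E);
  corrector_mean0 : forall i, \int[leb]_(q in torus) kappa q 0 i = 0;
  corrector_eq : {ae leb, forall xi, torus xi -> forall i,
    \int[leb]_q (a (xi - q) * mu q * (kappa q 0 i - kappa xi 0 i)) =
    \int[leb]_q (a (xi - q) * (xi - q) 0 i * mu q)}
}.

Definition effective_matrix a lambda mu kappa (Theta : 'M[R]_d) :=
  forall i j,
    Theta i j * \int[leb]_(xi in torus) (mu xi / lambda xi) =
    \int[leb]_(xi in torus) \int[leb]_q
      (2^-1 * (xi - q) 0 i * (xi - q) 0 j * a (xi - q) * mu q * mu xi)
    - \int[leb]_(xi in torus) \int[leb]_q
      (a (xi - q) * mu q * mu xi * (xi - q) 0 i * kappa q 0 j).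

Definition partial (i : 'I_d) f : Rd -> R := 'D_(delta_mx 0 i) f.

Definition partials (s : seq 'I_d) f : Rd -> R := foldr partial f s.

Definition schwartz f := forall s : seq 'I_d,
  [/\ forall x i, derivable (partials s f) x (delta_mx 0 i),
      continuous (partials s f) &
      forall m : nat, exists C : R,
        forall x, eucl_norm x ^+ m * `|partials s f x| <= C].

Definition L0 (Theta : 'M[R]_d) f (x : Rd) : R :=
  \sum_i \sum_j Theta i j * partial i (partial j f) x.

Definition L0_graph (Theta : 'M[R]_d) : set (C0 R d * C0 R d) :=
  [set uv : C0 R d * C0 R d | schwartz uv.1 /\ forall x, uv.2 x = L0 Theta uv.1 x].

End nonlocal.

(* Main.v *)
(* L^eps is dissipative, so T^eps contracts and, by a Trotter-Kato argument, it is
   enough to find for each Schwartz f functions f_eps -> f with L^eps f_eps -> L^0 f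
   uniformly. These are given by the two-scale ansatz
     f_eps(x) = f(x) + eps chi(x/eps) . grad f(x) + eps^2 k(x/eps) : hess f(x).
   The corrector equation, which makes the terms of order 1/eps cancel, exhibits
   kappa as a.e. equal to a continuous chi. The second corrector k has to solve, up
   to a small error, a cell problem whose right-hand side has mean zero because of
   the formula for Theta. Normalized, it reads G k - k = Psi for a Markov operator G
   on the torus. As a is positive near some point and, by symmetry, near its
   opposite, G o G charges a neighbourhood of the diagonal, hence a power of G
   dominates a multiple of the mean over the torus (Doeblin), so G^n Psi -> 0
   uniformly and k = - (Psi + ... + G^n Psi) works. The Taylor remainder is
   controlled by the integral of a(z) (1 + |z|)^2 min(1, eps |z|), which tends to 0
   as delta > 2. *)
From HB Require Import structures.
Require Import Defs.
From mathcomp Require Import all_boot all_order all_algebra.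
From mathcomp Require Import all_classical all_reals all_analysis.
From mathcomp Require Import measurable_realfun.
From mathcomp Require Import ring lra.
Set Implicit Arguments.
Unset Strict Implicit.
Unset Printing Implicit Defensive.
Import Order.TTheory GRing.Theory Num.Theory.
Import numFieldNormedType.Exports.
Local Open Scope classical_set_scope.
Local Open Scope ring_scope.

(** The Trotter-Kato step avoids resolvents and vector-valued integrals. The bound |T^eps(s) f -
    T^0(s) f| <= e t + k for s in [0, t] is propagated in t by induction along the real line, and
    the only derivative used is the right derivative which the generator provides. The term e t
    grows with time, whereas k can be made arbitrarily small by shrinking eps, so that the steps of
    the induction do not accumulate it; this forces the length of a step to be independent of k.
    Contractivity comes from the maximum principle for L^eps, while T^0 is only known to be bounded
    on bounded time intervals. An approximate second corrector suffices because its defect is fixed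
    before eps and enters L^eps f_eps at order 1, multiplied by the bounded Hessian of f. A defect
    of the first corrector would be divided by eps, hence that one is exact. Evenness of a makes G
    reversible, with invariant density J1 mu, where J1 is the total mass of a(xi - q) mu(q).
    Dividing the cell problem by lambda J1 turns the weight mu / lambda of the formula for Theta
    into this density, and the definition of Theta into the vanishing of an invariant mean. *)

(** * Induction along the real line and mean value inequalities *)

Lemma real_induction (R : realType) (tau : R) (P : R -> Prop) :
  P 0 ->
  (forall t : R, 0 <= t < tau -> P t ->
    exists2 h : R, 0 < h & forall s : R, t < s < t + h -> P s) ->
  (forall t : R, 0 < t <= tau -> (forall s : R, 0 <= s < t -> P s) -> P t) ->
  forall t : R, 0 <= t <= tau -> P t.
Proof.
move=> P0 Pr Pl t1 /andP[t10 t1tau].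
pose S := [set t | 0 <= t <= tau /\ forall s : R, 0 <= s <= t -> P s].
have S0 : S 0.
  split; first by rewrite lexx (le_trans t10).
  by move=> s ?; have -> : s = 0 by lra.
have Sub : has_sup S by split; [exists 0|exists tau => t [/andP[]]].
have m0 : 0 <= sup S by apply: ub_le_sup => //; case: Sub.
have mtau : sup S <= tau by apply: ge_sup; [exists 0|move=> t [/andP[]]].
have Plt s : 0 <= s < sup S -> P s.
  move=> /andP[s0 sm].
  have sm' : 0 < sup S - s by rewrite subr_gt0.
  have [x [_ Sx] sx] := sup_adherent sm' Sub.
  by apply: Sx; lra.
have Pm : P (sup S).
  have [->//|mn0] := eqVneq (sup S) 0.
  by apply: Pl => //; rewrite mtau lt_neqAle eq_sym mn0 m0.
have Ple s : 0 <= s <= sup S -> P s.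
  move=> /andP[s0]; rewrite le_eqVlt => /orP[/eqP->//|sm].
  by apply: Plt; rewrite s0.
have [mt|mt] := ltP (sup S) tau; last by apply: Ple; lra.
have m0t : 0 <= sup S < tau by rewrite m0 mt.
have [h h0 Ph] := Pr _ m0t Pm.
pose t2 := Num.min tau (sup S + h / 2).
have t2m : sup S < t2 by rewrite lt_min mt ltrDl divr_gt0.
have t2h : t2 <= sup S + h / 2 by rewrite ge_min lexx orbT.
have t2t : t2 <= tau by rewrite ge_min lexx.
have : S t2.
  split; first lra.
  move=> s /andP[s0 st2]; have [sm|sm] := leP s (sup S); first by apply: Ple; lra.
  by apply: Ph; lra.
by move=> /(ub_le_sup (proj2 Sub)); rewrite leNgt t2m.
Qed.

(** Right increments are all that a generator controls, so the slope is bounded on the right only;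
    the condition on the left excludes upward jumps at the limit times of the induction. *)
Lemma growth_bound (R : realType) (phi : R -> R) (M tau : R) : 0 <= tau ->
  (forall t : R, 0 < t <= tau -> forall eta : R, 0 < eta -> exists2 h : R, 0 < h &
    forall s : R, 0 <= s -> t - h < s < t -> phi t <= phi s + eta) ->
  (forall t : R, 0 <= t < tau -> forall eta : R, 0 < eta -> exists2 h : R, 0 < h &
    forall s : R, t < s < t + h -> phi s <= phi t + (M + eta) * (s - t)) ->
  phi tau <= phi 0 + M * tau.
Proof.
move=> tau0 phil phir.
(* The slope is relaxed to [M + eta], so that the induction reproduces its own bound exactly.
   Dividing by [tau + 1] rather than [tau] covers [tau = 0]. *)
suff H eta : 0 < eta -> phi tau <= phi 0 + (M + eta) * tau.
  apply/ler_addgt0Pr => e e0.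
  have t1 : 0 < tau + 1 by lra.
  have := H (e / (tau + 1)) ltac:(by rewrite divr_gt0).
  move=> /le_trans; apply.
  rewrite mulrDl addrA lerD2l -mulrAC ler_pdivrMr// ler_pM2l//; lra.
move=> eta0.
apply: (@real_induction _ tau (fun t => phi t <= phi 0 + (M + eta) * t)).
- by rewrite mulr0 addr0.
- move=> t tt Pt; have [h h0 Hh] := phir t tt _ eta0.
  exists h => // s sth; rewrite (le_trans (Hh _ sth))//.
  by rewrite mulrBr; lra.
- move=> t tt Ps; apply/ler_addgt0Pr => e e0.
  have e2 : 0 < e / 2 by lra.
  have [h h0 Hh] := phil t tt _ e2.
  (* [t - k / 2] is so close to [t] that the linear bound drops by at most [e / 2] in between,
     whatever the sign of the slope. *)
  pose k := Num.min t (Num.min h (e / 2 / (`|M + eta| + 1))).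
  have n0 : 0 < `|M + eta| + 1 by rewrite ltr_wpDl.
  have k0 : 0 < k by case/andP: (tt) => t0 _; rewrite !lt_min t0 h0 !divr_gt0.
  have kt : k <= t by rewrite ge_min lexx.
  have kh : k <= h by rewrite !ge_min lexx orbT.
  have ke : k <= e / 2 / (`|M + eta| + 1) by rewrite !ge_min lexx !orbT.
  have sb : 0 <= t - k / 2 by lra.
  have := Hh _ sb ltac:(lra); have := Ps (t - k / 2) ltac:(lra).
  suff : - ((M + eta) * (k / 2)) <= e / 2 by rewrite mulrBr; lra.
  have : `|(M + eta) * (k / 2)| <= e / 2.
    rewrite normrM (@ger0_norm _ (k/2)); last lra.
    apply: (@le_trans _ _ ((`|M + eta| + 1) * k)).
      by apply: ler_pM => //; lra.
    by rewrite mulrC -ler_pdivlMr.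
  by rewrite ler_norml => /andP[]; lra.
- by rewrite tau0 lexx.
Qed.

(** The scalar bound applies to the norm of [G t - G 0], whose increments are dominated by those of
    [G]. This serves as the fundamental theorem of calculus for orbits. *)
Lemma mean_value_bound (R : realType) (X : normedModType R) (G : R -> X)
    (M tau : R) : 0 <= tau ->
  (forall t : R, 0 < t <= tau -> forall eta : R, 0 < eta -> exists2 h : R, 0 < h &
    forall s : R, 0 <= s -> t - h < s < t -> `|G t - G s| <= eta) ->
  (forall t : R, 0 <= t < tau -> forall eta : R, 0 < eta -> exists2 h : R, 0 < h &
    forall s : R, t < s < t + h -> `|G s - G t| <= (M + eta) * (s - t)) ->
  `|G tau - G 0| <= M * tau.
Proof.
move=> tau0 Gl Gr.
have := @growth_bound R (fun t => `|G t - G 0|) M tau tau0.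
rewrite subrr normr0 add0r; apply.
- move=> t tt eta eta0; have [h h0 Hh] := Gl t tt eta eta0.
  exists h => // s s0 sth; have := Hh s s0 sth.
  have := ler_distD (G s) (G t) (G 0); lra.
- move=> t tt eta eta0; have [h h0 Hh] := Gr t tt eta eta0.
  exists h => // s sth; have := Hh s sth.
  have := ler_distD (G t) (G s) (G 0); lra.
Qed.

Lemma dnbhs0_rightP (R : realType) (X : normedModType R) (F : R -> X) (l : X) :
  F h @[h --> 0^'+] --> l <->
  forall eta : R, 0 < eta -> exists2 h0 : R, 0 < h0 &
    forall h, 0 < h < h0 -> `|F h - l| <= eta.
Proof.
split=> [/cvgrPdist_le Fl eta eta0|H].
  have [h0 /= h00 H] := Fl _ eta0.
  exists h0 => // h /andP[hp hh]; rewrite distrC; apply: H => //=.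
  by rewrite sub0r normrN gtr0_norm.
apply/cvgrPdist_le => e e0; have [h0 h00 Hh] := H _ e0.
exists h0 => // h /= + hp; rewrite sub0r normrN gtr0_norm// => hh.
by rewrite distrC; apply: Hh; rewrite hp.
Qed.

Lemma eq_le_of (disp : Order.disp_t) (T : porderType disp) (x y : T) : x = y -> (x <= y)%O.
Proof. by move->. Qed.

(** * Strongly continuous semigroups: local bounds, orbits, contractivity *)

Section semigroup_theory.
Context (R : realType) (X : completeNormedModType R) (T : R -> X -> X).
Hypothesis TP : strongly_continuous_semigroup T.

Lemma sgB t u v : 0 <= t -> T t (u - v) = T t u - T t v.
Proof.
move=> t0; have := semigroup_linear TP t0 (-1) v u.
by rewrite !scaleN1r !(addrC (- _)).
Qed.

Lemma sg0 t : 0 <= t -> T t 0 = 0.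
Proof. by move=> t0; have := sgB 0 0 t0; rewrite !subrr. Qed.

Lemma sgZ t (a : R) u : 0 <= t -> T t (a *: u) = a *: T t u.
Proof.
move=> t0; have T00 := sg0 t0.
by have := semigroup_linear TP t0 a u 0; rewrite T00 !addr0.
Qed.

Lemma sg_operator_bound t : 0 <= t ->
  exists2 M : R, 0 < M & forall u, `|T t u| <= M * `|u|.
Proof.
move=> t0; have T00 := sg0 t0.
have /(_ 0)/cvgr_dist_le/(_ 1 ltr01) := semigroup_bounded TP t0.
rewrite T00 => /nbhs_ballP[e /= e0 H].
exists (2 / e); first by rewrite divr_gt0.
move=> u; have [->|u0] := eqVneq u 0; first by rewrite T00 normr0 mulr0.
have nu : 0 < `|u| by rewrite normr_gt0.
have := H ((e / 2 / `|u|) *: u); rewrite -ball_normE /= sub0r normrN normrZ.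
rewrite ger0_norm; last by rewrite !divr_ge0// ltW.
rewrite divfK ?gt_eqF// => /(_ ltac:(lra)).
rewrite sgZ// sub0r normrN normrZ ger0_norm; last by rewrite !divr_ge0// ltW.
rewrite mulrC -ler_pdivlMr ?divr_gt0// => /le_trans; apply.
by apply: eq_le_of; field; rewrite !gt_eqF.
Qed.

(** Near 0 this is Banach-Steinhaus: otherwise some [T (tn n)] with [tn n] tending to 0 would have
    unbounded norms, although strong continuity at 0 bounds each orbit. The semigroup law then
    spreads the bound over the interval. *)
Lemma sg_locally_bounded tau : exists2 M : R, 0 < M &
  forall t : R, 0 <= t <= tau -> forall u, `|T t u| <= M * `|u|.
Proof.
have [del [M [del0 M1 HM]]] : exists del M, [/\ 0 < del, 1 <= M &
    forall t, 0 <= t <= del -> forall u, `|T t u| <= M * `|u|].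
  apply: contrapT => H.
  have /choice[tn tnP] : forall n : nat, exists t,
      (0 <= t <= n.+1%:R^-1) /\ exists u, n.+1%:R * `|u| < `|T t u|.
    move=> n; apply: contrapT => Hn; apply: H.
    exists n.+1%:R^-1, n.+1%:R; split => //; first by rewrite ler1n.
    move=> t tn u; rewrite leNgt; apply/negP => ut; apply: Hn.
    by exists t; split => //; exists u.
  pose F : set (X -> X) := range (fun n => T (tn n)).
  have tn0 n : 0 <= tn n by case: (tnP n) => /andP[].
  have ub : uniform_bounded F.
    apply: Banach_Steinhauss => [_ [n _ <-]|x].
      split; last exact: (semigroup_linear TP (tn0 n)).
      have [M M0 HM] := sg_operator_bound (tn0 n).
      move=> r; exists (M * r) => x xr; rewrite (le_trans (HM x))//.
      by rewrite ler_pM2l.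
    have /dnbhs0_rightP/(_ 1 ltr01)[h0 h00 Hh] := @semigroup_cvg0 _ _ _ TP x.
    have [N /ltW Nh] : exists N : nat, N.+1%:R^-1 < h0.
      have := near_infty_natSinv_lt (PosNum h00) => /= -[N _ /(_ N)/=].
      by move=> /(_ (leqnn _)) ?; exists N.
    (* The sum takes care of the first indices, [|x| + 1] of those for which [tn n] is below
       [h0]. *)
    pose B := \sum_(n < N.+1) `|T (tn n) x| + (`|x| + 1).
    exists B => _ [n _ <-].
    have [nN|nN] := ltnP n N.+1.
      rewrite /B (bigD1 (Ordinal nN))//= -addrA lerDl.
      by rewrite addr_ge0// ?sumr_ge0// addr_ge0.
    have : `|T (tn n) x| <= `|x| + 1.
      have [->|tnn0] := eqVneq (tn n) 0; first by rewrite (semigroup0 TP) lerDl.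
      have := Hh (tn n); rewrite lt_neqAle eq_sym tnn0 tn0 /=.
      have tnh : tn n < h0.
        case: (tnP n) => /andP[_ tnn] _; rewrite (le_lt_trans tnn)//.
        by rewrite (lt_le_trans _ Nh)// ltf_pV2 ?posrE// ltr_nat.
      move=> /(_ tnh) Hb.
      by have := ler_normD (T (tn n) x - x) x; rewrite subrK; lra.
    by move=> /le_trans; apply; rewrite /B lerDr sumr_ge0.
  have [M HM] := ub 1.
  pose n := Num.truncn `|M|.
  have [_ [u ut]] := tnP n.
  have nM : M < n.+1%:R.
    rewrite (le_lt_trans (ler_norm M))//.
    by rewrite real_truncnS_gt.
  have u0 : 0 < `|u|.
    rewrite normr_gt0; apply/negP => /eqP u0; move: ut; rewrite u0.
    by rewrite sg0// normr0 mulr0 ltxx.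
  have := HM (T (tn n)) (ex_intro2 _ _ n Logic.I erefl) (`|u|^-1 *: u).
  rewrite normrZ ger0_norm ?invr_ge0// mulVf ?gt_eqF// lexx => /(_ isT).
  rewrite sgZ// normrZ ger0_norm ?invr_ge0//.
  rewrite mulrC ler_pdivrMr// => /(lt_le_trans ut).
  by rewrite ltr_pM2r// ltNge (ltW nM).
have M0 : 0 < M by rewrite (lt_le_trans ltr01).
have step n : forall t, 0 <= t <= n%:R * del -> forall u, `|T t u| <= M ^+ n * `|u|.
  elim: n => [|n IH] t.
    rewrite mul0r => tt u; have -> : t = 0 by lra.
    by rewrite (semigroup0 TP) expr0 mul1r.
  rewrite -natr1 mulrDl mul1r => tt u; have [td|td] := leP t del.
    have td0 : 0 <= t <= del by rewrite td andbT; case/andP: tt.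
    rewrite (le_trans (HM t td0 u))// ler_wpM2r// exprS ler_peMr//; [exact: ltW|exact: exprn_ege1].
  have -> : t = del + (t - del) by lra.
  rewrite (semigroupD TP); [|lra|lra].
  have dd : 0 <= del <= del by lra.
  rewrite (le_trans (HM _ dd _))// exprS -mulrA ler_pM2l// IH//; lra.
pose n := (Num.truncn `|tau / del|).+1.
exists (M ^+ n); first exact: exprn_gt0.
move=> t tt u; apply: step; case/andP: tt => -> /= /le_trans; apply.
rewrite -ler_pdivrMr// (le_trans (ler_norm _))// ltW//.
by rewrite real_truncnS_gt.
Qed.

(** Continuity on both sides reduces to right continuity at 0 through
    [T s u - T r u = T r (T (s - r) u - u)]. For the limit from the left [r] varies, hence the
    uniform bound on [T r] for [r <= t + 1]. *)
Lemma sg_orbit_continuous u t eta : 0 <= t -> 0 < eta ->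
  exists2 h : R, 0 < h & forall s : R, 0 <= s -> `|s - t| < h -> `|T s u - T t u| <= eta.
Proof.
move=> t0 eta0; have [M M0 HM] := sg_locally_bounded (t + 1).
have /dnbhs0_rightP H := @semigroup_cvg0 _ _ _ TP u.
have [h0 h00 Hh] := H (eta / M) ltac:(by rewrite divr_gt0).
exists (Num.min h0 1); first by rewrite lt_min h00 ltr01.
suff key r s : 0 <= r -> 0 <= s -> r <= s -> r <= t + 1 ->
    s - r < h0 -> `|T s u - T r u| <= eta.
  move=> s s0; rewrite lt_min => /andP[sth st1].
  have [st|st] := leP s t.
    rewrite distrC; apply: key => //; first lra.
    by move: sth; rewrite distrC; apply: le_lt_trans; exact: ler_norm.
  apply: key => //; [exact: ltW|lra|].
  by apply: le_lt_trans sth; exact: ler_norm.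
move=> r0 s0 rs rt srh; have [->|rs'] := eqVneq s r.
  by rewrite subrr normr0 ltW.
have -> : s = r + (s - r) by lra.
have rt' : 0 <= r <= t + 1 by lra.
rewrite (semigroupD TP); [|lra|lra].
rewrite -sgB// (le_trans (HM r rt' _))//.
rewrite mulrC -ler_pdivlMr//; apply: Hh; rewrite srh andbT.
by rewrite subr_gt0 lt_neqAle eq_sym rs' rs.
Qed.

Lemma generator_orbit u v t : 0 <= t -> generator T (u, v) ->
  generator T (T t u, T t v).
Proof.
move=> t0 /dnbhs0_rightP uv; apply/dnbhs0_rightP => eta eta0.
have [M M0 HM] := sg_operator_bound t0.
have [h0 h00 Hh] := uv (eta / M) ltac:(by rewrite divr_gt0).
exists h0 => // h hh; have /= := Hh h hh => Hb.
have hp : 0 <= h by lra.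
have -> : T h (T t u) = T t (T h u).
  by rewrite -!(semigroupD TP)// addrC.
by rewrite -sgB// -sgZ// -sgB// (le_trans (HM _))// mulrC -ler_pdivlMr.
Qed.

Lemma generator_expansion u v eta : generator T (u, v) -> 0 < eta ->
  exists2 h0 : R, 0 < h0 & forall h, 0 <= h < h0 ->
    `|T h u - u - h *: v| <= eta * h.
Proof.
move=> /dnbhs0_rightP uv eta0; have [h0 h00 Hh] := uv _ eta0.
exists h0 => // h /andP[h1 h2].
have [->|hn0] := eqVneq h 0.
  by rewrite (semigroup0 TP) subrr scale0r subrr normr0 mulr0.
have hp : 0 < h by rewrite lt_neqAle eq_sym hn0.
have /= := Hh h ltac:(by rewrite hp) => Hb.
have -> : T h u - u - h *: v = h *: (h^-1 *: (T h u - u) - v).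
  by rewrite scalerBr scalerA divff// scale1r.
by rewrite normrZ gtr0_norm// mulrC ler_pM2r.
Qed.

(** The norm of the orbit has nonpositive right derivative. As in the implicit Euler scheme,
    dissipativity is applied at the end [r] of a short step, where [T r u - (r - s) *: T r v] equals
    [T s u] up to [o(r - s)]. *)
Lemma sg_dissipative_contraction t u : 0 <= t ->
  (forall p q, generator T (p, q) -> forall h, 0 < h -> `|p| <= `|p - h *: q|) ->
  (exists v, generator T (u, v)) -> `|T t u| <= `|u|.
Proof.
move=> t0 diss [v uv].
have := @growth_bound R (fun s => `|T s u|) 0 t t0.
rewrite mul0r addr0 (semigroup0 TP); apply.
- move=> s /andP[s0 st] eta eta0.
  have [h h0 Hh] := sg_orbit_continuous u (ltW s0) eta0.
  exists h => // r r0 rs.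
  have := Hh r r0; rewrite ltr_distl => /(_ ltac:(lra)).
  by rewrite distrC; have := ler_normD (T s u - T r u) (T r u); rewrite subrK; lra.
- move=> s /andP[s0 st] eta eta0; rewrite add0r.
  have e2 : 0 < eta / 2 by lra.
  have [h1 h10 Hh1] := generator_expansion (generator_orbit s0 uv) e2.
  have [h2 h20 Hh2] := sg_orbit_continuous v s0 e2.
  exists (Num.min h1 h2); first by rewrite lt_min h10.
  move=> r; rewrite -ltrBlDl lt_min => /andP[sr /andP[rh1 rh2]].
  have rs0 : 0 < r - s by lra.
  have r0 : 0 <= r by lra.
  have := diss _ _ (generator_orbit r0 uv) _ rs0.
  have := Hh1 (r - s) ltac:(lra); rewrite -(semigroupD TP)//; last lra.
  rewrite (_ : r - s + s = r); last lra.
  have := Hh2 r r0; rewrite gtr0_norm// => /(_ rh2) HB HA /le_trans; apply.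
  have -> : T r u - (r - s) *: T r v = T s u + (T r u - T s u - (r - s) *: T s v)
     - (r - s) *: (T r v - T s v).
    rewrite (addrA (T s u)) [T s u + (_ - _)]addrC subrK.
    by rewrite scalerBr opprB addrA subrK.
  rewrite (le_trans (ler_normB _ _))// normrZ gtr0_norm//.
  have := ler_normD (T s u) (T r u - T s u - (r - s) *: T s v).
  have : (r - s) * `|T r v - T s v| <= (r - s) * (eta / 2) by rewrite ler_pM2l.
  by rewrite {1}[(r - s) * (eta / 2)]mulrC; lra.
Qed.

End semigroup_theory.

(** * Trotter-Kato approximation of semigroups *)

Lemma subrACA (V : zmodType) (x a y b : V) : (x - a) - (y - b) = (x - y) - (a - b).
Proof. by rewrite !opprB addrACA [in RHS]addrACA (addrC (- a)). Qed.

Lemma closure_prod_approx (R : realType) (X : normedModType R) (A : set (X * X))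
    g w (eta : R) : closure A (g, w) -> 0 < eta ->
  exists p q, [/\ A (p, q), `|p - g| <= eta & `|q - w| <= eta].
Proof.
move=> clA eta0.
have [] := clA (ball g eta `*` ball w eta).
  by exists (ball g eta, ball w eta) => //; split; exact: nbhsx_ballx.
move=> [p q] [Apq [/= pg qw]]; exists p, q.
by move: pg qw; rewrite -!ball_normE /= !(distrC g) !(distrC w) => /ltW ? /ltW ?.
Qed.

Section trotter_kato.
Context (R : realType) (X : completeNormedModType R).

(** Plays the part of the formula expressing [T r p - p - r *: w] as the integral of [T s q - w]
    over [0, r]. *)
Lemma contraction_mean_value (T : R -> X -> X) p q w (K r : R) :
  strongly_continuous_semigroup T -> generator T (p, q) -> 0 <= r ->
  (forall s : R, 0 <= s <= r -> `|T s q - w| <= K) ->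
  `|T r p - p - r *: w| <= K * r.
Proof.
move=> TP pq r0 HK.
have := @mean_value_bound R X (fun s => T s p - s *: w) K r r0.
rewrite (semigroup0 TP) scale0r subr0 addrAC; apply.
- move=> t /andP[t0 tr] eta eta0.
  have e2 : 0 < eta / 2 by lra.
  have [h h0 Hh] := sg_orbit_continuous TP p (ltW t0) e2.
  have n0 : 0 < `|w| + 1 by rewrite ltr_wpDl.
  exists (Num.min h (eta / 2 / (`|w| + 1))).
    by rewrite lt_min h0 divr_gt0.
  move=> s s0; rewrite ltrBlDr -ltrBlDl lt_min => /andP[/andP[sh se] st].
  have -> : T t p - t *: w - (T s p - s *: w) = (T t p - T s p) - (t - s) *: w.
    by rewrite subrACA scalerBl.
  rewrite (le_trans (ler_normB _ _))// normrZ gtr0_norm ?subr_gt0//.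
  have := Hh s s0; rewrite distrC gtr0_norm ?subr_gt0// => /(_ sh).
  rewrite distrC.
  have : (t - s) * `|w| <= eta / 2.
    rewrite (@le_trans _ _ ((t - s) * (`|w| + 1)))//.
      by rewrite ler_pM2l ?subr_gt0// lerDl.
    by rewrite -ler_pdivlMr// ltW.
  lra.
- move=> t /andP[t0 tr] eta eta0.
  have [h h0 Hh] := generator_expansion TP (generator_orbit TP t0 pq) eta0.
  exists h => // s tsh.
  have st : 0 <= s - t by lra.
  have -> : T s p - s *: w - (T t p - t *: w) =
     (T (s - t) (T t p) - T t p - (s - t) *: T t q) + (s - t) *: (T t q - w).
    by rewrite -(semigroupD TP)// subrK scalerBr addrA subrK subrACA scalerBl.
  rewrite (le_trans (ler_normD _ _))// normrZ (@ger0_norm _ (s - t))//.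
  have := Hh (s - t) ltac:(lra).
  have : (s - t) * `|T t q - w| <= (s - t) * K.
    by rewrite ler_wpM2l// HK// t0 ltW.
  by rewrite (mulrC _ K); lra.
Qed.

Variables (T0 : R -> X -> X) (Teps : R -> R -> X -> X) (A0 : set (X * X)).
Hypothesis T0P : strongly_continuous_semigroup T0.
Hypothesis T0A : generator T0 = closure A0.
Hypothesis TepsP : forall eps, 0 < eps -> strongly_continuous_semigroup (Teps eps).
Hypothesis Teps_contraction : forall eps t u, 0 < eps -> 0 <= t ->
  `|Teps eps t u| <= `|u|.
Hypothesis domain_dense : forall u eta, 0 < eta ->
  exists p q, generator T0 (p, q) /\ `|p - u| <= eta.
Hypothesis approx : forall p q eta, A0 (p, q) -> 0 < eta ->
  exists2 eps0 : R, 0 < eps0 & forall eps, 0 < eps < eps0 ->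
    exists p' q', [/\ generator (Teps eps) (p', q'), `|p' - p| <= eta &
      `|q' - q| <= eta].

Let sgcontr eps t u v : 0 < eps -> 0 <= t ->
  `|Teps eps t u - Teps eps t v| <= `|u - v|.
Proof. by move=> e0 t0; rewrite -(sgB (TepsP e0))// Teps_contraction. Qed.

(** The orbit of an approximant [p'] moves at speed at most [|q'|], which stays below [|q| + eta]
    whatever [eps]; contractivity carries the estimate over to [u]. The distance from [u] to [p'] is
    at most three eighths of [eta] and is paid twice. *)
Lemma small_time u eta : 0 < eta ->
  exists h eps0 : R, [/\ 0 < h, 0 < eps0 & forall eps, 0 < eps < eps0 ->
    forall r : R, 0 <= r < h -> `|Teps eps r u - u| <= eta].
Proof.
move=> eta0; have e8 : 0 < eta / 8 by lra.
have [p1 [q1 [+ p1u]]] := domain_dense u e8.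
rewrite T0A => /closure_prod_approx/(_ e8)[p [q [pq pp1 _]]].
have [eps0 eps00 He] := approx pq e8.
pose h := (eta / 8) / (`|q| + eta).
have n0 : 0 < `|q| + eta by rewrite ltr_wpDl.
exists h, eps0; split => //; first by rewrite divr_gt0.
move=> eps epse r /andP[r0 rh].
have e0 : 0 < eps by case/andP: epse.
have [p' [q' [pq' p'p q'q]]] := He _ epse.
have q'n : `|q'| <= `|q| + eta by have := ler_normD (q' - q) q; rewrite subrK; lra.
have Hs s : 0 <= s <= r -> `|Teps eps s q' - 0| <= `|q| + eta.
  by move=> /andP[s0 _]; rewrite subr0 (le_trans _ q'n)// Teps_contraction.
have := contraction_mean_value (TepsP e0) pq' r0 Hs.
rewrite scaler0 subr0 => H1; have {H1} : `|Teps eps r p' - p'| <= eta / 8.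
  by rewrite (le_trans H1)// mulrC -ler_pdivlMr// ltW.
have := sgcontr u p' e0 r0.
have := ler_distD p u p'; have := ler_distD p1 u p.
have := ler_distD (Teps eps r p') (Teps eps r u) u; have := ler_distD p' (Teps eps r p') u.
by rewrite !(distrC p' u) (distrC u p1) (distrC p1 p) (distrC p p'); lra.
Qed.

(** The order of the quantifiers matters: [h] depends on [w] and [eta] alone, whereas [kap], the
    price of replacing [(g, w)] by a pair of the core and then by its approximants, can be chosen
    afterwards at the expense of [eps0]. *)
Lemma consistency g w eta : generator T0 (g, w) -> 0 < eta ->
  exists2 h : R, 0 < h & forall kap : R, 0 < kap ->
   exists2 eps0 : R, 0 < eps0 & forall eps, 0 < eps < eps0 ->
    forall r : R, 0 <= r < h -> `|Teps eps r g - g - r *: w| <= eta * r + kap.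
Proof.
move=> gw eta0; have e4 : 0 < eta / 4 by lra.
have [h [eps1 [h0 eps10 H1]]] := small_time w e4.
exists h => // kap kap0.
pose m := Num.min (kap / 4) (eta / 4).
have m0 : 0 < m by rewrite lt_min; apply/andP; split; lra.
have mk : m <= kap / 4 by rewrite ge_min lexx.
have me : m <= eta / 4 by rewrite ge_min lexx orbT.
move: gw; rewrite T0A => /closure_prod_approx/(_ m0)[p [q [pq pg qw]]].
have [eps2 eps20 H2] := approx pq m0.
exists (Num.min eps1 eps2); first by rewrite lt_min eps10.
move=> eps /andP[e0]; rewrite lt_min => /andP[ee1 ee2] r /andP[r0 rh].
have [p' [q' [pq' p'p q'q]]] := H2 eps ltac:(by rewrite e0).
(* [eta / 4] from the motion of [w] in a short time, and [2 * m] from the distance between [q'] and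
   [w]. *)
have Hs s : 0 <= s <= r -> `|Teps eps s q' - w| <= 3 / 4 * eta.
  move=> /andP[s0 sr].
  have := H1 eps ltac:(by rewrite e0) s ltac:(lra).
  have := sgcontr q' w e0 s0.
  have := ler_distD (Teps eps s w) (Teps eps s q') w.
  have := ler_distD q q' w; lra.
have := contraction_mean_value (TepsP e0) pq' r0 Hs.
have := sgcontr g p' e0 r0.
have := ler_distD p g p'; rewrite (distrC g p) (distrC p p').
have -> : Teps eps r g - g - r *: w =
  (Teps eps r g - Teps eps r p') + (Teps eps r p' - p' - r *: w) - (g - p').
  rewrite !addrA subrK opprB addrA.
  by rewrite (addrAC (_ - p') (- (r *: w)) p') subrK addrAC.
have := ler_normB ((Teps eps r g - Teps eps r p') + (Teps eps r p' - p' - r *: w)) (g - p').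
have := ler_normD (Teps eps r g - Teps eps r p') (Teps eps r p' - p' - r *: w).
have : 0 <= eta * r by rewrite mulr_ge0// ltW.
lra.
Qed.

Lemma trotter_kato_domain f v tau eta : generator T0 (f, v) -> 0 <= tau -> 0 < eta ->
  exists2 eps0 : R, 0 < eps0 & forall eps, 0 < eps < eps0 ->
    forall t : R, 0 <= t <= tau -> `|Teps eps t f - T0 t f| <= eta.
Proof.
move=> fv tau0 eta0.
pose eta1 := eta / 2 / (tau + 1).
have t1 : 0 < tau + 1 by lra.
have eta10 : 0 < eta1 by rewrite !divr_gt0.
(* The term [eta1 * t] absorbs the error made along the way; [kap] is quantified anew at every time
   and is therefore not accumulated. *)
pose P (t : R) := forall kap : R, 0 < kap ->
  exists2 eps0 : R, 0 < eps0 & forall eps, 0 < eps < eps0 ->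
    forall s : R, 0 <= s <= t -> `|Teps eps s f - T0 s f| <= eta1 * t + kap.
suff HP t : 0 <= t <= tau -> P t.
  have e2 : 0 < eta / 2 by lra.
  have [eps0 eps00 He] := HP tau ltac:(by rewrite tau0 lexx) _ e2.
  exists eps0 => // eps ee t tt; rewrite (le_trans (He eps ee t tt))//.
  suff : eta1 * tau <= eta / 2 by lra.
  by rewrite /eta1 mulrAC ler_pdivrMr// ler_pM2l//; lra.
apply: (@real_induction _ tau) => {t}.
- move=> kap kap0; exists 1 => // eps /andP[e0 _] s s0.
  have -> : s = 0 by lra.
  by rewrite (semigroup0 (TepsP e0)) (semigroup0 T0P) subrr normr0 mulr0 add0r ltW.
(* Beyond [t], both evolutions of [T0 t f] are compared with the line [T0 t f + r *: T0 t v]; this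
   point lies again in the domain of the generator. *)
- move=> t /andP[t0 ttau] Pt.
  have e2 : 0 < eta1 / 2 by lra.
  have gt := generator_orbit T0P t0 fv.
  have [h1 h10 H1] := consistency gt e2.
  have [h2 h20 H2] := generator_expansion T0P gt e2.
  exists (Num.min h1 h2); first by rewrite lt_min h10.
  move=> s; rewrite -ltrBlDl lt_min => /andP[ts /andP[sh1 sh2]] kap kap0.
  have k2 : 0 < kap / 2 by lra.
  have [e1 e10 He1] := Pt _ k2; have [e3 e30 He3] := H1 _ k2.
  exists (Num.min e1 e3); first by rewrite lt_min e10.
  move=> eps /andP[e0]; rewrite lt_min => /andP[ee1 ee3] s' /andP[s'0 s's].
  have ee1' : 0 < eps < e1 by rewrite e0.
  have ee3' : 0 < eps < e3 by rewrite e0.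
  have ets : eta1 * t <= eta1 * s by rewrite ler_pM2l// ltW.
  have [s't|ts'] := leP s' t.
    by have := He1 _ ee1' s' ltac:(by rewrite s'0); lra.
  have r0 : 0 <= s' - t by lra.
  have := He1 _ ee1' t ltac:(by rewrite t0 lexx).
  have := sgcontr (Teps eps t f) (T0 t f) e0 r0.
  have := He3 _ ee3' (s' - t) ltac:(lra).
  have := H2 (s' - t) ltac:(lra).
  rewrite -(semigroupD T0P)// -(semigroupD (TepsP e0))// !subrK.
  set A := Teps eps s' f; set B := Teps eps (s' - t) (T0 t f).
  set z := (s' - t) *: T0 t v; set C := T0 s' f; set D := T0 t f.
  have : `|A - C| <= `|A - B| + `|B - D - z| + `|C - D - z|.
    have -> : A - C = (A - B) + (B - D - z) - (C - D - z).
      rewrite !addrA subrK (opprB (C - D)) addrA subrK opprB addrA subrK.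
      by [].
    rewrite (le_trans (ler_normB _ _))// lerD2r.
    exact: ler_normD.
  have : eta1 * (s' - t) <= eta1 * (s - t) by rewrite ler_pM2l// lerB.
  by rewrite mulrBr; lra.
(* At a limit time, the gap between [s = t - m / 2] and [t] is bridged by [small_time] for the
   approximating semigroups and by continuity of the limit orbit. *)
- move=> t /andP[t0 ttau] Ps kap kap0.
  have k8 : 0 < kap / 8 by lra.
  have k4 : 0 < kap / 4 by lra.
  have [h1 h10 H1] := sg_orbit_continuous T0P f (ltW t0) k8.
  have [h2 [e2 [h20 e20 H2]]] := small_time (T0 t f) k8.
  pose m := Num.min t (Num.min h1 h2).
  have m0 : 0 < m by rewrite !lt_min t0 h10.
  have mt : m <= t by rewrite ge_min lexx.
  have mh1 : m <= h1 by rewrite !ge_min lexx orbT.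
  have mh2 : m <= h2 by rewrite !ge_min lexx !orbT.
  pose s := t - m / 2.
  have s0 : 0 <= s by rewrite /s; lra.
  have st : s < t by rewrite /s; lra.
  have [e1 e10 He1] := Ps s ltac:(by rewrite s0) _ k4.
  exists (Num.min e1 e2); first by rewrite lt_min e10.
  move=> eps /andP[e0]; rewrite lt_min => /andP[ee1 ee2] s' /andP[s'0 s's].
  have ee1' : 0 < eps < e1 by rewrite e0.
  have ee2' : 0 < eps < e2 by rewrite e0.
  have ets : eta1 * s <= eta1 * t by rewrite ler_pM2l// ltW.
  have [s't|ts'] := leP s' s.
    by have := He1 _ ee1' s' ltac:(by rewrite s'0); lra.
  have r0 : 0 <= s' - s by lra.
  have := He1 _ ee1' s ltac:(by rewrite s0 lexx).
  have := sgcontr (Teps eps s f) (T0 t f) e0 r0.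
  have := H2 _ ee2' (s' - s) ltac:(by rewrite r0 /s; lra).
  have := H1 s s0 ltac:(by rewrite ltr_norml /s; lra).
  have := H1 s' s'0 ltac:(by rewrite ltr_norml; rewrite /s in ts'; lra).
  rewrite -(semigroupD (TepsP e0))// !subrK.
  have := ler_distD (T0 t f) (Teps eps s' f) (T0 s' f).
  have := ler_distD (Teps eps (s' - s) (T0 t f)) (Teps eps s' f) (T0 t f).
  have := ler_distD (T0 s f) (Teps eps s f) (T0 t f).
  by rewrite (distrC (T0 t f) (T0 s' f)); lra.
Qed.

Lemma trotter_kato f tau eta : 0 <= tau -> 0 < eta ->
  exists2 eps0 : R, 0 < eps0 & forall eps, 0 < eps < eps0 ->
    forall t : R, 0 <= t <= tau -> `|Teps eps t f - T0 t f| <= eta.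
Proof.
move=> tau0 eta0; have [M M0 HM] := sg_locally_bounded T0P tau.
(* Moving [f] to a point of the domain costs [del] for the contractions and [M * del] for [T0]. *)
pose del := eta / 3 / (M + 1).
have M1 : 0 < M + 1 by lra.
have del0 : 0 < del by rewrite !divr_gt0//.
have delM : del * (M + 1) = eta / 3 by rewrite /del divfK// gt_eqF.
have [p [q [pq pf]]] := domain_dense f del0.
have e3 : 0 < eta / 3 by lra.
have [eps0 eps00 He] := trotter_kato_domain pq tau0 e3.
exists eps0 => // eps ee t tt.
have e0 : 0 < eps by case/andP: ee.
have t0 : 0 <= t by case/andP: tt.
have := He eps ee t tt.
have := HM t tt (p - f); rewrite (sgB T0P)//.
have := sgcontr f p e0 t0; rewrite (distrC f p).
have := ler_distD (Teps eps t p) (Teps eps t f) (T0 t f).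
have := ler_distD (T0 t p) (Teps eps t p) (T0 t f).
have : M * `|p - f| <= M * del by rewrite ler_pM2l.
by move: delM; rewrite mulrDr mulr1 (mulrC del); lra.
Qed.

End trotter_kato.

(** * Dominated convergence for integrals depending on a parameter *)

Lemma continuous_atP (R : realType) (V W : normedModType R) (F : V -> W) (x : V) :
  {for x, continuous F} <->
  forall e : R, 0 < e -> exists2 r : R, 0 < r &
    forall y, `|x - y| < r -> `|F x - F y| <= e.
Proof.
split=> [/cvgrPdist_le H e /H/nbhs_ballP[r r0 Hr]|H].
  by exists r => // y xy; apply: Hr; rewrite -ball_normE.
apply/cvgrPdist_le => e /H[r r0 Hr]; apply/nbhs_ballP; exists r => // y.
by rewrite -ball_normE; exact: Hr.
Qed.

Section dominated_convergence_parameter.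
Context (R : realType) (dY : measure_display) (Y : measurableType dY).
Variable mu : {measure set Y -> \bar R}.

Lemma cvg_Rintegral_dominated (D : set Y) (f_ : nat -> Y -> R) (f g : Y -> R) :
  measurable D -> (forall n, measurable_fun D (f_ n)) ->
  (forall y, D y -> f_ n y @[n --> \oo] --> f y) ->
  mu.-integrable D (EFin \o g) ->
  (forall n y, D y -> `|f_ n y| <= g y) ->
  \int[mu]_(y in D) f_ n y @[n --> \oo] --> \int[mu]_(y in D) f y.
Proof.
move=> mD mf ff ig fg.
have mf' n : measurable_fun D (EFin \o f_ n) by apply/measurable_EFinP; exact: mf.
have ff' y : D y -> (EFin \o f_ n) y @[n --> \oo] --> (EFin \o f) y.
  by move=> Dy; apply: cvg_EFin; [exact: nearW|exact: ff].
have mf0 : measurable_fun D (EFin \o f).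
  exact: (emeasurable_fun_cvg (fun n => EFin \o f_ n) _ mf' ff').
have [|| ifn _] := @dominated_convergence _ _ _ mu D mD (fun n => EFin \o f_ n)
  (EFin \o f) (EFin \o g) mf' mf0 _ ig _.
- exact: aeW.
- by apply: aeW => y n Dy; rewrite lee_fin; exact: fg.
rewrite -[X in _ --> X -> _]fineK; last exact: integrable_fin_num.
exact: fine_cvg.
Qed.

(** Reduces continuity to sequences, the setting of dominated convergence. They are confined to a
    ball because a dominating function may be valid only for parameters near [x]. *)
Lemma continuous_from_seq (V W : normedModType R) (F : V -> W) (x : V) (r : R) :
  0 < r ->
  (forall u : nat -> V, (forall n, `|x - u n| < r) ->
    u n @[n --> \oo] --> x -> F (u n) @[n --> \oo] --> F x) ->
  {for x, continuous F}.
Proof.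
move=> r0 H; apply: contrapT => nc.
have [e e0 He] : exists2 e : R, 0 < e & forall n : nat, exists y : V,
    [/\ `|x - y| < n.+1%:R^-1, `|x - y| < r & e <= `|F x - F y|].
  apply: contrapT => nH; apply: nc; apply/continuous_atP => e e0.
  apply: contrapT => nn; apply: nH; exists e => // n.
  apply: contrapT => nex; apply: nn.
  exists (Num.min n.+1%:R^-1 r); first by rewrite lt_min r0 invr_gt0 ltr0n.
  move=> y; rewrite lt_min => /andP[yn yr].
  by rewrite leNgt; apply/negP => Fe; apply: nex; exists y; split=> //; exact: ltW.
have [u uP] := choice He.
have ux : u n @[n --> \oo] --> x.
  apply/cvgrPdist_lt => eta eta0.
  near=> n; case: (uP n) => + _ _; move/lt_trans; apply.
  by near: n; exact: (near_infty_natSinv_lt (PosNum eta0)).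
have ur n : `|x - u n| < r by case: (uP n).
have /cvgrPdist_lt/(_ e e0)[N _ /(_ N (leqnn N))] := H u ur ux.
by case: (uP N) => _ _ /le_lt_trans h /h; rewrite ltxx.
Unshelve. all: by end_near. Qed.

Lemma continuous_Rintegral (V : normedModType R) (D : set Y) (F : V -> Y -> R)
    (g : Y -> R) (x : V) (r : R) :
  measurable D -> 0 < r -> (forall v, measurable_fun D (F v)) ->
  (forall y, D y -> {for x, continuous (F ^~ y)}) ->
  mu.-integrable D (EFin \o g) ->
  (forall v y, `|x - v| < r -> D y -> `|F v y| <= g y) ->
  {for x, continuous (fun v => \int[mu]_(y in D) F v y)}.
Proof.
move=> mD r0 mF cF ig Fg; apply: (continuous_from_seq r0) => u ur ux.
apply: (@cvg_Rintegral_dominated D (fun n => F (u n)) (F x) g) => //.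
- by move=> y Dy; apply: (@cvg_comp _ _ _ u (F ^~ y) _ _ _ ux); exact: (cF y Dy).
- by move=> n y Dy; exact: Fg.
Qed.

End dominated_convergence_parameter.

Section vanishing.
Context (R : realType) (d : nat).

Lemma vanishing_from_seq (F : 'rV[R]_d -> R) :
  (forall u : nat -> 'rV[R]_d, (forall n, n%:R < `|u n|) ->
    F (u n) @[n --> \oo] --> 0) ->
  vanishing_at_infinity F.
Proof.
move=> H e e0; apply: contrapT => nH.
have He (n : nat) : exists x, n%:R < `|x| /\ e <= `|F x|.
  apply: contrapT => nex; apply: nH; exists n%:R => x nx.
  by rewrite ltNge; apply/negP => Fe; apply: nex; exists x.
have [u uP] := choice He.
have un n : n%:R < `|u n| by case: (uP n).
have /cvgr0Pnorm_lt/(_ e e0)[N _ /(_ N (leqnn N))] := H u un.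
by case: (uP N) => _ /le_lt_trans h /h; rewrite ltxx.
Qed.

Lemma vanishing_seq (F : 'rV[R]_d -> R) (u : nat -> 'rV[R]_d) (b : R) :
  vanishing_at_infinity F -> (forall n, n%:R - b <= `|u n|) ->
  F (u n) @[n --> \oo] --> 0.
Proof.
move=> vF un; apply/cvgr0Pnorm_lt => e e0; have [M HM] := vF e e0.
near=> n; apply: HM; rewrite (lt_le_trans _ (un n))// ltrBrDr.
by near: n; exact: nbhs_infty_gtr.
Unshelve. all: by end_near. Qed.

Lemma vanishing_Rintegral (dY : measure_display) (Y : measurableType dY)
    (mu : {measure set Y -> \bar R}) (D : set Y) (F : 'rV[R]_d -> Y -> R)
    (g : Y -> R) :
  measurable D -> (forall v, measurable_fun D (F v)) ->
  (forall y, D y -> vanishing_at_infinity (F ^~ y)) ->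
  mu.-integrable D (EFin \o g) ->
  (forall v y, D y -> `|F v y| <= g y) ->
  vanishing_at_infinity (fun v => \int[mu]_(y in D) F v y).
Proof.
move=> mD mF vF ig Fg; apply: vanishing_from_seq => u un.
have -> : 0 = \int[mu]_(y in D) (0 : R).
  by rewrite Rintegral_cst// mul0r.
apply: (@cvg_Rintegral_dominated _ _ _ mu D (fun n => F (u n)) (cst 0) g) => //.
- move=> y Dy; apply: (@vanishing_seq (F ^~ y) u 0); first exact: vF.
  by move=> n; rewrite subr0 ltW.
- by move=> n y Dy; exact: Fg.
Qed.

End vanishing.

(** * Completeness of the space of continuous functions vanishing at infinity *)

Section C0_complete.
Context (R : realType) (d : nat).

Lemma C0_uniform_closed (l : 'rV[R]_d -> R) :
  (forall e : R, 0 < e -> exists u : C0 R d, forall x, `|u x - l x| <= e) ->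
  l \in @C0_pred R d.
Proof.
move=> H; rewrite inE; split.
  move=> x; apply/continuous_atP => e e0.
  have e3 : 0 < e / 3 by lra.
  have [u ul] := H _ e3; have [cu _] := C0P u.
  have /continuous_atP/(_ _ e3)[r r0 ur] := cu x.
  exists r => // y /ur.
  have := ul x; have := ul y; rewrite (distrC (u x)).
  by have := ler_distD (u x) (l x) (l y); have := ler_distD (u y) (u x) (l y); lra.
move=> e e0; have e2 : 0 < e / 2 by lra.
have [u ul] := H _ e2; have [_ /(_ _ e2)[M HM]] := C0P u.
exists M => x /HM; have := ul x.
have := ler_normB (u x) (u x - l x); rewrite opprB addrC subrK; lra.
Qed.

Lemma C0_cauchy_cvg (F : set_system (C0 R d)) : ProperFilter F -> cauchy F -> cvg F.
Proof.
move=> FF /cauchy_ballP Fc.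
have Fx x : cvg ((fun u : C0 R d => u x) @ F).
  apply: cauchy_cvg; apply/cauchy_ballP => e e0.
  near_simpl; apply: filterS (Fc e e0) => -[u v] /=.
  rewrite -!ball_normE /=; apply: le_lt_trans.
  by have := C0_normP (u - v) x.
pose l x := lim ((fun u : C0 R d => u x) @ F).
have Fl (e : R) : 0 < e -> F [set u : C0 R d | forall x, `|u x - l x| <= e].
  move=> e0; have e2 : 0 < e / 2 by lra.
  near=> u => x.
  have : F [set v : C0 R d | `|v x - l x| <= e / 2].
    have /cvgrPdist_le/(_ _ e2) := Fx x; apply: filterS => v /=.
    by rewrite distrC.
  move=> Hl.
  have Hu : F [set v | ball u (e / 2) v] by near: u; apply: nearP_dep; exact: Fc.
  have [v [/= vl uv]] := filter_ex (filterI Hl Hu).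
  have : `|u x - v x| <= e / 2.
    move: uv; rewrite -ball_normE /= => /ltW; apply: le_trans.
    by have := C0_normP (u - v) x.
  by have := ler_distD (v x) (u x) (l x); lra.
have lC : l \in @C0_pred R d.
  apply: C0_uniform_closed => e e0.
  by have [u ul] := filter_ex (Fl e e0); exists u.
apply/cvg_ex; exists (MkC0 lC); apply/cvgrPdist_le => e e0.
apply: filterS (Fl e e0) => u ul; rewrite distrC.
exact: (@C0_norm_le _ _ (u - MkC0 lC)).
Unshelve. all: by end_near. Qed.

HB.instance Definition _ := Uniform_isComplete.Build (C0 R d) C0_cauchy_cvg.

End C0_complete.


(** * Density of the domain of a generator on this space *)

Section generator_domain_dense.
Context (R : realType) (d : nat) (T : R -> C0 R d -> C0 R d).
Hypothesis TP : strongly_continuous_semigroup T.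
Variable u : C0 R d.

Notation leb1 := (@lebesgue_measure R).

(** The orbit of [u], frozen at negative times so as to be continuous on the whole line. *)
Let F (s : R) : C0 R d := T (Num.max 0 s) u.

Let F_continuous : continuous F.
Proof.
move=> t; apply/(@continuous_atP R R^o) => e e0.
have t0 : 0 <= Num.max 0 t by rewrite le_max lexx.
have [h h0 Hh] := sg_orbit_continuous TP u t0 e0.
exists h => // s ts; rewrite distrC; apply: Hh; first by rewrite le_max lexx.
apply: le_lt_trans ts; rewrite distrC.
by have [?|?] := leP 0 s; have [?|?] := leP 0 t; rewrite ?subr0 ?sub0r ?normrN
  ?normr0 // ler_norml; apply/andP; split; rewrite ?ler_norml;
  have := ler_norm (t - s); have := ler_norm (- (t - s)); rewrite normrN;
  first [lra | rewrite ger0_norm; lra].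
Qed.

Let Fx_continuous x : continuous (fun s => F s x).
Proof.
move=> t; apply/(@continuous_atP R R^o) => e e0.
have /(@continuous_atP R R^o)/(_ e e0)[r r0 Hr] := @F_continuous t.
by exists r => // s /Hr; apply: le_trans; exact: (C0_normP (F t - F s)).
Qed.

Let Fx_measurable x (D : set (measurableTypeR R)) : measurable D ->
  measurable_fun D (fun s => F s x).
Proof.
move=> mD; apply: measurable_funTS; apply: continuous_measurable_fun; exact: Fx_continuous.
Qed.

Let Fx_integrable x (a b : R) :
  leb1.-integrable `[a, b] (EFin \o (fun s => F s x)).
Proof.
apply: continuous_compact_integrable; first exact: segment_compact.
by apply: continuous_subspaceT; exact: Fx_continuous.
Qed.

(** The integral of the orbit is formed point by point with the scalar Lebesgue integral. That it
    stays in the space and is compatible with [T] then has to be proved. *)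
Let Itg_fun (b : R) x := \int[leb1]_(s in `[0, b]) F s x.

Let Itg_C0 b : Itg_fun b \in @C0_pred R d.
Proof.
have [M M0 HM] := sg_locally_bounded TP `|b|.
have FM s x : `[0, b]%classic s -> `|F s x| <= M * `|u|.
  rewrite /= in_itv /= => /andP[s0 sb]; apply: le_trans (C0_normP _ _) _.
  rewrite /F; have -> : Num.max 0 s = s by apply/max_idPr.
  by apply: HM; rewrite s0 (le_trans sb)// ler_norm.
have iM : leb1.-integrable `[0, b] (EFin \o (fun=> M * `|u|)).
  apply: continuous_compact_integrable; first exact: segment_compact.
  by apply: continuous_subspaceT => x; exact: cvg_cst.
rewrite inE; split.
  move=> x.
  apply: (@continuous_Rintegral _ _ _ leb1 _ `[0, b]%classic (fun x s => F s x)
    (fun=> M * `|u|) x 1) => //.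
  - by move=> v; exact: Fx_measurable.
  - by move=> s _; have [+ _] := C0P (F s); exact.
  - by move=> v y _; exact: FM.
apply: (@vanishing_Rintegral _ _ _ _ leb1 `[0, b]%classic (fun x s => F s x)
    (fun=> M * `|u|)) => //.
- by move=> v; exact: Fx_measurable.
- by move=> s _; have [_] := C0P (F s).
- by move=> v y; exact: FM.
Qed.

Let Itg b : C0 R d := MkC0 (Itg_C0 b).

(** Strict differentiability at [b]: neither end of the increment has to be [b], so that the
    estimate serves on both sides of a point. *)
Let Itg_local b eta : 0 < eta -> exists2 h : R, 0 < h &
  forall s s' : R, 0 <= s <= s' -> `|s - b| < h -> `|s' - b| < h ->
    `|Itg s' - Itg s - (s' - s) *: F b| <= eta * (s' - s).
Proof.
move=> eta0; have /(@continuous_atP R R^o)/(_ _ eta0)[h h0 Hh] := @F_continuous b.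
exists h => // s s' /andP[s0 ss'] sh s'h.
apply: (@C0_norm_le _ _ (Itg s' - Itg s - (s' - s) *: F b)) => x.
have -> : (Itg s' - Itg s - (s' - s) *: F b) x =
  Itg_fun s' x - Itg_fun s x - (s' - s) * F b x by [].
rewrite /Itg_fun (@Rintegral_itvB _ (fun y => F y x) (BLeft 0) (BRight s') s) //.
have mD : measurable (`]s, s']%classic : set (measurableTypeR R)) by [].
have lD : fine (leb1 `]s, s']%classic) = s' - s.
  rewrite lebesgue_measure_itv /= lte_fin; case: ltP => // s's.
  by rewrite /=; lra.
have iF : leb1.-integrable `]s, s'] (EFin \o (fun y => F y x)).
  by apply: integrableS (Fx_integrable x s s') => //; exact: subset_itv_oc_cc.
have ic (c : R) : leb1.-integrable `]s, s'] (EFin \o (fun=> c)).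
  have icc : leb1.-integrable `[s, s'] (EFin \o (fun=> c)).
    apply: continuous_compact_integrable; first exact: segment_compact.
    by apply: continuous_subspaceT => y; exact: cvg_cst.
  by apply: integrableS icc => //; exact: subset_itv_oc_cc.
have -> : (s' - s) * F b x = \int[leb1]_(y in `]s, s']) F b x.
  by rewrite Rintegral_cst// lD mulrC.
rewrite -RintegralB//.
have -> : eta * (s' - s) = \int[leb1]_(y in `]s, s']) eta.
  by rewrite Rintegral_cst// lD.
have iB : leb1.-integrable `]s, s'] (EFin \o (fun y => F y x - F b x)).
  rewrite (_ : EFin \o _ = (fun y => (F y x)%:E - (F b x)%:E)%E)//.
  by apply: integrableB => //; exact: ic.
apply: le_trans (le_normr_Rintegral _ iB) _ => //.
apply: le_Rintegral => //; first exact: integrable_norm.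
move=> y /=; rewrite in_itv /= => /andP[sy ys'].
have : `|F b - F y| <= eta.
  by apply: Hh; move: sh s'h; rewrite !ltr_distl; lra.
by rewrite distrC; apply: le_trans; exact: (C0_normP (F y - F b) x).
Qed.

Let FE t : 0 <= t -> F t = T t u.
Proof. by move=> t0; rewrite /F; congr (T _ _); apply/max_idPr. Qed.

(** The difference of the two sides vanishes at [b = 0] and has derivative 0, because
    [T r (F t) = F (r + t)]. The mean value inequality thus replaces the exchange of a bounded
    operator with an integral. *)
Let Itg_shift r b : 0 <= r -> 0 <= b -> T r (Itg b) = Itg (b + r) - Itg r.
Proof.
move=> r0 b0; apply/eqP; rewrite -subr_eq0 -normr_le0.
have Itg0 : Itg 0 = 0.
  by apply/val_inj/funext => x /=; rewrite /Itg_fun set_itv1 Rintegral_set1.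
have [M M0 HM] := sg_operator_bound TP r0.
pose G b := T r (Itg b) - (Itg (b + r) - Itg r).
have G0 : G 0 = 0 by rewrite /G add0r subrr subr0 Itg0 (sg0 TP).
have GB s s' : G s' - G s = T r (Itg s' - Itg s) - (Itg (s' + r) - Itg (s + r)).
  by rewrite /G (sgB TP)// subrACA [X in _ - X]subrACA subrr subr0.
have Gloc t (eta : R) : 0 <= t -> 0 < eta -> exists2 h : R, 0 < h &
  forall s s' : R, 0 <= s <= s' -> `|s - t| < h -> `|s' - t| < h ->
    `|G s' - G s| <= eta * (s' - s).
  move=> t0 eta0; have M1 : 0 < M + 1 by lra.
  have e1 : 0 < eta / (M + 1) by rewrite divr_gt0.
  have [h1 h10 H1] := Itg_local t e1.
  have [h2 h20 H2] := Itg_local (t + r) e1.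
  exists (Num.min h1 h2); first by rewrite lt_min h10.
  move=> s s' /andP[s0 ss']; rewrite !lt_min => /andP[sh1 sh2] /andP[s'h1 s'h2].
  have := H1 s s' ltac:(by rewrite s0) sh1 s'h1.
  have := H2 (s + r) (s' + r) ltac:(lra).
  rewrite (_ : s + r - (t + r) = s - t); last lra.
  rewrite (_ : s' + r - (t + r) = s' - t); last lra.
  rewrite (_ : s' + r - (s + r) = s' - s); last lra.
  move=> /(_ sh2 s'h2); rewrite (addrC t).
  move=> A2 A1; rewrite GB.
  set w := (s' - s) *: F (r + t) in A2.
  have -> : T r (Itg s' - Itg s) - (Itg (s' + r) - Itg (s + r)) =
    T r (Itg s' - Itg s - (s' - s) *: F t) - (Itg (s' + r) - Itg (s + r) - w).
    rewrite (sgB TP (Itg s' - Itg s) _ r0) (sgZ TP)// (FE t0) -(semigroupD TP)//.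
    by rewrite -FE ?addr_ge0// subrACA subrr subr0.
  rewrite (le_trans (ler_normB _ _))//.
  have := HM (Itg s' - Itg s - (s' - s) *: F t).
  have : M * `|Itg s' - Itg s - (s' - s) *: F t| <= M * (eta / (M + 1) * (s' - s)).
    by rewrite ler_pM2l.
  have : eta * (s' - s) = M * (eta / (M + 1) * (s' - s)) + eta / (M + 1) * (s' - s).
    by field; rewrite gt_eqF.
  lra.
have := @mean_value_bound R _ G 0 b b0; rewrite G0 subr0 mul0r; apply.
- move=> t /andP[t0 _] eta eta0; have [h h0 Hh] := Gloc t 1 (ltW t0) ltr01.
  exists (Num.min h eta); first by rewrite lt_min h0.
  move=> s s0 /andP[ts st].
  have ts' : t - s < Num.min h eta by lra.
  move: ts'; rewrite lt_min => /andP[tsh tse].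
  have := Hh s t ltac:(by rewrite s0 ltW); rewrite subrr normr0 => /(_ _ h0).
  rewrite distrC gtr0_norm ?subr_gt0// => /(_ tsh); lra.
- move=> t /andP[t0 _] eta eta0; have [h h0 Hh] := Gloc t eta t0 eta0.
  exists h => // s /andP[ts sth]; rewrite add0r.
  apply: Hh; [by rewrite t0 ltW|by rewrite subrr normr0|].
  by rewrite gtr0_norm ?subr_gt0//; lra.
Qed.

(** Averages of the orbit over [0, b] are close to [u]. They lie in the domain since, by
    [Itg_shift], their difference quotient is a difference of two short averages, one just after [b]
    and one just after 0. *)
Lemma generator_domain_dense (eta : R) : 0 < eta ->
  exists p q, generator T (p, q) /\ `|p - u| <= eta.
Proof.
move=> eta0; have [h h0 Hh] := Itg_local 0 eta0.
pose b := h / 2.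
have b0 : 0 < b by rewrite divr_gt0.
have Itg0 : Itg 0 = 0.
  by apply/val_inj/funext => x /=; rewrite /Itg_fun set_itv1 Rintegral_set1.
exists (b^-1 *: Itg b), (b^-1 *: (F b - u)); split; last first.
  have := Hh 0 b; rewrite lexx ltW// subr0 normr0 => /(_ isT h0).
  rewrite !subr0 gtr0_norm// Itg0 subr0 FE// (semigroup0 TP) => /(_ ltac:(rewrite /b; lra)) H.
  have -> : b^-1 *: Itg b - u = b^-1 *: (Itg b - b *: u).
    by rewrite scalerBr scalerA mulVf ?gt_eqF// scale1r.
  by rewrite normrZ gtr0_norm ?invr_gt0// mulrC ler_pdivrMr.
apply/dnbhs0_rightP => e e0.
pose e1 := e * b / 2.
have e10 : 0 < e1 by rewrite !mulr_gt0.
have [h1 h10 H1] := Itg_local b e10.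
have [h2 h20 H2] := Itg_local 0 e10.
exists (Num.min h1 h2); first by rewrite lt_min h10.
move=> r /andP[r0]; rewrite lt_min => /andP[rh1 rh2] /=.
have := H1 b (b + r); rewrite (ltW b0) lerDl (ltW r0) subrr normr0 addrAC subrr add0r.
rewrite gtr0_norm// => /(_ isT h10 rh1) A1.
have := H2 0 r; rewrite lexx (ltW r0) subrr normr0 !subr0 gtr0_norm//.
move=> /(_ isT h20 rh2); rewrite Itg0 subr0 [in F 0]FE// (semigroup0 TP) => A2.
rewrite (sgZ TP _ _ (ltW r0)) (Itg_shift (ltW r0) (ltW b0)).
have -> : r^-1 *: (b^-1 *: (Itg (b + r) - Itg r) - b^-1 *: Itg b) - b^-1 *: (F b - u) =
  (b * r)^-1 *: ((Itg (b + r) - Itg b - r *: F b) - (Itg r - r *: u)).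
  rewrite -scalerBr scalerA -invfM (mulrC r).
  have -> : b^-1 *: (F b - u) = (b * r)^-1 *: (r *: (F b - u)).
    by rewrite scalerA; congr (_ *: _); field; rewrite !gt_eqF.
  rewrite -scalerBr; congr (_ *: _).
  by rewrite subrACA -scalerBr; congr (_ - _); rewrite addrAC.
rewrite normrZ gtr0_norm ?invr_gt0 ?mulr_gt0// mulrC ler_pdivrMr ?mulr_gt0//.
rewrite (le_trans (ler_normB _ _))//.
have -> : e * (b * r) = e1 * r + e1 * r by rewrite /e1; field.
exact: lerD.
Qed.

End generator_domain_dense.

(** * Norms and Borel sets on row vectors *)

Section row_vectors.
Context (R : realType) (n : nat).
Implicit Types x : 'rV[R]_n.

Lemma rV_norm_leP x (r : R) : 0 <= r ->
  reflect (forall i, `|x 0 i| <= r) (`|x| <= r).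
Proof.
move=> r0; apply: (iffP idP) => [xr i|xr].
  apply: le_trans xr; rewrite [leRHS]mx_normrE.
  exact: (le_bigmax _ (fun ij : 'I_1 * 'I_n => `|x ij.1 ij.2|) (0, i)).
by rewrite [leLHS]mx_normrE; apply/bigmax_leP; split => // -[i j] _ /=; rewrite ord1.
Qed.

Lemma rV_coord_le x i : `|x 0 i| <= `|x|.
Proof. by have /rV_norm_leP := lexx `|x|; exact. Qed.

Lemma rV_norm_eucl x : `|x| <= eucl_norm x.
Proof.
apply/rV_norm_leP => [|i]; first exact: sqrtr_ge0.
rewrite -sqrtr_sqr ler_wsqrtr// (bigD1 i)//= lerDl.
by apply: sumr_ge0 => j _; exact: sqr_ge0.
Qed.

(** The sigma-algebra is generated by the coordinates; an open set belongs to it as the countable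
    union of the boxes with rational centre and half-side [1 / (k + 1)] that it contains. *)
Lemma open_measurable_rV (U : set 'rV[R]_n) : open U -> measurable U.
Proof.
move=> oU.
pose B (qk : 'rV[rat]_n * nat) : set 'rV[R]_n :=
  box (map_mx ratr qk.1 - const_mx qk.2.+1%:R^-1) (map_mx ratr qk.1 + const_mx qk.2.+1%:R^-1).
pose F qk := if `[< B qk `<=` U >] then B qk else set0.
have -> : U = \bigcup_qk F qk.
  apply/seteqP; split=> [x Ux|x [qk _]]; last first.
    by rewrite /F; case: asboolP => // + Bx; exact.
  have /nbhs_ballP[r /= r0 xrU] : nbhs x U by exact: open_nbhs_nbhs.
  have [k kr] : exists k : nat, k.+1%:R^-1 < r / 2.
    have r20 : 0 < r / 2 by lra.
    have /= -[N _ /(_ N (leqnn N))/= ?] := near_infty_natSinv_lt (PosNum r20).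
    by exists N.
  have k0 : (0 : R) < k.+1%:R^-1 by rewrite invr_gt0.
  have /choice[q qP] (i : 'I_n) : exists q : rat,
      x 0 i - k.+1%:R^-1 < ratr q < x 0 i + k.+1%:R^-1.
    have xi : x 0 i - k.+1%:R^-1 < x 0 i + k.+1%:R^-1.
      by rewrite ltrBlDr -addrA ltrDl addr_gt0.
    by have [q] := rat_in_itvoo xi; rewrite in_itv /=; exists q.
  exists (\row_i q i, k) => //.
  rewrite /F; case: asboolP => [_|nB]; first by move=> i; rewrite !mxE; have := qP i; move: (k.+1%:R^-1) => e; lra.
  case: nB => y By; apply: xrU; rewrite -ball_normE /=.
  apply: (@le_lt_trans _ _ (2 * k.+1%:R^-1)); last by rewrite -ltr_pdivlMl// mulrC.
  apply/rV_norm_leP => [|i]; first by rewrite mulr_ge0// ltW.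
  by have := By i; have := qP i; rewrite !mxE ler_norml; move: k.+1%:R^-1 => e; lra.
apply: countable_bigcupT_measurable => // qk.
by rewrite /F; case: asboolP => // _; exact: measurable_box.
Qed.

Lemma continuous_measurable_rV (f : 'rV[R]_n -> R) (D : set 'rV[R]_n) :
  continuous f -> measurable_fun D f.
Proof.
move=> /continuousP cf; apply: measurable_funTS.
apply: (measurability _ (RGenOpens.measurableE R)).
move=> _ [_ [a [b ->] <-]]; rewrite setTI; apply: open_measurable_rV.
exact/cf/interval_open.
Qed.

End row_vectors.

(** * Iterated integrals and affine substitutions *)

Section integral_rV.
Context (R : realType).
Notation leb n := (lebesgue_rV R n).
Notation leb1 := (@lebesgue_measure R).
Local Open Scope ereal_scope.

Lemma ge0_integral_rVS n (G : 'rV[R]_n.+1 -> \bar R) :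
  measurable_fun setT G -> (forall x, 0 <= G x) ->
  \int[leb n.+1]_x G x = \int[leb1]_t \int[leb n]_x G (cons_rV (t, x)).
Proof.
move=> mG G0.
have mcons := @measurable_cons_rV R n.
transitivity (\int[(leb1 \x leb n)]_p G (cons_rV p)).
  by rewrite /= /cons_measure ge0_integral_pushforward// => x _; exact: G0.
rewrite (fubini_tonelli1 (G \o @cons_rV R n))//; last by move=> p; exact: G0.
exact: (measurableT_comp mG mcons).
Qed.

Lemma measurable_cons_rV_section n (t : R) :
  measurable_fun setT (fun x : 'rV[R]_n => cons_rV (t : measurableTypeR R, x)).
Proof. exact: (measurableT_comp (@measurable_cons_rV R n) (measurable_pair1 t)). Qed.

Lemma measurable_integral_section n (G : 'rV[R]_n.+1 -> \bar R) :
  measurable_fun setT G -> (forall x, 0 <= G x) ->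
  measurable_fun setT (fun t : measurableTypeR R => \int[leb n]_x G (cons_rV (t, x))).
Proof.
move=> mG G0.
have mcons := @measurable_cons_rV R n.
apply: (measurable_fun_fubini_tonelli_F (G \o @cons_rV R n)) => //.
  exact: (measurableT_comp mG mcons).
by move=> p; exact: G0.
Qed.

(** The image of Lebesgue measure under the affine map, scaled by [|c|], agrees with Lebesgue
    measure on half-open intervals and hence everywhere. A negative [c] exchanges the open and the
    closed end. *)
Lemma ge0_integral_affine1 (c h : R) (g : measurableTypeR R -> \bar R) :
  (c != 0)%R -> measurable_fun setT g -> (forall t, 0 <= g t) ->
  `|c|%:E * \int[leb1]_t g (c * t + h)%R = \int[leb1]_t g t.
Proof.
move=> c0 mg g0.
pose phi (t : measurableTypeR R) : measurableTypeR R := (c * t + h)%R.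
have mphi : measurable_fun setT phi.
  by apply: measurable_funD => //; exact: measurable_funM.
pose m0 : {measure set (measurableTypeR R) -> \bar R} :=
  measure_function_pushforward__canonical__measure_function_Measure leb1 mphi.
pose m : {measure set (measurableTypeR R) -> \bar R} :=
  mscale (NngNum (normr_ge0 c)) m0.
have mE A : measurable A -> leb1 A = m A.
  apply: (@lebesgue_measure_unique R m) => _ [[a b]] _ <-.
  transitivity (`|c|%:E * leb1 (phi @^-1` `]a, b])); last by [].
  rewrite lebesgue_measure_itv /=.
  have [cp|cn] := ltP 0%R c.
    have -> : phi @^-1` `]a, b] = `]((a - h) / c)%R, ((b - h) / c)%R]%classic.
      apply/seteqP; split=> t /=; rewrite !in_itv /= /phi ltr_pdivrMr// ler_pdivlMr//
        mulrC ltrBlDr lerBrDr //.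
    rewrite lebesgue_measure_itv /= !lte_fin ltr_pM2r ?invr_gt0// ltrD2r.
    case: ifP => ab; last by rewrite mule0.
    by rewrite gtr0_norm// -!EFinB -EFinM; congr EFin; field; rewrite gt_eqF.
  have cn' : (c < 0)%R by rewrite lt_neqAle c0 cn.
  have -> : phi @^-1` `]a, b] = `[((b - h) / c)%R, ((a - h) / c)%R[%classic.
    apply/seteqP; split=> t /=; rewrite !in_itv /= /phi ler_ndivrMr// ltr_ndivlMr//
      mulrC ltrBlDr lerBrDr andbC //.
  rewrite lebesgue_measure_itv /= !lte_fin ltr_nM2r ?invr_lt0// ltrD2r.
  case: ifP => ab; last by rewrite mule0.
  by rewrite ltr0_norm// -!EFinB -EFinM; congr EFin; field; rewrite lt_eqF.
have <- : \int[m]_t g t = \int[leb1]_t g t.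
  by apply: eq_measure_integral => A mA _; rewrite -(mE A mA).
by rewrite /m ge0_integral_mscale// ge0_integral_pushforward// => t _; exact: g0.
Qed.

Lemma measurable_affine n (c : R) (h : 'rV[R]_n) :
  measurable_fun setT (fun x : 'rV[R]_n => (c *: x + h)%R).
Proof.
apply/measurable_fun_rVP => i.
under eq_fun do rewrite !mxE.
apply: measurable_funD => //; apply: measurable_funM => //.
exact: measurable_rV_coord.
Qed.

Lemma cons_rV_affine n (c : R) (h : 'rV[R]_n.+1) t (x : 'rV[R]_n) :
  (c *: cons_rV (t : measurableTypeR R, x) + h)%R =
  cons_rV ((c * t + h 0 0)%R : measurableTypeR R, (c *: x + \row_i h 0 (lift 0 i))%R).
Proof.
apply/rowP => i; rewrite mxE [X in (X + _)%R = _]mxE; case: (unliftP 0%R i) => [j ->|->].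
  by rewrite !cons_rVS /= !mxE.
by rewrite !cons_rV0.
Qed.

Lemma ge0_integral_affine n (c : R) (h : 'rV[R]_n) (G : 'rV[R]_n -> \bar R) :
  (c != 0)%R -> measurable_fun setT G -> (forall x, 0 <= G x) ->
  (`|c| ^+ n)%:E * \int[leb n]_x G (c *: x + h)%R = \int[leb n]_x G x.
Proof.
move=> c0; elim: n h G => [|n IH] h G mG G0.
  rewrite expr0 mul1e; apply: eq_integral => x _; congr G.
  by apply/rowP => -[].
have mGa : measurable_fun setT (fun x : 'rV[R]_n.+1 => G (c *: x + h)%R).
  exact: (measurableT_comp mG (@measurable_affine n.+1 c h)).
have mGt t : measurable_fun setT (fun x => G (cons_rV (t : measurableTypeR R, x))).
  exact: (measurableT_comp mG (measurable_cons_rV_section t)).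
rewrite !ge0_integral_rVS//.
rewrite exprS EFinM -muleA -ge0_integralZl//; last 2 first.
- exact: (measurable_integral_section mGa).
- by move=> t _; exact: integral_ge0.
transitivity (`|c|%:E * \int[leb1]_t
    (fun s : measurableTypeR R => \int[leb n]_x G (cons_rV (s, x))) (c * t + h 0 0)%R).
  congr (_ * _); apply: eq_integral => t _.
  under eq_integral do rewrite cons_rV_affine.
  exact: (IH _ (fun x => G (cons_rV (_, x)))).
rewrite (@ge0_integral_affine1 c (h 0%R 0%R)
  (fun t => \int[leb n]_x G (cons_rV (t, x))))//.
- exact: measurable_integral_section.
- by move=> t; exact: integral_ge0.
Qed.

End integral_rV.

(** * Integrals over the torus and their invariance under translations *)

Section torus_integral.
Context (R : realType).
Notation leb n := (lebesgue_rV R n).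
Notation leb1 := (@lebesgue_measure R).

(** Invariance under the unit vectors, a form of periodicity that passes directly to sections in an
    induction on the dimension. *)
Definition coord_periodic n (V : Type) (f : 'rV[R]_n -> V) :=
  forall x i, f (x + delta_mx 0 i) = f x.

Lemma Zd_coord_periodic n (V : Type) (f : 'rV[R]_n -> V) :
  Zd_periodic f -> coord_periodic f.
Proof.
move=> pf x i; rewrite -(pf x (delta_mx 0 i)); congr (f (_ + _)).
by apply/rowP => j; rewrite !mxE; case: (_ && _).
Qed.

Lemma measurable_torus n : measurable (@torus R n).
Proof. exact: measurable_box. Qed.

Lemma lebesgue_torus n : leb n (@torus R n) = 1%E.
Proof.
rewrite lebesgue_rV_box => [|i]; last by rewrite !mxE.
by rewrite big1// => i _; rewrite !mxE subr0.
Qed.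

Local Open Scope ereal_scope.

Lemma ge0_integral_torusS n (G : 'rV[R]_n.+1 -> \bar R) :
  measurable_fun setT G -> (forall x, 0 <= G x) ->
  \int[leb n.+1]_(x in @torus R n.+1) G x =
  \int[leb1]_(t in `[0%R, 1%R]) \int[leb n]_(x in @torus R n) G (cons_rV (t, x)).
Proof.
move=> mG G0.
have mT := @measurable_torus n.+1.
rewrite integral_mkcond ge0_integral_rVS; first last.
- by move=> x; rewrite patchE; case: ifP.
- by apply/(measurable_restrictT _ mT); exact: measurable_funTS.
rewrite [RHS]integral_mkcond; apply: eq_integral => t _.
rewrite [RHS]patchE; case: ifPn => tI.
  rewrite [RHS]integral_mkcond; apply: eq_integral => x _.
  rewrite !patchE.
  suff -> : (cons_rV (t, x) \in @torus R n.+1) = (x \in @torus R n) by [].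
  apply/idP/idP => /set_mem xT; apply/mem_set => i.
    by have := xT (lift 0%R i); rewrite cons_rVS !mxE.
  case: (unliftP 0%R i) => [j ->|->].
    by rewrite cons_rVS !mxE; have := xT j; rewrite !mxE.
  by rewrite cons_rV0 !mxE; move: tI => /set_mem; rewrite /= in_itv.
apply: integral0_eq => x _; rewrite patchE ifN//.
apply: contra tI => /set_mem xT; apply/mem_set.
by have := xT 0%R; rewrite cons_rV0 !mxE /= in_itv.
Qed.

Lemma ge0_integral_shift1 (h : R) (A : set (measurableTypeR R))
    (g : measurableTypeR R -> \bar R) : measurable A ->
  measurable_fun setT g -> (forall t, 0 <= g t) ->
  \int[leb1]_(t in (fun t => (t + h)%R) @^-1` A) g (t + h)%R = \int[leb1]_(t in A) g t.
Proof.
move=> mA mg g0.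
rewrite [RHS]integral_mkcond -(@ge0_integral_affine1 _ 1 h) ?oner_neq0//; first last.
- by move=> t; rewrite patchE; case: ifP.
- by apply/(measurable_restrictT _ mA); exact: measurable_funTS.
rewrite normr1 mul1e integral_mkcond; apply: eq_integral => t _.
by rewrite !patchE mul1r.
Qed.

Lemma ge0_integral_periodic1 (h : R) (g : measurableTypeR R -> \bar R) :
  measurable_fun setT g -> (forall t, 0 <= g t) ->
  (forall t, g (t + 1)%R = g t) ->
  \int[leb1]_(t in `[0%R, 1%R]) g (t + h)%R = \int[leb1]_(t in `[0%R, 1%R]) g t.
Proof.
move=> mg g0 pg.
have pgn (m : nat) t : g (t + m%:R)%R = g t.
  elim: m => [|m IH]; first by rewrite addr0.
  by rewrite -natr1 addrA pg IH.
have pgz (z : int) t : g (t + z%:~R)%R = g t.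
  case: z => m; first exact: pgn.
  by rewrite NegzE mulrNz -(pgn m.+1 (t - m.+1%:~R)%R) subrK.
(* Only the fractional part [k] of the shift matters; the interval []k, 1 + k]] is then cut at 1 and
   its second piece moved back by 1. *)
pose k := (h - (Num.floor h)%:~R)%R.
have k0 : (0 <= k)%R by rewrite subr_ge0 floor_le_tmp.
have k1 : (k < 1)%R by have := floorD1_gt h; rewrite intrD /k; lra.
have -> : \int[leb1]_(t in `[0%R, 1%R]) g (t + h)%R =
    \int[leb1]_(t in `[0%R, 1%R]) g (t + k)%R.
  apply: eq_integral => t _; rewrite -(pgz (Num.floor h) (t + k)%R).
  by rewrite -addrA subrK.
have mg' (D : set (measurableTypeR R)) : measurable_fun D g by exact: measurable_funTS.
have mgk (D : set (measurableTypeR R)) : measurable_fun D (fun t => g (t + k)%R).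
  apply: measurable_funTS; apply: (measurableT_comp mg).
  by apply: measurable_funD.
rewrite -!(@integral_itv_obnd_cbnd _ 0%R); [|exact: mg'|exact: mgk].
have -> : \int[leb1]_(t in `]0%R, 1%R]) g (t + k)%R =
    \int[leb1]_(t in `]k, (1 + k)%R]) g t.
  rewrite -[RHS](@ge0_integral_shift1 k)//; congr (integral _ _ _).
  by apply/seteqP; split=> t /=; rewrite !in_itv /=; lra.
have -> : `]k, (1 + k)%R]%classic = `]k, 1%R]%classic `|` `]1%R, (1 + k)%R]%classic.
  apply/seteqP; split=> t /=; rewrite !in_itv /=; last by case; lra.
  by case: (leP t 1%R) => ? ?; [left|right]; lra.
have -> : `]0%R, 1%R]%classic = `]0%R, k]%classic `|` `]k, 1%R]%classic :> set R.
  apply/seteqP; split=> t /=; rewrite !in_itv /=; last by case; lra.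
  by case: (leP t k) => ? ?; [left|right]; lra.
have dj (a b c : R) : [disjoint `]a, b]%classic & `]b, c]%classic].
  apply/disj_setPS => t [/=]; rewrite !in_itv /= => /andP[_ tb] /andP[bt _].
  by move: (lt_le_trans bt tb); rewrite ltxx.
rewrite !ge0_integral_setU// addeC; congr (_ + _).
rewrite -[LHS](@ge0_integral_shift1 1%R)//.
have -> : (fun t : R => (t + 1)%R) @^-1` `]1%R, (1 + k)%R] = `]0%R, k]%classic.
  by apply/seteqP; split=> t /=; rewrite !in_itv /=; lra.
by apply: eq_integral => t _; exact: pg.
Qed.

Lemma ge0_integral_torus_shift n (h : 'rV[R]_n) (G : 'rV[R]_n -> \bar R) :
  coord_periodic G -> measurable_fun setT G -> (forall x, 0 <= G x) ->
  \int[leb n]_(x in @torus R n) G (x + h)%R = \int[leb n]_(x in @torus R n) G x.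
Proof.
elim: n h G => [|n IH] h G pG mG G0.
  by apply: eq_integral => x _; congr G; apply/rowP => -[].
have mGa : measurable_fun setT (fun x : 'rV[R]_n.+1 => G (x + h)%R).
  have := measurableT_comp mG (@measurable_affine R n.+1 1 h).
  by apply: eq_measurable_fun => x _ /=; rewrite scale1r.
have mGt t : measurable_fun setT (fun x => G (cons_rV (t : measurableTypeR R, x))).
  exact: (measurableT_comp mG (measurable_cons_rV_section t)).
rewrite (ge0_integral_torusS mG G0) (ge0_integral_torusS mGa)//.
pose g (t : measurableTypeR R) := \int[leb n]_(x in @torus R n) G (cons_rV (t, x)).
have mg : measurable_fun setT g.
  (* Cutting [G] off where the last coordinates leave the torus turns [g] into an integral over the
     whole space, whose measurability in [t] is known. *)
  pose G' := G \_ [set x : 'rV[R]_n.+1 | @torus R n (\row_i x 0%R (lift 0%R i))].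
  have mD : measurable [set x : 'rV[R]_n.+1 | @torus R n (\row_i x 0%R (lift 0%R i))].
    rewrite -[X in measurable X]setTI.
    apply: (_ : measurable_fun setT (fun x : 'rV[R]_n.+1 => \row_i x 0%R (lift 0%R i))) => //.
      apply/measurable_fun_rVP => i; under eq_fun do rewrite mxE.
      exact: measurable_rV_coord.
    exact: measurable_torus.
  have mG' : measurable_fun setT G'.
    by apply/(measurable_restrictT _ mD); exact: measurable_funTS.
  have G'0 x : 0 <= G' x by rewrite /G' patchE; case: ifP.
  apply: eq_measurable_fun (measurable_integral_section mG' G'0) => t _.
  rewrite /g [RHS]integral_mkcond; apply: eq_integral => x _; rewrite !patchE.
  have rowE : \row_i cons_rV (t, x) 0%R (lift 0%R i) = x.
    by apply/rowP => i; rewrite mxE cons_rVS.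
  by congr (if _ then _ else _); apply/idP/idP => /set_mem /=;
    rewrite ?rowE => xT; apply/mem_set; rewrite /= ?rowE.
transitivity (\int[leb1]_(t in `[0%R, 1%R]) g (t + h 0%R 0%R)%R).
  apply: eq_integral => t _.
  transitivity (\int[leb n]_(x in @torus R n)
      G (cons_rV ((t + h 0 0)%R, (x + \row_i h 0 (lift 0 i))%R))).
    apply: eq_integral => x _; have := cons_rV_affine 1 h t x.
    by rewrite !scale1r mul1r => ->.
  apply: (IH _ (fun x => G (cons_rV ((t + h 0 0)%R, x)))) => // x i.
  rewrite -[RHS](pG _ (lift 0%R i)); congr G; apply/rowP => j; rewrite [RHS]mxE.
  case: (unliftP 0%R j) => [k ->|->].
    by rewrite !cons_rVS !mxE (inj_eq (@lift_inj _ _)).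
  by rewrite !cons_rV0 !mxE addr0.
rewrite ge0_integral_periodic1//.
- by move=> t; exact: integral_ge0.
- move=> t; apply: eq_integral => x _; rewrite -[RHS](pG _ 0%R); congr G.
  apply/rowP => j; rewrite [RHS]mxE; case: (unliftP 0%R j) => [k ->|->].
    by rewrite !cons_rVS !mxE addr0.
  by rewrite !cons_rV0 !mxE.
Qed.

End torus_integral.

(** * Affine substitutions for real-valued integrands *)

Section real_valued.
Context (R : realType) (n : nat).
Notation leb := (lebesgue_rV R n).
Implicit Types f : 'rV[R]_n -> R.

Lemma integrable_affine (c : R) (h : 'rV[R]_n) f :
  c != 0 -> leb.-integrable setT (EFin \o f) ->
  leb.-integrable setT (EFin \o (fun x => f (c *: x + h))).
Proof.
move=> c0 /integrableP[mf fi]; have mf' : measurable_fun setT f by apply/measurable_EFinP.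
apply/integrableP; split.
  exact: (measurableT_comp mf (measurable_affine c h)).
have := @ge0_integral_affine R n c h (fun x => `|(f x)%:E|%E) c0.
have cn : 0 < `|c| ^+ n by rewrite exprn_gt0// normr_gt0.
move=> /(_ (measurableT_comp (@abse_measurable _ _) mf) (fun=> abse_ge0 _)) E.
move: fi; rewrite -E /=; set I := (\int[_]_x _)%E.
move=> H; rewrite ltey; apply/eqP => Ioo; move: H.
by rewrite Ioo gt0_muley ?lte_fin// ltxx.
Qed.

Lemma Rintegral_affine (c : R) (h : 'rV[R]_n) f :
  c != 0 -> measurable_fun setT f ->
  `|c| ^+ n * \int[leb]_x f (c *: x + h) = \int[leb]_x f x.
Proof.
move=> c0 mf; have mf' : measurable_fun setT (EFin \o f) by apply/measurable_EFinP.
have cn : 0 < `|c| ^+ n by rewrite exprn_gt0// normr_gt0.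
have G0 x : (0 <= (EFin \o f)^\+ x)%E by exact: funepos_ge0.
have G1 x : (0 <= (EFin \o f)^\- x)%E by exact: funeneg_ge0.
have H0 := @ge0_integral_affine R n c h _ c0 (measurable_funepos mf') G0.
have H1 := @ge0_integral_affine R n c h _ c0 (measurable_funeneg mf') G1.
rewrite /Rintegral [in LHS]integralE [in RHS]integralE -H0 -H1.
have -> : ((EFin \o (fun x => f (c *: x + h)%R))^\+ = fun x => (EFin \o f)^\+ (c *: x + h)%R)%E.
  by apply/funext => x; rewrite !funeposE.
have -> : ((EFin \o (fun x => f (c *: x + h)%R))^\- = fun x => (EFin \o f)^\- (c *: x + h)%R)%E.
  by apply/funext => x; rewrite !funenegE.
set I := (\int[_]_x _)%E; set I' := (\int[_]_x _)%E.
have cnE : (0 < (`|c| ^+ n)%:E)%E by rewrite lte_fin.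
(* A positive finite factor preserves infinite values and [fine] maps both of them to 0, so the
   identity persists when one of the parts diverges. *)
case: I I' => [r| |] [r'| |]; rewrite ?(gt0_muley cnE) ?(gt0_muleNy cnE)/= ?mulr0//.
exact: mulrBr.
Qed.

Lemma Rintegral_isometry (c : R) (h : 'rV[R]_n) f :
  `|c| = 1 -> measurable_fun setT f ->
  \int[leb]_x f (c *: x + h) = \int[leb]_x f x.
Proof.
move=> c1 mf; have c0 : c != 0 by rewrite -normr_eq0 c1 oner_neq0.
by rewrite -(Rintegral_affine h c0 mf) c1 expr1n mul1r.
Qed.

End real_valued.

(** * An integrable weight of polynomial decay *)

Section weight.
Context (R : realType) (n : nat).
Notation leb := (lebesgue_rV R n).
Implicit Types z h : 'rV[R]_n.

Definition weight (s : R) z : R := (1 + `|z|) `^ (- (n%:R + s)).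

Lemma weight_gt0 s z : 0 < weight s z.
Proof. by apply: powR_gt0; rewrite ltr_wpDr. Qed.

Lemma continuous_weight s : continuous (weight s).
Proof.
move=> z; apply: (@continuous_comp _ _ _ (fun z : 'rV[R]_n => 1 + `|z|)
  (fun t : R => t `^ (- (n%:R + s)))).
  apply: continuousD; first exact: cst_continuous.
  exact: norm_continuous.
have t0 : 0 < 1 + `|z| by rewrite ltr_wpDr.
apply: differentiable_continuous; apply/derivable1_diffP; apply: derivable_powR.
by rewrite in_itv /= t0.
Qed.

Lemma weight_shift s z h : 0 <= s -> `|h| <= 1 ->
  weight s z <= 2 `^ (n%:R + s) * weight s (z + h).
Proof.
move=> s0 h1; rewrite /weight !powRN.
rewrite ler_pdivlMr ?powR_gt0 ?ltr_wpDr// mulrC ler_pdivrMr ?powR_gt0 ?ltr_wpDr//.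
rewrite -powRM//.
apply: ge0_ler_powR; rewrite ?nnegrE ?addr_ge0// ?mulr_ge0// ?addr_ge0//.
by have := ler_normD z h; have := normr_ge0 z; lra.
Qed.

(** Dyadic decomposition: where 2^(k-1) < |z| <= 2^k the weight is at most [q ^+ (k - 1)] with q =
    2^-(n+s), and the cube |z| <= 2^k has volume 2^n 2^(kn). The products form a geometric series of
    ratio [r], which is 2^-s. *)
Lemma weight_integrable s : 0 < s -> leb.-integrable setT (EFin \o weight s).
Proof.
move=> s0.
have mw : measurable_fun setT (EFin \o weight s).
  by apply/measurable_EFinP; apply: continuous_measurable_rV; exact: continuous_weight.
apply/integrableP; split => //.
pose r : R := 2 `^ (- s).
have r0 : 0 < r by exact: powR_gt0.
have r1 : r < 1.
  rewrite /r powRN invf_lt1 ?powR_gt0//.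
  by have := @gt0_ltr_powR R s s0 1 2; rewrite powR1; apply; rewrite ?nnegrE ?ltr1n.
pose q : R := r / 2 ^+ n.
have q0 : 0 < q by rewrite divr_gt0// exprn_gt0.
pose bx (k : nat) : set 'rV[R]_n := box (const_mx (- 2 ^+ k)) (const_mx (2 ^+ k)).
(* [q ^+ k / q] is [q ^+ (k - 1)] in a form that makes sense for [k = 0], where its value [1 / q] is
   at least 1 and so dominates the weight. *)
pose term (k : nat) (z : 'rV[R]_n) : \bar R := (q ^+ k / q * \1_(bx k) z)%:E.
have term0 k z : (0 <= term k z)%E.
  by rewrite lee_fin mulr_ge0// ?divr_ge0// ?exprn_ge0// ltW.
have mterm k : measurable_fun setT (term k).
  apply/measurable_EFinP; apply: measurable_funM => //.
  exact: measurable_indic (measurable_box _ _).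
have wterm z : (`|(weight s z)%:E| <= \sum_(k <oo) term k z)%E.
  have exk : exists k, `|z| <= 2 ^+ k.
    exists (Num.truncn `|z|).+1; rewrite ltW//.
    apply: (@lt_trans _ _ (Num.truncn `|z|).+1%:R); first by rewrite real_truncnS_gt.
    by rewrite -natrX ltr_nat ltn_expl.
  case: (ex_minnP exk) => k zk kmin.
  apply: le_trans (_ : (term k z <= _)%E); last first.
    rewrite (le_trans _ (nneseries_lim_ge k.+1 _))//.
    by rewrite big_nat_recr//= leeDr// sume_ge0.
  have zb : z \in bx k.
    apply/mem_set => i; rewrite !mxE -ler_norml.
    exact: le_trans (rV_coord_le z i) zk.
  rewrite /term indicE zb mulr1 lee_fin gtr0_norm ?weight_gt0//.
  case: k => [|k] in zk kmin zb *.
    rewrite expr0 mul1r (@le_trans _ _ 1)//.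
      rewrite /weight powRN invf_le1 ?powR_gt0 ?ltr_wpDr//.
      rewrite -[leLHS](powRr0 (1 + `|z|)) ler_powR//; first by rewrite lerDl.
      by rewrite addr_ge0// ltW.
    rewrite invf_ge1// /q ler_pdivrMr ?exprn_gt0// mul1r (le_trans (ltW r1))//.
    by rewrite exprn_ege1// ler1n.
  rewrite exprS mulrAC divff ?gt_eqF// mul1r.
  have zk' : 2 ^+ k < `|z|.
    by rewrite ltNge; apply/negP => /kmin; rewrite ltnn.
  have k1 : 0 <= 1 + `|z| by rewrite addr_ge0.
  apply: (@le_trans _ _ ((2 ^+ k) `^ (- (n%:R + s)))).
    rewrite /weight !powRN lef_pV2 ?posrE ?powR_gt0 ?exprn_gt0// ?ltr_wpDr//.
    apply: ge0_ler_powR; rewrite ?nnegrE ?exprn_ge0 ?addr_ge0// ?(ltW s0)//.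
    by rewrite (le_trans (ltW zk'))// lerDr.
  rewrite -powR_mulrn// -powRrM mulrC powRrM powR_mulrn ?powR_ge0//.
  apply: lerXn2r; rewrite ?nnegrE ?powR_ge0 ?(ltW q0)//.
  by rewrite opprD powRD; [rewrite [_ `^ (- n%:R)]powRN powR_mulrn// /q /r mulrC|rewrite pnatr_eq0 implybT].
apply: (@le_lt_trans _ _ (\int[leb]_z (\sum_(k <oo) term k z))%E).
  apply: ge0_le_integral => //.
  - exact: measurableT_comp.
  - by apply: ge0_emeasurable_sum => // k z _ _; exact: term0.
  - by move=> z _; exact: wterm.
rewrite integral_nneseries//.
have It k : (\int[leb]_z term k z = (2 ^+ n / q * r ^+ k)%:E)%E.
  under eq_integral do rewrite /term EFinM.
  have mi : measurable_fun setT (fun z => (\1_(bx k) z)%:E : \bar R).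
    by apply/measurable_EFinP; exact: measurable_indic (measurable_box _ _).
  rewrite (ge0_integralZl _ _ mi)//; last first.
    by rewrite lee_fin divr_ge0// ?exprn_ge0// ltW.
  rewrite integral_indic//; last exact: measurable_box.
  have vol : leb (bx k) = (\prod_(i < n) ((const_mx (2 ^+ k) : 'rV[R]_n) 0 i -
      (const_mx (- 2 ^+ k) : 'rV[R]_n) 0 i))%:E.
    rewrite [LHS]lebesgue_rV_box// => i; rewrite !mxE.
    by have : (0 : R) <= 2 ^+ k by []; lra.
  rewrite setIT [X in (_ * X)%E]vol (eq_bigr (fun=> 2 * 2 ^+ k)); last first.
    by move=> i _; rewrite !mxE; ring.
  rewrite prodr_const card_ord -EFinM; congr EFin.
  rewrite /q !expr_div_n !exprMn -!exprM (mulnC n k).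
  by field; rewrite ?gt_eqF ?expf_neq0 ?pnatr_eq0//= gt_eqF.
under eq_eseriesr do rewrite It.
have C0 : 0 <= 2 ^+ n / q by rewrite divr_ge0// ?exprn_ge0// ltW.
apply: (@le_lt_trans _ _ (2 ^+ n / q / (1 - r))%:E); last exact: ltry.
apply: lime_le.
  by apply: is_cvg_nneseries => k _ _; rewrite lee_fin mulr_ge0// exprn_ge0// ltW.
apply: nearW => N; rewrite sumEFin lee_fin -mulr_sumr ler_wpM2l//.
rewrite big_mkord -[leRHS]mul1r ler_pdivlMr ?subr_gt0//.
rewrite mulrC -opprB mulNr -subrX1 opprB lerBlDr lerDl exprn_ge0//; exact: ltW.
Qed.

End weight.

(** * The medium and integrals against its kernel *)

Record medium (R : realType) (d : nat) (a lambda mu : 'rV[R]_d -> R)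
    (C delta alpha1 alpha2 : R) : Prop := Medium {
  medium_a_cont : continuous a;
  medium_a_even : forall x, a x = a (- x);
  medium_a_ge0 : forall x, 0 <= a x;
  medium_a_int_gt0 : 0 < \int[lebesgue_rV R d]_x a x;
  medium_delta_gt2 : 2 < delta;
  medium_a_decay : forall x, a x <= C / (1 + eucl_norm x `^ (d%:R + delta));
  medium_lambda_cont : continuous lambda;
  medium_mu_cont : continuous mu;
  medium_lambda_periodic : Zd_periodic lambda;
  medium_mu_periodic : Zd_periodic mu;
  medium_alpha1_gt0 : 0 < alpha1;
  medium_lambda_bounds : forall x, alpha1 <= lambda x <= alpha2;
  medium_mu_bounds : forall x, alpha1 <= mu x <= alpha2
}.

Lemma medium_alpha2_gt0 (R : realType) d (a lambda mu : 'rV[R]_d -> R) (C delta alpha1 alpha2 : R) :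
  medium a lambda mu C delta alpha1 alpha2 -> 0 < alpha2.
Proof.
move=> M; have /andP[m1 m2] := medium_mu_bounds M 0.
exact: lt_le_trans (medium_alpha1_gt0 M) (le_trans m1 m2).
Qed.

Section kernel_integral.
Context (R : realType) (d : nat) (a lambda mu : 'rV[R]_d -> R) (C delta alpha1 alpha2 : R).
Notation leb := (lebesgue_rV R d).
Hypothesis M : medium a lambda mu C delta alpha1 alpha2.
Let a_cont := medium_a_cont M.
Let a_ge0 := medium_a_ge0 M.
Let delta_gt2 := medium_delta_gt2 M.
Let a_decay := medium_a_decay M.
Let mu_cont := medium_mu_cont M.
Let alpha1_gt0 := medium_alpha1_gt0 M.
Let mu_bounds := medium_mu_bounds M.

(** The factor of degree 2 is the cost of a second-order expansion. It leaves the decay exponent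
    [d + (delta - 2)], which is integrable as [delta > 2]. The decay hypothesis, in the Euclidean
    norm, passes to the max norm of [weight], which is the smaller of the two. *)
Lemma kernel_weight : exists2 K : R, 0 < K &
  forall z, a z * (1 + `|z|) ^+ 2 <= K * weight (delta - 2) z.
Proof.
pose p := d%:R + delta.
have p0 : 0 < p by rewrite ltr_wpDl//; have := delta_gt2; lra.
have C0 : 0 <= C.
  have e0 : 0 < 1 + eucl_norm (0 : 'rV[R]_d) `^ p by rewrite ltr_pwDl// powR_ge0.
  by have := le_trans (a_ge0 0) (a_decay 0); rewrite pmulr_lge0 ?invr_gt0.
exists (C * 2 `^ p + 1); first by rewrite ltr_wpDl// mulr_ge0// powR_ge0.
move=> z; have z1 : 0 < 1 + `|z| by rewrite ltr_wpDr.
have wE : weight (delta - 2) z = (1 + `|z|) ^+ 2 / (1 + `|z|) `^ p.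
  rewrite /weight -powR_mulrn ?(ltW z1)// -powRB; last by apply/implyP => _; rewrite gt_eqF.
  by congr (_ `^ _); rewrite /p; lra.
have zp : 0 < (1 + `|z|) `^ p by rewrite powR_gt0.
have ez : `|z| `^ p <= eucl_norm z `^ p.
  by apply: ge0_ler_powR; rewrite ?nnegrE ?(ltW p0)// ?sqrtr_ge0// rV_norm_eucl.
have pz : (1 + `|z|) `^ p <= 2 `^ p * (1 + eucl_norm z `^ p).
  apply: (@le_trans _ _ (2 `^ p * Num.max 1 (`|z| `^ p))); last first.
    rewrite ler_pM2l ?powR_gt0// ge_max lerDl powR_ge0/=.
    by rewrite (le_trans ez)// lerDr.
  have [z1'|z1'] := leP `|z| 1.
    apply: (@le_trans _ _ (2 `^ p)).
      by apply: ge0_ler_powR; rewrite ?nnegrE ?(ltW p0) ?(ltW z1)//; lra.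
    by rewrite ler_peMr ?powR_ge0// le_max lexx.
  apply: (@le_trans _ _ (2 `^ p * `|z| `^ p)).
    rewrite -powRM//.
    by apply: ge0_ler_powR; rewrite ?nnegrE ?(ltW p0) ?(ltW z1)//; lra.
  by rewrite ler_pM2l ?powR_gt0// le_max lexx orbT.
have az : a z <= C * 2 `^ p / (1 + `|z|) `^ p.
  apply: le_trans (a_decay z) _; rewrite -mulrA ler_wpM2l//.
  rewrite ler_pdivlMr// mulrC ler_pdivrMr//.
  by rewrite ltr_pwDl// powR_ge0.
rewrite wE (mulrC (a z)) [leRHS]mulrCA ler_pM2l ?exprn_gt0//.
apply: le_trans az _; rewrite ler_pM2r ?invr_gt0//; lra.
Qed.

(** Quadratic growth is that of the second-order terms of the ansatz, and [kernel_weight] makes it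
    integrable against [a]. *)
Definition admissible (g : 'rV[R]_d -> R) :=
  measurable_fun setT g /\ exists B : R, forall z, `|g z| <= B * (1 + `|z|) ^+ 2.

Lemma measurable_a : measurable_fun setT a.
Proof. exact: continuous_measurable_rV. Qed.

Lemma integrable_kernelM g : admissible g ->
  leb.-integrable setT (EFin \o (fun z => a z * g z)).
Proof.
move=> [mg [B gB]]; have [K K0 aK] := kernel_weight.
have s0 : 0 < delta - 2 by rewrite subr_gt0.
have iw := weight_integrable d s0.
have := integrableZl measurableT (`|B| * K) iw.
apply: le_integrable => //.
  by apply/measurable_EFinP; apply: measurable_funM => //; exact: measurable_a.
move=> z _ /=; rewrite lee_fin normrM ger0_norm//.
rewrite [leRHS]ger0_norm; last by rewrite mulr_ge0 ?(ltW (weight_gt0 _ _)) ?mulr_ge0 ?(ltW K0).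
apply: (@le_trans _ _ (`|B| * (a z * (1 + `|z|) ^+ 2))); last first.
  by rewrite -mulrA ler_wpM2l.
rewrite mulrCA ler_wpM2l// (le_trans (gB z))// ler_wpM2r// ?ler_norm//.
Qed.

Lemma admissibleD g h : admissible g -> admissible h ->
  admissible (fun z => g z + h z).
Proof.
move=> [mg [B gB]] [mh [B' hB]]; split; first exact: measurable_funD.
by exists (B + B') => z; rewrite mulrDl (le_trans (ler_normD _ _))// lerD.
Qed.

Lemma admissibleM_bounded (b g : 'rV[R]_d -> R) : measurable_fun setT b ->
  (exists B : R, forall z, `|b z| <= B) -> admissible g ->
  admissible (fun z => b z * g z).
Proof.
move=> mb [B bB] [mg [B' gB]]; split; first exact: measurable_funM.
exists (B * B') => z; rewrite normrM -mulrA ler_pM//.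
Qed.

Lemma admissibleZ c g : admissible g -> admissible (fun z => c * g z).
Proof. by apply: admissibleM_bounded => //; exists `|c|. Qed.

Lemma admissibleB g h : admissible g -> admissible h ->
  admissible (fun z => g z - h z).
Proof.
move=> ag /(admissibleZ (-1)) ah; have := admissibleD ag ah.
by under eq_fun do rewrite mulN1r.
Qed.

Lemma admissible_bounded (g : 'rV[R]_d -> R) : measurable_fun setT g ->
  (exists B : R, forall z, `|g z| <= B) -> admissible g.
Proof.
move=> mg [B gB]; split => //; exists B => z.
have B0 : 0 <= B by exact: le_trans (gB 0).
by rewrite (le_trans (gB z))// ler_peMr// exprn_ege1// lerDl.
Qed.

Lemma admissible_cst c : admissible (fun=> c).
Proof. by apply: admissible_bounded => //; exists `|c|. Qed.

Lemma measurable_norm_rV : measurable_fun setT (fun z : 'rV[R]_d => `|z|).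
Proof. by apply: continuous_measurable_rV; exact: norm_continuous. Qed.

Lemma admissible_sqr_norm : admissible (fun z : 'rV[R]_d => (1 + `|z|) ^+ 2).
Proof.
split; last by exists 1 => z; rewrite mul1r ger0_norm// sqr_ge0.
by apply/measurable_funX/measurable_funD => //; exact: measurable_norm_rV.
Qed.

Lemma admissible_coord i : admissible (fun z => z 0 i).
Proof.
split; first exact: measurable_rV_coord.
exists 1 => z; rewrite mul1r (le_trans (rV_coord_le z i))//.
have := normr_ge0 z; nra.
Qed.

Lemma admissible_coord2 i j : admissible (fun z => z 0 i * z 0 j).
Proof.
split; first by apply: measurable_funM; exact: measurable_rV_coord.
exists 1 => z; rewrite mul1r normrM.
have := rV_coord_le z i; have := rV_coord_le z j.
have := normr_ge0 (z 0 i); have := normr_ge0 (z 0 j); nra.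
Qed.

Lemma mu_bounded : exists B : R, forall z, `|mu z| <= B.
Proof.
exists alpha2 => z; have /andP[m1 m2] := mu_bounds z.
by rewrite ger0_norm// (le_trans (ltW alpha1_gt0)).
Qed.

Lemma measurable_mu_shift xi : measurable_fun setT (fun z : 'rV[R]_d => mu (xi - z)).
Proof.
have mmu : measurable_fun setT mu by exact: continuous_measurable_rV.
have := measurableT_comp mmu (@measurable_affine R d (-1) xi).
by apply: eq_measurable_fun => z _ /=; rewrite scaleN1r addrC.
Qed.

Lemma admissible_mu xi g : admissible g -> admissible (fun z => mu (xi - z) * g z).
Proof.
apply: admissibleM_bounded; first exact: measurable_mu_shift.
by have [B HB] := mu_bounded; exists B.
Qed.

(** The integral of the operator in the jump variable [z = xi - q]: the kernel [a z] no longer moves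
    with [xi], which suits dominated convergence. *)
Definition J (xi : 'rV[R]_d) (g : 'rV[R]_d -> R) : R :=
  \int[leb]_z (a z * (mu (xi - z) * g z)).

Lemma J_integrable xi g : admissible g ->
  leb.-integrable setT (EFin \o (fun z => a z * (mu (xi - z) * g z))).
Proof. by move=> /(admissible_mu xi)/integrable_kernelM. Qed.

Lemma JD xi g h : admissible g -> admissible h ->
  J xi (fun z => g z + h z) = J xi g + J xi h.
Proof.
move=> ag ah; rewrite /J -RintegralD//; [|exact: J_integrable..].
by apply: eq_Rintegral => z _; rewrite !mulrDr.
Qed.

Lemma JZ xi c g : admissible g -> J xi (fun z => c * g z) = c * J xi g.
Proof.
move=> ag; rewrite /J -RintegralZl//; last exact: J_integrable.
by apply: eq_Rintegral => z _; rewrite !(mulrCA c).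
Qed.

Lemma J_cst xi c : J xi (fun=> c) = c * J xi (fun=> 1).
Proof.
by rewrite -JZ; [apply: eq_Rintegral => z _; rewrite mulr1|exact: admissible_cst].
Qed.

Lemma JB xi g h : admissible g -> admissible h ->
  J xi (fun z => g z - h z) = J xi g - J xi h.
Proof.
move=> ag ah; rewrite -mulN1r -(JZ _ _ ah) -JD//; last exact: admissibleZ.
by apply: eq_Rintegral => z _; rewrite mulN1r.
Qed.

Lemma J_sum (I : finType) xi (g : I -> 'rV[R]_d -> R) :
  (forall i, admissible (g i)) ->
  admissible (fun z => \sum_i g i z) /\
  J xi (fun z => \sum_i g i z) = \sum_i J xi (g i).
Proof.
move=> ag.
have E0 : J xi (fun=> 0) = 0.
  by rewrite /J; under eq_Rintegral do rewrite !mulr0; rewrite Rintegral_cst// mul0r.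
have key (r : seq I) : admissible (fun z => \sum_(i <- r) g i z) /\
    J xi (fun z => \sum_(i <- r) g i z) = \sum_(i <- r) J xi (g i).
  elim: r => [|i r [IH1 IH2]].
    under eq_fun do rewrite big_nil.
    by rewrite big_nil; split; [exact: admissible_cst|exact: E0].
  under eq_fun do rewrite big_cons; rewrite big_cons.
  split; first exact: admissibleD.
  by rewrite JD// IH2.
exact: key.
Qed.

Lemma J_le xi g h : admissible g -> admissible h -> (forall z, g z <= h z) ->
  J xi g <= J xi h.
Proof.
move=> ag ah gh; apply: le_Rintegral => //; [exact: J_integrable..|move=> z _].
by rewrite ler_wpM2l// ler_wpM2l//; have := mu_bounds (xi - z); have := alpha1_gt0; lra.
Qed.

Lemma J_norm_le xi g h : admissible g -> admissible h -> (forall z, `|g z| <= h z) ->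
  `|J xi g| <= alpha2 * \int[leb]_z (a z * h z).
Proof.
move=> ag ah gh; apply: le_trans (le_normr_Rintegral _ (J_integrable xi ag)) _ => //.
rewrite -RintegralZl//; last exact: integrable_kernelM.
apply: le_Rintegral => //.
- exact: (integrable_norm (J_integrable xi ag)).
- by have := integrableZl measurableT alpha2 (integrable_kernelM ah).
move=> z _; have /andP[m1 m2] := mu_bounds (xi - z).
have m0 : 0 <= mu (xi - z) by exact: le_trans (ltW alpha1_gt0) m1.
by rewrite !normrM ger0_norm// (ger0_norm m0) mulrCA ler_pM ?mulr_ge0// ler_wpM2l.
Qed.

Lemma J_continuous (V : normedModType R) (xi : V -> 'rV[R]_d)
    (F : V -> 'rV[R]_d -> R) (B : R) (x : V) :
  {for x, continuous xi} -> (forall z, {for x, continuous (F ^~ z)}) ->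
  (forall v, measurable_fun setT (F v)) ->
  (forall v z, `|F v z| <= B * (1 + `|z|) ^+ 2) ->
  {for x, continuous (fun v => J (xi v) (F v))}.
Proof.
move=> cxi cF mF FB.
have aF v : admissible (F v) by split => //; exists B.
have aB := admissibleZ alpha2 (admissibleZ B admissible_sqr_norm).
apply: (@continuous_Rintegral R _ _ leb V setT _ (fun z => a z * (alpha2 * (B * (1 + `|z|) ^+ 2))) x 1) => //.
- move=> v; have := J_integrable (xi v) (aF v) => /integrableP[+ _].
  by move/measurable_EFinP.
- move=> z _; apply: continuousM; first exact: cst_continuous.
  apply: continuousM; last exact: cF.
  apply: (@continuous_comp _ _ _ (fun v => xi v - z) mu); last exact: mu_cont.
  by apply: continuousB => //; exact: cst_continuous.
- exact: integrable_kernelM.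
move=> v z _ _; have /andP[m1 m2] := mu_bounds (xi v - z).
have m0 : 0 <= mu (xi v - z) by exact: le_trans (ltW alpha1_gt0) m1.
by rewrite !normrM ger0_norm// (ger0_norm m0) ler_wpM2l// ler_pM.
Qed.

End kernel_integral.

(** * Operations on continuous functions and on functions vanishing at infinity *)

Section continuity_closure.
Context (R : realType) (d : nat).
Implicit Types f g : 'rV[R]_d -> R.

Lemma rV_continuousD f g : continuous f -> continuous g ->
  continuous (fun x => f x + g x).
Proof. by move=> cf cg x; apply: continuousD; [exact: cf|exact: cg]. Qed.

Lemma rV_continuousB f g : continuous f -> continuous g ->
  continuous (fun x => f x - g x).
Proof. by move=> cf cg x; apply: continuousB; [exact: cf|exact: cg]. Qed.

Lemma rV_continuousM f g : continuous f -> continuous g ->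
  continuous (fun x => f x * g x).
Proof. by move=> cf cg x; apply: continuousM; [exact: cf|exact: cg]. Qed.

Lemma rV_continuousZ (c : R) f : continuous f -> continuous (fun x => c * f x).
Proof.
by move=> cf x; apply: continuousM; [exact: cst_continuous|exact: cf].
Qed.

Lemma rV_continuous_sum (I : Type) (r : seq I) (P : pred I) (f : I -> 'rV[R]_d -> R) :
  (forall i, continuous (f i)) -> continuous (fun x => \sum_(i <- r | P i) f i x).
Proof.
move=> cf; elim: r => [|i r IH].
  by under eq_fun do rewrite big_nil; exact: cst_continuous.
under eq_fun do rewrite big_cons.
by case: (P i) => //; exact: rV_continuousD.
Qed.

Lemma rV_continuous_affine f (c : R) (h : 'rV[R]_d) : continuous f ->
  continuous (fun x : 'rV[R]_d => f (c *: x + h)).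
Proof.
move=> cf x; apply: (@continuous_comp _ _ _ (fun x : 'rV[R]_d => c *: x + h) f); last exact: cf.
apply: continuousD; last exact: cst_continuous.
exact: scaler_continuous.
Qed.

Lemma rV_continuous_shift f (h : 'rV[R]_d) : continuous f ->
  continuous (fun x : 'rV[R]_d => f (x - h)).
Proof.
move=> /(@rV_continuous_affine _ 1 (- h)).
by under [in X in X -> _]eq_fun do rewrite scale1r.
Qed.

End continuity_closure.

Section vanishing_closure.
Context (R : realType) (d : nat).
Implicit Types u v : 'rV[R]_d -> R.

Lemma vanishingD u v : vanishing_at_infinity u -> vanishing_at_infinity v ->
  vanishing_at_infinity (fun x => u x + v x).
Proof.
move=> vu vv e e0; have e2 : 0 < e / 2 by lra.
have [M HM] := vu _ e2; have [N HN] := vv _ e2.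
exists (Num.max M N) => x; rewrite gt_max => /andP[/HM ux /HN vx].
by rewrite [e]splitr (le_lt_trans (ler_normD _ _))// ltrD.
Qed.

Lemma vanishingM_bounded (b : 'rV[R]_d -> R) u (B : R) : (forall x, `|b x| <= B) ->
  vanishing_at_infinity u -> vanishing_at_infinity (fun x => b x * u x).
Proof.
move=> bB vu e e0.
have B0 : 0 <= B by exact: le_trans (bB 0).
have B1 : 0 < B + 1 by lra.
have eB : 0 < e / (B + 1) by rewrite divr_gt0.
have [M HM] := vu _ eB; exists M => x /HM ux; rewrite normrM.
apply: (@le_lt_trans _ _ ((B + 1) * `|u x|)).
  by rewrite ler_wpM2r// (le_trans (bB x))// lerDl.
by rewrite mulrC -ltr_pdivlMr.
Qed.

Lemma vanishing_shift u h : vanishing_at_infinity u ->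
  vanishing_at_infinity (fun x => u (x - h)).
Proof.
move=> vu e e0; have [M HM] := vu _ e0.
exists (M + `|h|) => x xM; apply: HM.
by have := ler_normD (x - h) h; rewrite subrK; lra.
Qed.

Lemma vanishing_sum (I : Type) (r : seq I) (P : pred I) (u : I -> 'rV[R]_d -> R) :
  (forall i, vanishing_at_infinity (u i)) ->
  vanishing_at_infinity (fun x => \sum_(i <- r | P i) u i x).
Proof.
move=> vu; elim: r => [|i r IH].
  by move=> e e0; exists 0 => x _; rewrite big_nil normr0.
under eq_fun do rewrite big_cons.
by case: (P i) => //; exact: vanishingD.
Qed.

End vanishing_closure.

(** * The rescaled operator: stability of the space and dissipativity *)

Section rescaled_operator.
Context (R : realType) (d : nat) (a lambda mu : 'rV[R]_d -> R) (C delta alpha1 alpha2 : R).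
Notation leb := (lebesgue_rV R d).
Hypothesis M : medium a lambda mu C delta alpha1 alpha2.
Let a_ge0 := medium_a_ge0 M.
Let a_int_gt0 := medium_a_int_gt0 M.
Let lambda_cont := medium_lambda_cont M.
Let alpha1_gt0 := medium_alpha1_gt0 M.
Let lambda_bounds := medium_lambda_bounds M.
Let mu_bounds := medium_mu_bounds M.
Local Notation J := (J a mu).

Let alpha2_gt0 := medium_alpha2_gt0 M.

Lemma integral_a_ge0 : 0 <= \int[leb]_z a z.
Proof. exact: ltW. Qed.

Lemma J1_bounds xi :
  alpha1 * \int[leb]_z a z <= J xi (fun=> 1) <= alpha2 * \int[leb]_z a z.
Proof.
have ia : leb.-integrable setT (EFin \o a).
  have := integrable_kernelM M (admissible_cst _ 1).
  by apply: eq_integrable => // z _; rewrite /= mulr1.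
have i1 := J_integrable M xi (admissible_cst _ 1).
have iZ c : leb.-integrable setT (EFin \o (fun z => c * a z)).
  by have := integrableZl measurableT c ia.
rewrite -!RintegralZl//; apply/andP; split; apply: le_Rintegral => // z _;
  by rewrite mulr1 (mulrC (a z)) ler_wpM2r//; have /andP[] := mu_bounds (xi - z).
Qed.

Lemma J1_gt0 xi : 0 < J xi (fun=> 1).
Proof.
by have /andP[+ _] := J1_bounds xi; apply: lt_le_trans; rewrite mulr_gt0.
Qed.

Variables (eps : R) (eps_gt0 : 0 < eps).

Lemma admissible_increment (u : 'rV[R]_d -> R) (B : R) x : measurable_fun setT u ->
  (forall y, `|u y| <= B) -> admissible (fun z => u (x - eps *: z) - u x).
Proof.
move=> mu' uB; apply: admissible_bounded.
  apply: measurable_funB => //.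
  have := measurableT_comp mu' (@measurable_affine R d (- eps) x).
  by apply: eq_measurable_fun => z _ /=; rewrite scaleNr addrC.
by exists (B + B) => z; rewrite (le_trans (ler_normB _ _))// lerD.
Qed.

(** The substitution [y = x - eps *: z] absorbs [d] of the [d + 2] powers of [eps] in its
    Jacobian. *)
Lemma LepsE (u : 'rV[R]_d -> R) (B : R) x : measurable_fun setT u ->
  (forall y, `|u y| <= B) ->
  Leps a lambda mu eps u x = (eps ^+ 2)^-1 * lambda (eps^-1 *: x) *
    J (eps^-1 *: x) (fun z => u (x - eps *: z) - u x).
Proof.
move=> mu' uB; have e0 : eps != 0 by rewrite gt_eqF.
rewrite /Leps; set f := (fun y => _).
set xi := eps^-1 *: x.
have fE z : f (- eps *: z + x) = lambda xi * (a z * (mu (xi - z) * (u (x - eps *: z) - u x))).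
  have -> : - eps *: z + x = x - eps *: z by rewrite scaleNr addrC.
  rewrite /f opprB [x + _]addrC subrK scalerA mulVf// scale1r.
  rewrite scalerBr scalerA mulVf// scale1r -/xi; ring.
have iJ := J_integrable M xi (admissible_increment x mu' uB).
have mF : measurable_fun setT (fun z : 'rV[R]_d => f (- eps *: z + x)).
  have /integrableP[/measurable_EFinP mJ _] := iJ.
  by under eq_fun do rewrite fE; exact: measurable_funM.
have ne0 : - eps != 0 by rewrite oppr_eq0.
have mf : measurable_fun setT f.
  have := measurableT_comp mF (measurable_affine (- eps)^-1 (- ((- eps)^-1 *: x))).
  apply: eq_measurable_fun => y _ /=.
  by rewrite scalerBr !scalerA divff// !scale1r subrK.
rewrite -(Rintegral_affine x ne0 mf).
under eq_Rintegral do rewrite fE.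
rewrite RintegralZl// -/(J _ _) normrN gtr0_norm// exprD invfM.
rewrite (mulrC (_ ^-1 : R)) !mulrA; congr (_ * _ * _).
by rewrite -mulrA mulVf ?mulr1// expf_neq0.
Qed.

(** Makes the operator everywhere defined on the space, so that every function lies in the domain of
    the generator. Continuity and decay both follow by dominated convergence. *)
Lemma Leps_C0 (u : C0 R d) : Leps a lambda mu eps u \in @C0_pred R d.
Proof.
have [cu vu] := C0P u; have uB y : `|u y| <= `|u| := C0_normP u y.
have mu' : measurable_fun setT u by exact: continuous_measurable_rV.
have -> : Leps a lambda mu eps u = fun x => (eps ^+ 2)^-1 * lambda (eps^-1 *: x) *
    J (eps^-1 *: x) (fun z => u (x - eps *: z) - u x).
  by apply/funext => x; exact: LepsE.
have mF x := (admissible_increment x mu' uB).1.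
have FB x z : `|u (x - eps *: z) - u x| <= `|u| + `|u|.
  by rewrite (le_trans (ler_normB _ _))// lerD.
have cs : continuous (fun x : 'rV[R]_d => eps^-1 *: x) by exact: scaler_continuous.
have lB x : `|(eps ^+ 2)^-1 * lambda (eps^-1 *: x)| <= (eps ^+ 2)^-1 * alpha2.
  have /andP[l1 l2] := lambda_bounds (eps^-1 *: x).
  rewrite normrM gtr0_norm ?invr_gt0 ?exprn_gt0// ler_pM2l ?invr_gt0 ?exprn_gt0//.
  by rewrite ger0_norm// (le_trans (ltW alpha1_gt0)).
rewrite inE; split.
  apply: rV_continuousM.
    apply: rV_continuousZ => x.
    by apply: (@continuous_comp _ _ _ _ lambda); [exact: cs|exact: lambda_cont].
  move=> x; apply: (J_continuous M (xi := fun x => eps^-1 *: x)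
    (F := fun x z => u (x - eps *: z) - u x) (B := `|u| + `|u|)).
  - exact: cs.
  - move=> z; apply: continuousB; last exact: cu.
    exact: (rV_continuous_shift cu).
  - exact: mF.
  - move=> v z; rewrite (le_trans (FB v z))// ler_peMr ?addr_ge0//.
    by rewrite exprn_ege1// lerDl.
apply: (vanishingM_bounded lB).
apply: (@vanishing_Rintegral _ _ _ _ _ _ (fun v z => a z * (mu (eps^-1 *: v - z) *
    (u (v - eps *: z) - u v))) (fun z => a z * (alpha2 * (`|u| + `|u|)))) => //.
- move=> v; have /integrableP[+ _] := J_integrable M (eps^-1 *: v) (admissible_increment v mu' uB).
  by move/measurable_EFinP.
- move=> z _.
  under eq_fun do rewrite mulrA.
  apply: (@vanishingM_bounded _ _ _ _ (a z * alpha2)).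
    move=> x; rewrite normrM ger0_norm// ler_wpM2l//.
    have /andP[m1 m2] := mu_bounds (eps^-1 *: x - z).
    by rewrite ger0_norm// (le_trans (ltW alpha1_gt0)).
  apply: vanishingD; first exact: vanishing_shift.
  by move=> e /vu[N HN]; exists N => x /HN; rewrite normrN.
- apply: (integrable_kernelM M); exact: admissible_cst.
- move=> v z _; rewrite normrM ger0_norm// ler_wpM2l// normrM.
  have /andP[m1 m2] := mu_bounds (eps^-1 *: v - z).
  by rewrite ler_pM// ger0_norm// (le_trans (ltW alpha1_gt0)).
Qed.

(** Maximum principle: where [s * u x = |u x|] is within [eta] of the norm, a jump can increase
    [s * u] by at most [eta]. Since the total jump rate is at most [K], this gives
    [s * v x <= eta * K]. *)
Lemma Leps_dissipative (u v : C0 R d) (h : R) : Leps_graph a lambda mu eps (u, v) ->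
  0 < h -> `|u| <= `|u - h *: v|.
Proof.
move=> uv h0; have [cu _] := C0P u; have uB y : `|u y| <= `|u| := C0_normP u y.
have mu' : measurable_fun setT u by exact: continuous_measurable_rV.
pose K := (eps ^+ 2)^-1 * alpha2 * (alpha2 * \int[leb]_z a z).
have K0 : 0 <= K.
  by rewrite !mulr_ge0 ?invr_ge0 ?exprn_ge0 ?(ltW alpha2_gt0) ?integral_a_ge0 ?(ltW eps_gt0).
have hK : 0 < 1 + h * K by rewrite ltr_wpDr// mulr_ge0// ltW.
apply/ler_addgt0Pr => e e0.
(* Chosen so that the total loss [eta + h * (eta * K)] equals [e]. *)
pose eta := e / (1 + h * K).
have eta0 : 0 < eta by rewrite divr_gt0.
have hs : has_sup (range (fun x => `|u x|)).
  by split; [exists `|u 0|; exists 0|exact: C0_bounded].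
have [_ [x _ <-] ux] := sup_adherent eta0 hs.
rewrite -[sup _]/(`|u|) in ux.
have key (s : R) : `|s| = 1 -> s * u x = `|u x| -> s * v x <= eta * K.
  move=> s1 sux; rewrite uv (LepsE x mu' uB) mulrCA.
  have ai := admissible_increment x mu' uB.
  rewrite -(JZ M)// (@le_trans _ _ ((eps ^+ 2)^-1 * lambda (eps^-1 *: x) * (eta * J (eps^-1 *: x) (fun=> 1))))//.
    have /andP[l1 l2] := lambda_bounds (eps^-1 *: x).
    apply: ler_wpM2l.
      by rewrite mulr_ge0 ?invr_ge0 ?exprn_ge0 ?(ltW eps_gt0)// (le_trans (ltW alpha1_gt0)).
    rewrite -(JZ M); last exact: admissible_cst.
    apply: (J_le M); [exact: admissibleZ|exact: admissible_cst|move=> z].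
    rewrite mulr1 mulrBr sux.
    have : s * u (x - eps *: z) <= `|u|.
      by rewrite (le_trans (ler_norm _))// normrM s1 mul1r.
    by lra.
  rewrite mulrCA ler_pM2l// /K.
  have /andP[l1 l2] := lambda_bounds (eps^-1 *: x).
  have /andP[j1 j2] := J1_bounds (eps^-1 *: x).
  apply: ler_pM => //.
  - by rewrite mulr_ge0 ?invr_ge0 ?exprn_ge0 ?(ltW eps_gt0)// (le_trans (ltW alpha1_gt0)).
  - exact: ltW (J1_gt0 _).
  - by rewrite ler_wpM2l ?invr_ge0 ?exprn_ge0 ?(ltW eps_gt0).
have [s s1 sux] : exists2 s : R, `|s| = 1 & s * u x = `|u x|.
  have [ux0|ux0] := leP 0 (u x).
    by exists 1; rewrite ?normr1// mul1r ger0_norm.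
  by exists (-1); rewrite ?normrN1// mulN1r ltr0_norm.
have := key s s1 sux => svx.
have : s * (u x - h * v x) <= `|u - h *: v|.
  rewrite (le_trans (ler_norm _))// normrM s1 mul1r.
  exact: (C0_normP (u - h *: v) x).
rewrite mulrBr sux mulrCA.
have : h * (s * v x) <= h * (eta * K) by rewrite ler_pM2l.
have : e = eta + h * (eta * K) by rewrite /eta; field; rewrite gt_eqF.
lra.
Qed.

Lemma Leps_semigroup_contraction (T : R -> C0 R d -> C0 R d) t u :
  generated_by T (Leps_graph a lambda mu eps) -> 0 <= t -> `|T t u| <= `|u|.
Proof.
move=> [TP TA] t0; apply: (sg_dissipative_contraction TP t0).
  by move=> p q; rewrite TA => pq h h0; exact: (Leps_dissipative pq h0).
by exists (MkC0 (Leps_C0 u)); rewrite TA.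
Qed.

End rescaled_operator.

(** * Tonelli on the torus, and periodic functions against the weight *)

Section torus_tonelli.
Context (R : realType) (n : nat).
Notation leb := (lebesgue_rV R n).
Local Open Scope ereal_scope.

Section restriction.
Variable F : 'rV[R]_n * 'rV[R]_n -> \bar R.
Hypotheses (mF : measurable_fun setT F) (F0 : forall p, 0 <= F p).

Let G := F \_ (@torus R n `*` setT).

Let mG : measurable_fun setT G.
Proof.
have mTT : measurable (@torus R n `*` [set: 'rV[R]_n]).
  by apply: measurableX => //; exact: measurable_torus.
by apply/(measurable_restrictT _ mTT); exact: measurable_funTS.
Qed.

Let G0 p : 0 <= G p. Proof. by rewrite /G patchE; case: ifP. Qed.

Let integral_G q : \int[leb]_h G (h, q) = \int[leb]_(h in @torus R n) F (h, q).
Proof.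
rewrite [RHS]integral_mkcond; apply: eq_integral => h _; rewrite /G !patchE.
congr (if _ then _ else _); apply/idP/idP => /set_mem.
  by move=> [hT _]; apply/mem_set.
by move=> hT; apply/mem_set; split.
Qed.

Lemma torus_tonelli :
  \int[leb]_(h in @torus R n) \int[leb]_q F (h, q) =
  \int[leb]_q \int[leb]_(h in @torus R n) F (h, q).
Proof.
transitivity (\int[leb]_h \int[leb]_q G (h, q)).
  rewrite integral_mkcond; apply: eq_integral => h _; rewrite patchE.
  case: ifPn => hT.
    apply: eq_integral => q _; rewrite /G patchE mem_set//; split => //.
    exact: set_mem.
  apply/esym/integral0_eq => q _; rewrite /G patchE ifN//.
  by apply: contra hT => /set_mem[hT _]; apply/mem_set.
by rewrite (fubini_tonelli G mG G0); apply: eq_integral => q _.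
Qed.

Lemma measurable_torus_integral :
  measurable_fun setT (fun q => \int[leb]_(h in @torus R n) F (h, q)).
Proof.
apply: eq_measurable_fun (measurable_fun_fubini_tonelli_G G mG G0) => q _.
exact: integral_G.
Qed.

End restriction.

Lemma measurable_addp : measurable_fun setT (fun p : 'rV[R]_n * 'rV[R]_n => (p.1 + p.2)%R).
Proof.
apply/measurable_fun_rVP => i; under eq_fun do rewrite mxE.
apply: measurable_funD.
- exact: (measurableT_comp (@measurable_rV_coord R n i) measurable_fst).
- exact: (measurableT_comp (@measurable_rV_coord R n i) measurable_snd).
Qed.

Lemma measurable_sub_rV (xi : 'rV[R]_n) : measurable_fun setT (fun x : 'rV[R]_n => (xi - x)%R).
Proof.
have := @measurable_affine R n (-1) xi.
by apply: eq_measurable_fun => x _; rewrite scaleN1r addrC.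
Qed.

Lemma ge0_integral_reflect (xi : 'rV[R]_n) (G : 'rV[R]_n -> \bar R) :
  measurable_fun setT G -> (forall x, 0 <= G x) ->
  \int[leb]_q G (xi - q)%R = \int[leb]_q G q.
Proof.
move=> mG G0; have n0 : (-1 != 0 :> R)%R by rewrite oppr_eq0 oner_neq0.
rewrite -(ge0_integral_affine xi n0 mG G0) normrN1 expr1n mul1e.
by apply: eq_integral => q _; rewrite scaleN1r addrC.
Qed.

Lemma ge0_integral_translate (h : 'rV[R]_n) (G : 'rV[R]_n -> \bar R) :
  measurable_fun setT G -> (forall x, 0 <= G x) ->
  \int[leb]_q G (q + h)%R = \int[leb]_q G q.
Proof.
move=> mG G0; rewrite -(ge0_integral_affine h (oner_neq0 _) mG G0) normr1 expr1n mul1e.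
by apply: eq_integral => q _; rewrite scale1r.
Qed.

(* The weight varies by a bounded factor under unit shifts, so the integral can
   be averaged over shifts of H, which by periodicity decouples w from H. *)
Lemma periodic_tail_bound (s : R) : (0 < s)%R -> exists2 K : R, (0 <= K)%R &
  forall xi (H : 'rV[R]_n -> \bar R), measurable_fun setT H ->
    (forall x, 0 <= H x) -> coord_periodic H ->
    \int[leb]_q ((weight s (xi - q)%R)%:E * H q) <=
    K%:E * \int[leb]_(h in @torus R n) H h.
Proof.
move=> s0; pose K' : R := (2 `^ (n%:R + s))%R.
have K'0 : (0 <= K')%R by exact: powR_ge0.
have iw := weight_integrable n s0.
have w0 (x : 'rV[R]_n) : (0 <= weight s x)%R by exact: ltW (weight_gt0 _ _).
exists (K' * \int[leb]_z weight s z)%R.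
  by rewrite mulr_ge0// Rintegral_ge0.
move=> xi H mH H0 pH; have mT := @measurable_torus R n.
have mw : measurable_fun setT (fun q : 'rV[R]_n => (weight s q)%:E : \bar R) by case/integrableP: iw.
have mws : measurable_fun setT (fun q : 'rV[R]_n => (weight s (xi - q)%R)%:E : \bar R).
  exact: (measurableT_comp mw (measurable_sub_rV xi)).
have mI : measurable_fun setT (fun q : 'rV[R]_n => (weight s (xi - q)%R)%:E * H q).
  exact: emeasurable_funM.
have mHa h : measurable_fun setT (fun q : 'rV[R]_n => H (q + h)%R).
  have := measurableT_comp mH (@measurable_affine R n 1 h).
  by apply: eq_measurable_fun => x _ /=; rewrite scale1r.
set I := \int[leb]_q _.
have -> : I = \int[leb]_(h in @torus R n) I.
  by rewrite integral_cst// [X in _ * X]lebesgue_torus mule1.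
apply: (@le_trans _ _ (\int[leb]_(h in @torus R n)
    \int[leb]_q (K'%:E * ((weight s (xi - q)%R)%:E * H (q + h)%R)))).
  apply: ge0_le_integral => //.
  - by move=> h _; apply: integral_ge0 => q _; rewrite mule_ge0// lee_fin.
  - pose F (p : 'rV[R]_n * 'rV[R]_n) : \bar R :=
      K'%:E * ((weight s (xi - p.2)%R)%:E * H (p.2 + p.1)%R).
    have mF : measurable_fun setT F.
      apply: emeasurable_funM => //; apply: emeasurable_funM.
        exact: (measurableT_comp mws measurable_snd).
      have := measurableT_comp mH measurable_addp.
      by apply: eq_measurable_fun => p _ /=; rewrite addrC.
    apply: measurable_funTS; apply: (measurable_fun_fubini_tonelli_F F mF) => p.
    by rewrite !mule_ge0// lee_fin.
  move=> h hT.
  have mK : measurable_fun setT (fun q : 'rV[R]_n =>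
      K'%:E * ((weight s (xi - q)%R)%:E * H (q + h)%R)).
    by apply: emeasurable_funM => //; apply: emeasurable_funM.
  rewrite -(@ge0_integral_translate (- h)%R _ mK); last first.
    by move=> q; rewrite !mule_ge0// lee_fin.
  have mKh : measurable_fun setT (fun q : 'rV[R]_n =>
      K'%:E * ((weight s (xi - (q - h))%R)%:E * H (q - h + h)%R)).
    have := measurableT_comp mK (@measurable_affine R n 1 (- h)).
    by apply: eq_measurable_fun => q _ /=; rewrite scale1r.
  have le q : (weight s (xi - q)%R)%:E * H q <=
      K'%:E * ((weight s (xi - (q - h))%R)%:E * H (q - h + h)%R).
    rewrite subrK muleA; apply: lee_wpmul2r; first exact: H0.
    rewrite -EFinM lee_fin opprB addrA addrAC.
    apply: weight_shift; first exact: ltW.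
    apply/rV_norm_leP => [|i]; first exact: ler01.
    have := hT i; rewrite !mxE => /andP[h0 h1].
    by rewrite ger0_norm.
  apply: (ge0_le_integral _ measurableT _ mI mKh) => q _; last exact: le.
  by rewrite mule_ge0// lee_fin.
pose F (p : 'rV[R]_n * 'rV[R]_n) : \bar R :=
  K'%:E * ((weight s (xi - p.2)%R)%:E * H (p.2 + p.1)%R).
have mF : measurable_fun setT F.
  apply: emeasurable_funM => //; apply: emeasurable_funM.
    exact: (measurableT_comp mws measurable_snd).
  have := measurableT_comp mH measurable_addp.
  by apply: eq_measurable_fun => p _ /=; rewrite addrC.
have F0 p : 0 <= F p by rewrite !mule_ge0// lee_fin.
rewrite (torus_tonelli mF F0) /F /=.
have mHT q : measurable_fun (@torus R n) (fun h => H (h + q)%R) by exact: measurable_funTS.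
have E q : \int[leb]_(h in @torus R n) (K'%:E * ((weight s (xi - q)%R)%:E * H (q + h)%R)) =
    (K' * weight s (xi - q))%:E * \int[leb]_(h in @torus R n) H h.
  have Kw : 0 <= (K' * weight s (xi - q))%:E by rewrite lee_fin mulr_ge0.
  have ZE := ge0_integralZl leb mT (mHT q) (fun x _ => H0 _) Kw.
  rewrite -(ge0_integral_torus_shift q pH mH H0).
  rewrite -[RHS]ZE; apply: eq_integral => h _.
  by rewrite muleA -EFinM (addrC q h).
under eq_integral do rewrite E.
rewrite ge0_integralZr//; last 3 first.
- apply/measurable_EFinP; apply: measurable_funM => //.
  by move/measurable_EFinP : mws.
- by move=> q _; rewrite lee_fin mulr_ge0.
- exact: integral_ge0.
apply: lee_wpmul2r; first exact: integral_ge0.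
under eq_integral do rewrite EFinM.
rewrite ge0_integralZl//; last first.
  by move=> q _; rewrite lee_fin.
rewrite (ge0_integral_reflect xi mw); last by move=> q; rewrite lee_fin.
rewrite EFinM /Rintegral fineK//.
exact: integrable_fin_num.
Qed.

End torus_tonelli.

(** * Periodic functions and the continuous version of the first corrector *)

Section periodic_functions.
Context (R : realType) (d : nat).

Lemma Zd_representative (x : 'rV[R]_d) : exists (k : 'rV[int]_d) (t : 'rV[R]_d),
  @torus R d t /\ x = t + map_mx intr k.
Proof.
exists (\row_i Num.floor (x 0 i)), (\row_i (x 0 i - (Num.floor (x 0 i))%:~R)).
split=> [i|]; last by apply/rowP => i; rewrite !mxE subrK.
by have := floor_le (x 0 i); have := floorD1_gt (x 0 i); rewrite !mxE intrD; lra.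
Qed.

Lemma torus_norm_le1 (t : 'rV[R]_d) : @torus R d t -> `|t| <= 1.
Proof.
move=> tT; apply/rV_norm_leP => // i; have := tT i; rewrite !mxE => /andP[t0 t1].
by rewrite ger0_norm.
Qed.

Lemma continuous_periodic_bounded (f : 'rV[R]_d -> R) : continuous f -> Zd_periodic f ->
  exists B : R, forall x, `|f x| <= B.
Proof.
move=> cf pf; pose B : set 'rV[R]_d := [set x | `|x| <= 1].
have cB : compact B.
  apply: bounded_closed_compact.
    exists 1; split; first exact: num_real.
    by move=> N MN x xM; exact: le_trans xM (ltW MN).
  apply: (@closed_comp _ _ (fun x : 'rV[R]_d => `|x|) [set t | t <= 1]).
    by move=> x _; exact: norm_continuous.
  exact: closed_le.
have /compact_bounded [K [_ uK]] : compact (f @` B).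
  apply: continuous_compact => //; exact: continuous_subspaceT.
exists (K + 1) => x; have [k [t [tT ->]]] := Zd_representative x.
rewrite pf; apply: (uK (K + 1)); first by rewrite ltrDl.
by exists t => //; exact: torus_norm_le1.
Qed.

End periodic_functions.

Section corrector_regularity.
Context (R : realType) (d : nat) (a lambda mu : 'rV[R]_d -> R) (C delta alpha1 alpha2 : R).
Notation leb := (lebesgue_rV R d).
Hypothesis M : medium a lambda mu C delta alpha1 alpha2.
Let a_cont := medium_a_cont M.
Let a_ge0 := medium_a_ge0 M.
Let delta_gt2 := medium_delta_gt2 M.
Let mu_cont := medium_mu_cont M.
Let mu_periodic := medium_mu_periodic M.
Let alpha1_gt0 := medium_alpha1_gt0 M.
Let mu_bounds := medium_mu_bounds M.
Local Notation J := (J a mu).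

Let s := delta - 2.
Let s0 : 0 < s. Proof. by rewrite subr_gt0. Qed.

Let ma : measurable_fun setT a. Proof. exact: measurable_a M. Qed.
Let mmu : measurable_fun setT mu. Proof. exact: continuous_measurable_rV. Qed.

Lemma J_convE xi (g : 'rV[R]_d -> R) : measurable_fun setT g ->
  J xi g = \int[leb]_q (a (xi - q) * (mu q * g (xi - q))).
Proof.
move=> mg; have n1 : `|-1 : R| = 1 by rewrite normrN1.
have mf : measurable_fun setT (fun q : 'rV[R]_d => a (xi - q) * (mu q * g (xi - q))).
  apply: measurable_funM; first exact: (measurableT_comp ma (measurable_sub_rV xi)).
  apply: measurable_funM => //; exact: (measurableT_comp mg (measurable_sub_rV xi)).
rewrite -(Rintegral_isometry xi n1 mf); apply: eq_Rintegral => z _.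
have -> : -1 *: z + xi = xi - z by rewrite scaleN1r addrC.
by rewrite subKr.
Qed.

Let w0 (z : 'rV[R]_d) : 0 < weight s z := weight_gt0 s z.

Lemma weighted_periodic_integrable (H : 'rV[R]_d -> R) xi : measurable_fun setT H ->
  coord_periodic H -> leb.-integrable (@torus R d) (EFin \o H) ->
  leb.-integrable setT (EFin \o (fun q => weight s (xi - q) * H q)).
Proof.
move=> mH pH /integrableP[_ iH]; have [K K0 HK] := periodic_tail_bound d s0.
have mw : measurable_fun setT (fun q : 'rV[R]_d => weight s (xi - q)).
  have mw' : measurable_fun setT (@weight R d s).
    by apply: continuous_measurable_rV; exact: continuous_weight.
  exact: (measurableT_comp mw' (measurable_sub_rV xi)).
apply/integrableP; split; first by apply/measurable_EFinP; exact: measurable_funM.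
have mH' : measurable_fun setT (fun q => `|(H q)%:E|%E).
  by apply: measurableT_comp => //; exact/measurable_EFinP.
have pH' : coord_periodic (fun q => `|(H q)%:E|%E) by move=> x i; rewrite pH.
have := HK xi _ mH' (fun x => abse_ge0 _) pH'.
move=> HKxi; under eq_integral do rewrite /= normrM (ger0_norm (ltW (w0 _))) EFinM.
by apply: (le_lt_trans HKxi); rewrite lte_mul_pinfty.
Qed.

(** The function [k] is merely integrable on the torus, so continuity comes from the kernel: for [v]
    within distance 1 of [xi], [weight_shift] bounds [a (v - q)] by a multiple of the weight at the
    fixed point [xi - q]. *)
Lemma continuous_convolution (k : 'rV[R]_d -> R) : measurable_fun setT k ->
  coord_periodic k -> leb.-integrable (@torus R d) (EFin \o k) ->
  continuous (fun xi : 'rV[R]_d => \int[leb]_q (a (xi - q) * (mu q * k q))).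
Proof.
move=> mk pk ik xi; have [K K0 aK] := kernel_weight M.
have iw := weighted_periodic_integrable xi mk pk ik.
pose K' := K * 2 `^ (d%:R + s) * alpha2.
have iwn : leb.-integrable setT (EFin \o (fun q => K' * `|weight s (xi - q) * k q|)).
  by have := integrableZl measurableT K' (integrable_norm iw).
apply: (@continuous_Rintegral R _ _ leb _ setT
  (fun xi q => a (xi - q) * (mu q * k q)) _ xi 1 _ _ _ _ iwn) => //.
- move=> v; apply: measurable_funM; last exact: measurable_funM.
  exact: (measurableT_comp ma (measurable_sub_rV v)).
- by move=> q _; apply: rV_continuousM; [exact: rV_continuous_shift|exact: cst_continuous].
move=> v q xv _; have /andP[m1 m2] := mu_bounds q.
have mu0 : 0 <= mu q by exact: le_trans (ltW alpha1_gt0) m1.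
have av : a (v - q) <= K * 2 `^ (d%:R + s) * weight s (xi - q).
  apply: (@le_trans _ _ (K * weight s (v - q))).
    apply: le_trans (aK (v - q)).
    by rewrite ler_peMr// exprn_ege1// lerDl.
  rewrite -mulrA ler_pM2l//.
  have := @weight_shift R d s (v - q) (xi - v) (ltW s0) (ltW xv).
  have -> // : v - q + (xi - v) = xi - q.
  by apply/rowP => i; rewrite !mxE; ring.
rewrite !normrM (ger0_norm (a_ge0 _)) (ger0_norm mu0) (ger0_norm (ltW (w0 _))).
rewrite [leRHS](_ : _ = K * 2 `^ (d%:R + s) * weight s (xi - q) * (alpha2 * `|k q|)).
  apply: ler_pM => //; first by rewrite mulr_ge0.
  by rewrite ler_wpM2r.
by rewrite /K'; ring.
Qed.

Lemma continuous_J_cst g : admissible g -> continuous (fun xi : 'rV[R]_d => J xi g).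
Proof.
move=> [mg [B gB]] x; apply: (J_continuous M (F := fun _ => g) (B := B)) => //.
by move=> z; exact: cst_continuous.
Qed.

Lemma J_Zd_periodic g : Zd_periodic (fun xi => J xi g).
Proof.
move=> xi k; apply: eq_Rintegral => z _; congr (_ * (_ * _)).
by rewrite addrAC mu_periodic.
Qed.

Lemma continuous_J1V : continuous (fun xi : 'rV[R]_d => (J xi (fun=> 1))^-1).
Proof.
move=> x; apply: (@continuous_comp _ _ _ (fun xi : 'rV[R]_d => J xi (fun=> 1)) (@GRing.inv R)).
  exact: (continuous_J_cst (admissible_cst _ 1)).
by apply: inv_continuous; rewrite gt_eqF// (J1_gt0 M).
Qed.

Lemma Rintegral_ae_eq (f g : 'rV[R]_d -> R) : measurable_fun setT f ->
  measurable_fun setT g -> {ae leb, forall q, f q = g q} ->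
  \int[leb]_q f q = \int[leb]_q g q.
Proof.
move=> mf mg fg; congr fine; apply: ae_eq_integral => //; try exact/measurable_EFinP.
by apply: filterS fg => q -> _.
Qed.

Variable kappa : 'rV[R]_d -> 'rV[R]_d.
Hypothesis kappaP : corrector a mu kappa.

Section component.
Variable j : 'I_d.
Let k q := kappa q 0 j.

Let mk : measurable_fun setT k.
Proof. by have /measurable_fun_rVP := corrector_measurable kappaP; exact. Qed.

Let pk : Zd_periodic k.
Proof. by move=> x n; rewrite /k (corrector_periodic kappaP). Qed.

Let ik : leb.-integrable (@torus R d) (EFin \o k).
Proof.
have mT := @measurable_torus R d.
(* Square integrability passes to integrability by [|k| <= 1 + k ^ 2], as the torus has measure
   1. *)
have i1 : leb.-integrable (@torus R d) (EFin \o cst 1).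
  apply/integrableP; split; first exact/measurable_EFinP.
  under eq_integral do rewrite /= normr1.
  by rewrite integral_cst// [X in (_ * X)%E]lebesgue_torus mule1 ltry.
have := integrableD mT i1 (corrector_L2 kappaP j).
apply: le_integrable => //; first by apply/measurable_EFinP; exact: measurable_funTS.
move=> q _; change (`|k q|%:E <= `|1 + k q ^+ 2|%:E)%E.
rewrite lee_fin [leRHS]ger0_norm ?addr_ge0 ?sqr_ge0// -[in leRHS]real_normK ?num_real//.
by have := sqr_ge0 (`|k q| - 1); have := normr_ge0 (k q); rewrite sqrrB expr1n mulr1; lra.
Qed.

Let J0 (xi : 'rV[R]_d) := \int[leb]_q (a (xi - q) * (mu q * k q)).
(** The corrector equation solved for the value at [xi], which occurs there only with the factor
    [J xi (fun=> 1)]. Everything else depends on [kappa] through an integral, hence continuously on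
    [xi]. *)
Let kbar (xi : 'rV[R]_d) := (J0 xi - J xi (fun z => z 0 j)) * (J xi (fun=> 1))^-1.

Let kbar_continuous : continuous kbar.
Proof.
apply: rV_continuousM; last exact: continuous_J1V.
apply: (@rV_continuousB _ _ J0 (fun xi => J xi (fun z => z 0 j))); last exact: (continuous_J_cst (@admissible_coord R d j)).
exact: (continuous_convolution mk (Zd_coord_periodic pk) ik).
Qed.

Let J0_periodic : Zd_periodic J0.
Proof.
move=> xi n; rewrite /J0.
have n1 : `|1 : R| = 1 by rewrite normr1.
have mf : measurable_fun setT (fun q : 'rV[R]_d => a (xi + map_mx intr n - q) * (mu q * k q)).
  apply: measurable_funM; last exact: measurable_funM.
  exact: (measurableT_comp ma (measurable_sub_rV _)).
rewrite -(Rintegral_isometry (map_mx intr n) n1 mf); apply: eq_Rintegral => q _.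
by rewrite scale1r mu_periodic pk opprD addrACA subrr addr0.
Qed.

Let kbar_periodic : Zd_periodic kbar.
Proof. by move=> xi n; rewrite /kbar J0_periodic !J_Zd_periodic. Qed.

Let J0_integrable xi : leb.-integrable setT (EFin \o (fun q => a (xi - q) * (mu q * k q))).
Proof.
have [K K0 aK] := kernel_weight M.
have iw := weighted_periodic_integrable xi mk (Zd_coord_periodic pk) ik.
have := integrableZl measurableT (K * alpha2) iw.
apply: le_integrable => //.
  apply/measurable_EFinP; apply: measurable_funM; last exact: measurable_funM.
  exact: (measurableT_comp ma (measurable_sub_rV xi)).
move=> q _ /=; rewrite lee_fin; have /andP[m1 m2] := mu_bounds q.
have mu0 : 0 <= mu q by exact: le_trans (ltW alpha1_gt0) m1.
have al0 : 0 <= alpha2 by exact: le_trans m2.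
have av : a (xi - q) <= K * weight s (xi - q).
  apply: le_trans (aK (xi - q)).
  by rewrite ler_peMr// exprn_ege1// lerDl.
rewrite !normrM (ger0_norm (a_ge0 _)) (ger0_norm mu0) (ger0_norm (ltW (w0 _))).
rewrite (ger0_norm (ltW K0)) (ger0_norm al0).
rewrite [leRHS](_ : _ = K * weight s (xi - q) * (alpha2 * `|k q|)); last by ring.
apply: ler_pM => //; first by rewrite mulr_ge0.
by rewrite ler_wpM2r.
Qed.

Let kappa_ae_torus : {ae leb, forall xi, @torus R d xi -> k xi = kbar xi}.
Proof.
apply: filterS (corrector_eq kappaP) => xi H /H/(_ j).
have i1 : leb.-integrable setT (EFin \o (fun q => (a (xi - q) * (mu q * 1)))).
  have := J_integrable M xi (admissible_cst _ 1) => /(integrable_affine xi (_ : -1 != 0)).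
  move=> /(_ ltac:(by rewrite oppr_eq0 oner_neq0)); apply: eq_integrable => // q _ /=.
  have -> : -1 *: q + xi = xi - q by rewrite scaleN1r addrC.
  by rewrite subKr.
have i2 : leb.-integrable setT (EFin \o (fun q => k xi * (a (xi - q) * (mu q * 1)))).
  by have := integrableZl measurableT (k xi) i1.
have i0 := J0_integrable xi.
have E1 : \int[leb]_q (a (xi - q) * mu q * (kappa q 0 j - kappa xi 0 j)) =
    J0 xi - k xi * J xi (fun=> 1).
  rewrite (J_convE xi)// -RintegralZl// -RintegralB//.
  by apply: eq_Rintegral => q _; rewrite -/(k q) -/(k xi); ring.
have E2 : \int[leb]_q (a (xi - q) * (xi - q) 0 j * mu q) = J xi (fun z => z 0 j).
  rewrite (J_convE xi); last exact: measurable_rV_coord.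
  by apply: eq_Rintegral => q _; ring.
rewrite E1 E2 => E; rewrite /kbar -E opprB addrC subrK mulfK//.
by rewrite gt_eqF// (J1_gt0 M).
Qed.

Let mkbar : measurable_fun setT kbar.
Proof. exact: continuous_measurable_rV. Qed.

(** From the torus to the whole space: by [periodic_tail_bound] the integral of [|k - kbar|] against
    a positive weight is bounded by a multiple of its integral over the torus, which is 0. *)
Let kappa_ae : {ae leb, forall q, k q = kbar q}.
Proof.
have [K K0 HK] := periodic_tail_bound d s0.
pose H (q : 'rV[R]_d) : \bar R := `|(k q - kbar q)%:E|%E.
have mH : measurable_fun setT H.
  by apply: measurableT_comp => //; apply/measurable_EFinP; exact: measurable_funB.
have pH : coord_periodic H.
  by move=> x i; rewrite /H (Zd_coord_periodic pk) (Zd_coord_periodic kbar_periodic).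
have mT := @measurable_torus R d.
have HT : (\int[leb]_(h in @torus R d) H h = 0)%E.
  rewrite (ae_eq_integral (cst 0%E)) ?integral0//; first exact: measurable_funTS.
  by apply: filterS kappa_ae_torus => q Hq /Hq; rewrite /H => ->; rewrite subrr abse0.
have := HK 0 H mH (fun x => abse_ge0 _) pH; rewrite HT mule0 => I0.
have mw : measurable_fun setT (fun q : 'rV[R]_d => (weight s (0 - q)%R)%:E : \bar R).
  have mw' : measurable_fun setT (@weight R d s).
    by apply: continuous_measurable_rV; exact: continuous_weight.
  by apply/measurable_EFinP; exact: (measurableT_comp mw' (measurable_sub_rV 0)).
have mwH : measurable_fun setT (fun q : 'rV[R]_d => (weight s (0 - q)%R)%:E * H q)%E.
  exact: emeasurable_funM.
have wH0 q : (0 <= (weight s (0 - q)%R)%:E * H q)%E.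
  by apply: mule_ge0; [rewrite lee_fin ltW|rewrite /H abse_ge0].
have I0' : (\int[leb]_q ((weight s (0 - q)%R)%:E * H q) = 0)%E.
  by apply/eqP; rewrite eq_le I0 integral_ge0.
have := (ae_eq_integral_abs leb measurableT mwH).1.
under eq_integral do rewrite gee0_abs//.
move=> /(_ I0'); apply: filterS => q /(_ Logic.I) /eqP.
rewrite mule_eq0 => /orP[|]; first by rewrite eqe gt_eqF.
by rewrite /H abse_eq0 eqe subr_eq0 => /eqP.
Qed.

(** The last clause rewrites with [chi] the second integral of [effective_matrix], which is
    expressed with [kappa]. *)
Lemma corrector_component : exists chi : 'rV[R]_d -> R,
  [/\ continuous chi, Zd_periodic chi,
      forall xi, J xi (fun z => chi (xi - z) - chi xi - z 0 j) = 0 &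
      forall xi i, \int[leb]_q (a (xi - q) * mu q * mu xi * (xi - q) 0 i * kappa q 0 j) =
        mu xi * J xi (fun z => z 0 i * chi (xi - z))].
Proof.
have [B kB] := continuous_periodic_bounded kbar_continuous kbar_periodic.
have mks xi : measurable_fun setT (fun z : 'rV[R]_d => kbar (xi - z)).
  exact: (measurableT_comp mkbar (measurable_sub_rV xi)).
have ak xi : admissible (fun z => kbar (xi - z)).
  by apply: admissible_bounded => //; exists B.
exists kbar; split => // [xi|xi i].
  have E : J0 xi = J xi (fun z => kbar (xi - z)).
    rewrite (J_convE xi)//; apply: Rintegral_ae_eq.
    - apply: measurable_funM; last exact: measurable_funM.
      exact: (measurableT_comp ma (measurable_sub_rV xi)).
    - under eq_fun do rewrite subKr.
      apply: measurable_funM; last exact: measurable_funM.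
      exact: (measurableT_comp ma (measurable_sub_rV xi)).
    - by apply: filterS kappa_ae => q ->; rewrite subKr.
  rewrite (JB M); [|by apply: (admissibleD (ak xi)); exact: admissible_cst|exact: admissible_coord].
  rewrite (JB M)//; last exact: admissible_cst.
  rewrite [J xi (fun=> kbar xi)](J_cst M).
  by rewrite {2}/kbar mulfVK ?gt_eqF ?(J1_gt0 M)// -E subKr subrr.
have ai := admissibleM_bounded (mks xi) (ex_intro _ B (fun z => kB _)) (@admissible_coord R d i).
rewrite -(JZ M); last first.
  by under eq_fun do rewrite mulrC.
rewrite (J_convE xi); last first.
  apply: measurable_funM => //; apply: measurable_funM => //.
  exact: measurable_rV_coord.
apply: Rintegral_ae_eq.
- apply: measurable_funM => //; apply: measurable_funM; last first.
    exact: (measurableT_comp (@measurable_rV_coord R d i) (measurable_sub_rV xi)).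
  apply: measurable_funM => //; apply: measurable_funM => //.
  exact: (measurableT_comp ma (measurable_sub_rV xi)).
- under eq_fun do rewrite subKr.
  apply: measurable_funM; first exact: (measurableT_comp ma (measurable_sub_rV xi)).
  apply: measurable_funM => //; apply: measurable_funM => //; apply: measurable_funM => //.
  exact: (measurableT_comp (@measurable_rV_coord R d i) (measurable_sub_rV xi)).
by apply: filterS kappa_ae => q kq; rewrite subKr -/(k q) kq; ring.
Qed.

End component.
End corrector_regularity.

(** * The Markov operator of the cell and its invariant measure *)

Definition continuous_periodic (R : realType) d (u : 'rV[R]_d -> R) :=
  continuous u /\ Zd_periodic u.

Section continuous_periodic_closure.
Context (R : realType) (d : nat).
Implicit Types u v : 'rV[R]_d -> R.
Local Notation cper := (@continuous_periodic R d).

Lemma continuous_periodic_cst (c : R) : cper (fun=> c).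
Proof. by split => //; exact: cst_continuous. Qed.

Lemma continuous_periodicD u v : cper u -> cper v -> cper (fun x => u x + v x).
Proof.
move=> [cu pu] [cv pv]; split; first exact: rV_continuousD.
by move=> x k; rewrite pu pv.
Qed.

Lemma continuous_periodicB u v : cper u -> cper v -> cper (fun x => u x - v x).
Proof.
move=> [cu pu] [cv pv]; split; first exact: rV_continuousB.
by move=> x k; rewrite pu pv.
Qed.

Lemma continuous_periodicM u v : cper u -> cper v -> cper (fun x => u x * v x).
Proof.
move=> [cu pu] [cv pv]; split; first exact: rV_continuousM.
by move=> x k; rewrite pu pv.
Qed.

Lemma continuous_periodicV u : cper u -> (forall x, u x != 0) -> cper (fun x => (u x)^-1).
Proof.
move=> [cu pu] u0; split; last by move=> x k; rewrite pu.
by move=> x; apply: (@continuous_comp _ _ _ u (@GRing.inv R)); [exact: cu|exact: inv_continuous].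
Qed.

Lemma continuous_periodic_measurable u : cper u -> measurable_fun setT u.
Proof. by move=> [cu _]; exact: continuous_measurable_rV. Qed.

Lemma continuous_periodic_integrable_torus u : cper u ->
  (lebesgue_rV R d).-integrable (@torus R d) (EFin \o u).
Proof.
move=> cu; have [B uB] := continuous_periodic_bounded cu.1 cu.2.
have mT := @measurable_torus R d.
apply: measurable_bounded_integrable => //.
- by rewrite [X in (X < _)%E]lebesgue_torus ltry.
- by apply: measurable_funTS; exact: continuous_periodic_measurable.
- exists B; split; first exact: num_real.
  by move=> b Bb x _; apply: le_trans (ltW Bb); exact: uB.
Qed.

Lemma EFin_Rintegral (D : set 'rV[R]_d) (f : 'rV[R]_d -> R) : measurable D ->
  (lebesgue_rV R d).-integrable D (EFin \o f) ->
  (\int[lebesgue_rV R d]_(x in D) (f x)%:E = (\int[lebesgue_rV R d]_(x in D) f x)%R%:E)%E.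
Proof. by move=> mD fi; rewrite /Rintegral fineK//; exact: integrable_fin_num. Qed.

End continuous_periodic_closure.

Section markov_operator.
Context (R : realType) (d : nat) (a lambda mu : 'rV[R]_d -> R) (C delta alpha1 alpha2 : R).
Notation leb := (lebesgue_rV R d).
Hypothesis M : medium a lambda mu C delta alpha1 alpha2.
Let a_even := medium_a_even M.
Let a_ge0 := medium_a_ge0 M.
Let mu_cont := medium_mu_cont M.
Let mu_periodic := medium_mu_periodic M.
Let alpha1_gt0 := medium_alpha1_gt0 M.
Let mu_bounds := medium_mu_bounds M.
Local Notation J := (J a mu).
Local Notation cper := (@continuous_periodic R d).

Let ma : measurable_fun setT a. Proof. exact: measurable_a M. Qed.

Definition J1 xi := J xi (fun=> 1).
(** Transition operator of the chain which moves from [xi] to [q] with density proportional to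
    [a (xi - q) * mu q]; [J1] is the normalizing mass. *)
Definition G (u : 'rV[R]_d -> R) xi := J xi (fun z => u (xi - z)) / J1 xi.

Lemma admissible_periodic u xi : cper u -> admissible (fun z => u (xi - z)).
Proof.
move=> cu; have [B uB] := continuous_periodic_bounded cu.1 cu.2.
apply: admissible_bounded; last by exists B.
exact: (measurableT_comp (continuous_periodic_measurable cu) (measurable_sub_rV xi)).
Qed.

Lemma continuous_periodic_J1 : cper J1.
Proof.
split; last by move=> x k; rewrite /J1 (J_Zd_periodic M).
exact: (continuous_J_cst M (admissible_cst _ 1)).
Qed.

Lemma continuous_periodic_J (F : 'rV[R]_d -> 'rV[R]_d -> R) (B : R) :
  (forall z, continuous (F ^~ z)) -> (forall x, measurable_fun setT (F x)) ->
  (forall x z, `|F x z| <= B * (1 + `|z|) ^+ 2) ->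
  (forall x k z, F (x + map_mx intr k) z = F x z) ->
  cper (fun x => J x (F x)).
Proof.
move=> cF mF FB pF; split.
  move=> x; apply: (J_continuous M (xi := idfun) (F := F) (B := B)).
  - exact: cvg_id.
  - by move=> z; exact: cF.
  - exact: mF.
  - exact: FB.
move=> x k; rewrite (J_Zd_periodic M); congr J.
by apply/funext => z; rewrite pF.
Qed.

Lemma continuous_periodic_G u : cper u -> cper (G u).
Proof.
move=> cu; have [B uB] := continuous_periodic_bounded cu.1 cu.2.
apply: continuous_periodicM; last first.
  by apply: continuous_periodicV => [|x]; [exact: continuous_periodic_J1|rewrite gt_eqF// (J1_gt0 M)].
have B0 : 0 <= B by exact: le_trans (uB 0).
apply: (@continuous_periodic_J (fun x z => u (x - z)) B).
- by move=> z; exact: rV_continuous_shift cu.1.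
- by move=> x; have [] := admissible_periodic x cu.
- by move=> x z; rewrite (le_trans (uB _))// ler_peMr// exprn_ege1// lerDl.
- by move=> x k z; rewrite addrAC cu.2.
Qed.

Lemma continuous_periodic_iterG n u : cper u -> cper (iter n G u).
Proof. by move=> cu; elim: n => //= n IH; exact: continuous_periodic_G. Qed.

Lemma J_periodicE u xi : cper u -> J xi (fun z => u (xi - z)) = J1 xi * G u xi.
Proof. by move=> cu; rewrite /G mulrC divfK// gt_eqF// (J1_gt0 M). Qed.

Lemma GD u v : cper u -> cper v -> G (fun x => u x + v x) = (fun x => G u x + G v x).
Proof.
move=> cu cv; apply/funext => x; rewrite /G (JD M) ?mulrDl//; exact: admissible_periodic.
Qed.

Lemma GB u v : cper u -> cper v -> G (fun x => u x - v x) = (fun x => G u x - G v x).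
Proof.
move=> cu cv; apply/funext => x; rewrite /G (JB M) ?mulrBl//; exact: admissible_periodic.
Qed.

Lemma G_cst (c : R) : G (fun=> c) = (fun=> c).
Proof.
apply/funext => x; rewrite /G [J x (fun=> c)](J_cst M).
by rewrite mulfK// gt_eqF// (J1_gt0 M).
Qed.

Lemma G_le u v : cper u -> cper v -> (forall x, u x <= v x) -> forall x, G u x <= G v x.
Proof.
move=> cu cv uv x; rewrite ler_pM2r ?invr_gt0 ?(J1_gt0 M)//.
by apply: (J_le M); [exact: admissible_periodic|exact: admissible_periodic|].
Qed.

Lemma G_ge0 u : cper u -> (forall x, 0 <= u x) -> forall x, 0 <= G u x.
Proof.
move=> cu u0 x; rewrite -[leLHS](_ : G (fun=> 0) x = 0); last by rewrite G_cst.
by apply: G_le => //; exact: continuous_periodic_cst.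
Qed.

Lemma iterG_cst n (c : R) : iter n G (fun=> c) = (fun=> c).
Proof. by elim: n => //= n ->; rewrite G_cst. Qed.

Lemma iterGB n u v : cper u -> cper v ->
  iter n G (fun x => u x - v x) = (fun x => iter n G u x - iter n G v x).
Proof.
by move=> cu cv; elim: n => //= n ->; apply: GB; exact: continuous_periodic_iterG.
Qed.

Lemma iterG_ge0 n u : cper u -> (forall x, 0 <= u x) -> forall x, 0 <= iter n G u x.
Proof.
move=> cu u0; elim: n => //= n IH x.
by apply: G_ge0 => //; exact: continuous_periodic_iterG.
Qed.

(** Density of a reversible measure: multiplied by the transition density it gives
    [a (x - q) * mu q * mu x], symmetric in [x] and [q] as [a] is even. *)
Definition invariant_weight x := J1 x * mu x.

Lemma continuous_periodic_weight : cper invariant_weight.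
Proof. exact: continuous_periodicM continuous_periodic_J1 (conj mu_cont mu_periodic). Qed.

Let mu_gt0 x : 0 < mu x.
Proof. by have /andP[m1 _] := mu_bounds x; exact: lt_le_trans m1. Qed.

Lemma invariant_weight_gt0 x : 0 < invariant_weight x.
Proof. by rewrite mulr_gt0// (J1_gt0 M). Qed.

(** Exchanging the two ends of a jump amounts to [z -> - z] together with a shift of [x] by [z],
    which preserves integrals of periodic functions over the torus. Nonnegativity permits
    Tonelli. *)
Let G_invariant_ge0 u : cper u -> (forall x, 0 <= u x) ->
  (\int[leb]_(x in @torus R d) (G u x * invariant_weight x)%:E =
   \int[leb]_(x in @torus R d) (u x * invariant_weight x)%:E)%E.
Proof.
move=> cu u0; have mT := @measurable_torus R d.
have mu' := continuous_periodic_measurable cu.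
have mmu := continuous_periodic_measurable (conj mu_cont mu_periodic).
have mpsub : measurable_fun setT (fun p : 'rV[R]_d * 'rV[R]_d => p.1 - p.2).
  have := measurableT_comp (@measurable_addp R d) (measurable_fun_pair measurable_fst
    (measurableT_comp (@measurable_sub_rV R d 0) measurable_snd)).
  by apply: eq_measurable_fun => p _ /=; rewrite sub0r.
pose F (p : 'rV[R]_d * 'rV[R]_d) : \bar R :=
  (a p.2 * (mu (p.1 - p.2) * u (p.1 - p.2)) * mu p.1)%:E.
have mF : measurable_fun setT F.
  apply/measurable_EFinP; apply: measurable_funM; last exact: (measurableT_comp mmu measurable_fst).
  apply: measurable_funM; first exact: (measurableT_comp ma measurable_snd).
  by apply: measurable_funM; [exact: (measurableT_comp mmu mpsub)|exact: (measurableT_comp mu' mpsub)].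
have F0 p : (0 <= F p)%E.
  by rewrite lee_fin !mulr_ge0// ltW.
pose F' (p : 'rV[R]_d * 'rV[R]_d) : \bar R :=
  (a p.2 * (mu (p.1 - p.2) * 1) * (mu p.1 * u p.1))%:E.
have mF' : measurable_fun setT F'.
  apply/measurable_EFinP; apply: measurable_funM; last first.
    by apply: measurable_funM; [exact: (measurableT_comp mmu measurable_fst)|exact: (measurableT_comp mu' measurable_fst)].
  apply: measurable_funM; first exact: (measurableT_comp ma measurable_snd).
  by apply: measurable_funM => //; exact: (measurableT_comp mmu mpsub).
have F'0 p : (0 <= F' p)%E.
  by rewrite lee_fin !mulr_ge0// ltW.
transitivity (\int[leb]_(x in @torus R d) \int[leb]_z F (x, z))%E.
  apply: eq_integral => x _.
  have ia := admissible_periodic x cu.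
  have i1 := J_integrable M x ia.
  rewrite /F /=; under eq_integral do rewrite mulrC.
  have i2 : leb.-integrable setT (EFin \o (fun z => mu x * (a z * (mu (x - z) * u (x - z))))).
    by have := integrableZl measurableT (mu x) i1.
  rewrite EFin_Rintegral// RintegralZl//; congr EFin.
  rewrite /invariant_weight mulrA -[X in _ = mu x * X]/(J x (fun z => u (x - z))).
  by rewrite (J_periodicE x cu); ring.
rewrite (torus_tonelli mF F0).
transitivity (\int[leb]_z \int[leb]_(x in @torus R d) F' (x, z))%E; last first.
  rewrite -(torus_tonelli mF' F'0); apply: eq_integral => x _.
  have i1 := J_integrable M x (admissible_cst _ 1).
  rewrite /F' /=; under eq_integral do rewrite mulrC.
  have i2 : leb.-integrable setT (EFin \o (fun z => mu x * u x * (a z * (mu (x - z) * 1)))).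
    by have := integrableZl measurableT (mu x * u x) i1.
  rewrite EFin_Rintegral// RintegralZl//; congr EFin.
  by rewrite /invariant_weight -[X in _ * X = _]/(J1 x); ring.
rewrite -(@ge0_integral_reflect R d 0 (fun z => \int[leb]_(x in @torus R d) F (x, z)))%E; first last.
- by move=> z; exact: integral_ge0.
- exact: measurable_torus_integral.
apply: eq_integral => z _; rewrite sub0r.
pose g x : \bar R := (a z * (mu (x - z) * 1) * (mu x * u x))%:E.
have mg : measurable_fun setT g.
  exact: (measurableT_comp mF' (measurable_pair2 z)).
have pg : coord_periodic g.
  move=> x i; rewrite /g addrAC (Zd_coord_periodic cu.2).
  by rewrite !(Zd_coord_periodic mu_periodic).
rewrite -[RHS](ge0_integral_torus_shift z pg mg); last first.
  by move=> x; rewrite lee_fin !mulr_ge0// ltW.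
apply: eq_integral => x _; rewrite /F /g /= opprK addrK -a_even; congr EFin; ring.
Qed.

Lemma G_invariant u : cper u ->
  \int[leb]_(x in @torus R d) (G u x * invariant_weight x) =
  \int[leb]_(x in @torus R d) (u x * invariant_weight x).
Proof.
move=> cu; have [B uB] := continuous_periodic_bounded cu.1 cu.2.
have mT := @measurable_torus R d.
(* Adding a constant, which [G] fixes, reduces the statement to a nonnegative function. *)
have cB := @continuous_periodic_cst R d B.
have cuB := continuous_periodicD cu cB.
have uB0 x : 0 <= u x + B by have := uB x; rewrite ler_norml => /andP[]; lra.
have := congr1 fine (G_invariant_ge0 cuB uB0).
have i1 v : cper v -> leb.-integrable (@torus R d) (EFin \o (fun x => v x * invariant_weight x)).
  move=> cv; apply: continuous_periodic_integrable_torus.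
  exact: continuous_periodicM cv continuous_periodic_weight.
rewrite -/(Rintegral _ _ _) -/(Rintegral _ _ _).
rewrite GD// G_cst.
under eq_Rintegral do rewrite mulrDl.
under [in RHS]eq_Rintegral do rewrite mulrDl.
rewrite !RintegralD//; last 4 first.
- exact: i1.
- exact: i1.
- by apply: i1; exact: continuous_periodic_G.
- exact: i1.
exact: addIr.
Qed.

Lemma iterG_invariant n u : cper u ->
  \int[leb]_(x in @torus R d) (iter n G u x * invariant_weight x) =
  \int[leb]_(x in @torus R d) (u x * invariant_weight x).
Proof.
move=> cu; elim: n => //= n <-; apply: G_invariant.
exact: continuous_periodic_iterG.
Qed.

End markov_operator.

(** * Cubes and their volumes *)

Section cubes.
Context (R : realType) (n : nat).
Notation leb := (lebesgue_rV R n).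

Definition cube (h : 'rV[R]_n) (r : R) : set 'rV[R]_n := [set x | `|x - h| <= r].

Lemma cubeE h r : 0 <= r -> cube h r = box (h - const_mx r) (h + const_mx r).
Proof.
move=> r0; apply/seteqP; split => x.
  move=> /(rV_norm_leP _ r0) xh i; have := xh i; rewrite !mxE ler_norml; lra.
move=> xh; apply/rV_norm_leP => // i; have := xh i; rewrite !mxE ler_norml; lra.
Qed.

Lemma measurable_cube h r : 0 <= r -> measurable (cube h r).
Proof. by move=> r0; rewrite cubeE//; exact: measurable_box. Qed.

Lemma lebesgue_cube h r : 0 <= r -> leb (cube h r) = ((2 * r) ^+ n)%:E.
Proof.
move=> r0; rewrite cubeE// [LHS]lebesgue_rV_box => [|i]; last by rewrite !mxE; lra.
congr EFin; rewrite -[in RHS](card_ord n) -prodr_const; apply: eq_bigr => i _.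
by rewrite !mxE; lra.
Qed.

Lemma ge0_integral_lower (A D : set 'rV[R]_n) (c : \bar R) (f : 'rV[R]_n -> \bar R) :
  measurable A -> measurable D -> A `<=` D -> (0 <= c)%E -> measurable_fun D f ->
  (forall x, 0 <= f x)%E -> (forall x, A x -> c <= f x)%E ->
  (c * leb A <= \int[leb]_(x in D) f x)%E.
Proof.
move=> mA mD AD c0 mf f0 cf; rewrite -integral_cst//.
apply: (@le_trans _ _ (\int[leb]_(x in A) f x)%E); last exact: ge0_subset_integral.
by apply: ge0_le_integral => //; exact: measurable_funS mf.
Qed.

Lemma cube_translate (h : 'rV[R]_n) (r : R) (f : 'rV[R]_n -> \bar R) : 0 <= r ->
  measurable_fun setT f -> (forall x, 0 <= f x)%E ->
  (\int[leb]_(t in cube h r) f t = \int[leb]_(t in cube 0%R r) f (h + t)%R)%E.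
Proof.
move=> r0 mf f0; rewrite integral_mkcond [RHS]integral_mkcond.
rewrite -[LHS](ge0_integral_translate h); last first.
- by move=> x; rewrite patchE; case: ifP.
- by apply/(measurable_restrictT _ (measurable_cube h r0)); exact: measurable_funTS.
apply: eq_integral => t _; rewrite !patchE addrC; congr (if _ then _ else _).
by apply/idP/idP => /set_mem /=; rewrite /cube /= => th; apply/mem_set;
  rewrite /cube /= addrAC subrr add0r subr0 in th *.
Qed.

End cubes.

Lemma Rintegral_torus_cst (R : realType) n (r : R) :
  \int[lebesgue_rV R n]_(x in @torus R n) r = r.
Proof.
by rewrite Rintegral_cst ?[X in fine X]lebesgue_torus ?mulr1//; exact: measurable_torus.
Qed.

(** * Doeblin minorization and the approximate cell solution *)

Section doeblin.
Context (R : realType) (d : nat) (a lambda mu : 'rV[R]_d -> R) (C delta alpha1 alpha2 : R).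
Notation leb := (lebesgue_rV R d).
Hypothesis M : medium a lambda mu C delta alpha1 alpha2.
Let a_cont := medium_a_cont M.
Let a_even := medium_a_even M.
Let a_ge0 := medium_a_ge0 M.
Let a_int_gt0 := medium_a_int_gt0 M.
Let lambda_cont := medium_lambda_cont M.
Let lambda_periodic := medium_lambda_periodic M.
Let alpha1_gt0 := medium_alpha1_gt0 M.
Let lambda_bounds := medium_lambda_bounds M.
Let mu_bounds := medium_mu_bounds M.
Local Notation J := (J a mu).
Local Notation G := (G a mu).
Local Notation cper := (@continuous_periodic R d).

Let ma : measurable_fun setT a. Proof. exact: measurable_a M. Qed.

Let alpha2_gt0 := medium_alpha2_gt0 M.

(** The periodic coefficients are removed by [mu >= alpha1] in the numerator and the upper bound of
    [J1] in the denominator. *)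
Let G_lower : exists2 c : R, 0 < c & forall u, cper u -> (forall x, 0 <= u x) ->
  forall xi, (c%:E * \int[leb]_z (a z * u (xi - z))%:E <= (G u xi)%:E)%E.
Proof.
have ci0 : 0 < alpha2 * \int[leb]_z a z by rewrite mulr_gt0.
exists (alpha1 / (alpha2 * \int[leb]_z a z)); first by rewrite divr_gt0.
move=> u cu u0 xi.
have au := admissible_periodic xi cu.
have iu := integrable_kernelM M au.
have iJ := J_integrable M xi au.
rewrite EFin_Rintegral// -EFinM lee_fin /G mulrAC.
have -> : alpha1 * \int[leb]_z (a z * u (xi - z)) = \int[leb]_z (alpha1 * (a z * u (xi - z))).
  by rewrite RintegralZl.
have le1 : \int[leb]_z (alpha1 * (a z * u (xi - z))) <= J xi (fun z => u (xi - z)).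
  apply: le_Rintegral => //; first by have := integrableZl measurableT alpha1 iu.
  move=> z _; rewrite mulrCA; apply: ler_wpM2l => //; apply: ler_wpM2r => //.
  by have /andP[] := mu_bounds (xi - z).
have J0 : 0 <= J xi (fun z => u (xi - z)).
  by apply: Rintegral_ge0 => z _; rewrite !mulr_ge0//; have /andP[+ _] := mu_bounds (xi - z);
    apply: le_trans; exact: ltW.
apply: ler_pM => //.
- by apply: Rintegral_ge0 => z _; rewrite !mulr_ge0// ltW.
- by rewrite invr_ge0 ltW.
- rewrite lef_pV2 ?posrE ?(J1_gt0 M)//.
  by have /andP[] := J1_bounds M xi.
Qed.

(** The half-side [2 * r] leaves room in [G2_lower] for the sum of two displacements of size [r]. *)
Let a_lower : exists z0 (r c : R), [/\ 0 < r, 0 < c & forall z, cube z0 (2 * r) z -> c <= a z].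
Proof.
have [z0 az0] : exists z0, 0 < a z0.
  apply: contrapT => /forallNP an.
  have a0 z : a z = 0 by apply/eqP; rewrite eq_le a_ge0 andbT leNgt; exact/negP/an.
  have := a_int_gt0; under eq_Rintegral do rewrite a0.
  by rewrite Rintegral_cst// mul0r ltxx.
have a20 : 0 < a z0 / 2 by rewrite divr_gt0.
have [r r0 ar] := (continuous_atP _ _).1 (@a_cont z0) _ a20.
exists z0, (r / 4), (a z0 / 2); split => //; first by rewrite divr_gt0.
move=> z zz; have /ar : `|z0 - z| < r by rewrite distrC; apply: le_lt_trans zz _; lra.
rewrite ler_norml; lra.
Qed.

Let measurable_kernel_shift (u : 'rV[R]_d -> R) xi : cper u ->
  measurable_fun setT (fun z => (a z * u (xi - z))%:E).
Proof.
move=> cu; apply/measurable_EFinP; apply: measurable_funM => //.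
exact: (measurableT_comp (continuous_periodic_measurable cu) (measurable_sub_rV xi)).
Qed.

Let measurable_shiftE (u : 'rV[R]_d -> R) x : cper u ->
  measurable_fun setT (fun t : 'rV[R]_d => (u (x + t))%:E).
Proof.
move=> cu; apply/measurable_EFinP.
have := measurableT_comp (continuous_periodic_measurable cu) (@measurable_affine R d 1 x).
by apply: eq_measurable_fun => z _ /=; rewrite scale1r addrC.
Qed.

(** The chain goes from [xi] to [xi - z] with [z] near [z0], then to [xi + t]. The second jump is
    [- z - t], and evenness gives [a (- z - t) = a (z + t)] with [z + t] still near [z0]. Each
    application of [G] contributes [c * b], and the choices of [z] contribute the volume
    [(2 * r) ^+ d]. *)
Let G2_lower : exists (r c : R), [/\ 0 < r, 0 < c & forall u, cper u -> (forall x, 0 <= u x) ->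
  forall xi, (c%:E * \int[leb]_(t in cube 0%R r) (u (xi + t)%R)%:E <= (G (G u) xi)%:E)%E].
Proof.
have [z0 [r [b [r0 b0 ab]]]] := a_lower.
have [c c0 Gc] := G_lower.
have r0' := ltW r0; have rr : 0 < (2 * r) ^+ d by rewrite exprn_gt0// mulr_gt0.
exists r, (c * b * (c * b) * (2 * r) ^+ d); split => //; first by rewrite !mulr_gt0.
move=> u cu u0 xi; have cGu := continuous_periodic_G M cu.
have Gu0 := G_ge0 M cu u0.
have muE := measurable_shiftE xi cu.
set K := (\int[leb]_(t in _) _)%E.
have K0 : (0 <= K)%E by apply: integral_ge0 => t _; rewrite lee_fin.
have mC := measurable_cube (0 : 'rV[R]_d) r0'.
have inner z : cube z0 r z -> (c%:E * (b%:E * K) <= (G u (xi - z)%R)%:E)%E.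
  move=> zz; apply: le_trans (Gc u cu u0 _); apply: lee_wpmul2l; first by rewrite lee_fin ltW.
  rewrite -(ge0_integral_reflect (- z)); last 2 first.
  - exact: measurable_kernel_shift.
  - by move=> w; rewrite lee_fin mulr_ge0.
  rewrite /K -ge0_integralZl//; last 3 first.
  - exact: measurable_funTS.
  - by move=> t _; rewrite lee_fin.
  - exact: ltW.
  apply: (@le_trans _ _ (\int[leb]_(t in cube 0%R r) (a (- z - t) * u (xi - z - (- z - t)))%:E)%E).
    apply: ge0_le_integral => //.
    - by move=> t _; rewrite -EFinM lee_fin mulr_ge0// ltW.
    - by apply: measurable_funTS; exact: measurable_funeM.
    - apply: measurable_funTS.
      exact: (measurableT_comp (measurable_kernel_shift (xi - z) cu) (measurable_sub_rV (- z))).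
    move=> t tr; rewrite -EFinM lee_fin; have -> : xi - z - (- z - t) = xi + t.
      by rewrite opprB opprK addrA addrAC subrK.
    apply: ler_wpM2r => //; rewrite a_even opprB opprK; apply: ab.
    rewrite /cube /= in zz tr *; rewrite subr0 in tr.
    have -> : t + z - z0 = t + (z - z0) by rewrite addrA.
    by rewrite (le_trans (ler_normD _ _))//; lra.
  apply: ge0_subset_integral => //.
  - exact: (measurableT_comp (measurable_kernel_shift (xi - z) cu) (measurable_sub_rV (- z))).
  - by move=> t _; rewrite lee_fin mulr_ge0.
apply: le_trans (Gc _ cGu Gu0 xi).
have cube_le z : cube z0 r z -> cube z0 (2 * r) z.
  by rewrite /cube /= => zr; apply: le_trans zr _; lra.
have I0 : (0 <= c%:E * (b%:E * K))%E by rewrite !mule_ge0 ?lee_fin ?(ltW c0) ?(ltW b0).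
have mGu := measurable_kernel_shift xi cGu.
have low : (b%:E * (c%:E * (b%:E * K)) * leb (cube z0 r) <=
    \int[leb]_z (a z * G u (xi - z))%:E)%E.
  apply: ge0_integral_lower => //; first exact: measurable_cube.
  - by rewrite mule_ge0 ?lee_fin ?(ltW b0).
  - by move=> z; rewrite lee_fin mulr_ge0.
  - move=> z zz; rewrite EFinM; apply: lee_pmul => //.
    + by rewrite lee_fin ltW.
    + by rewrite lee_fin; exact/ab/cube_le.
    + exact: inner.
rewrite [X in (_ * X <= _)%E]lebesgue_cube// in low.
apply: (@le_trans _ _ (c%:E * (b%:E * (c%:E * (b%:E * K)) * ((2 * r) ^+ d)%:E))%E).
  rewrite (muleC _ ((2 * r) ^+ d)%:E) !muleA -!EFinM.
  by rewrite (_ : c * b * (c * b) * (2 * r) ^+ d = c * (2 * r) ^+ d * b * c * b)//; ring.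
by apply: lee_wpmul2l => //; rewrite lee_fin ltW.
Qed.

(* A step of length in [r/2, r] in each coordinate, in the direction of h,
   brings the target cube closer by r/2. *)
Let iterG_cube_lower (r b : R) : 0 < r -> 0 < b ->
  (forall u, cper u -> (forall x, 0 <= u x) -> forall xi,
    (b%:E * \int[leb]_(t in cube 0%R (2 * r)%R) (u (xi + t)%R)%:E <= (G (G u) xi)%:E)%E) ->
  forall n, exists2 c : R, 0 < c & forall u, cper u -> (forall x, 0 <= u x) ->
    forall xi h, `|h| <= r + n%:R * (r / 2) ->
    (c%:E * \int[leb]_(t in cube 0%R r) (u (xi + (h + t))%R)%:E <=
     (iter n.+1.*2 G u xi)%:E)%E.
Proof.
move=> r0 b0 G2; have r0' := ltW r0; have rr : 0 <= 2 * r by lra.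
have mC := measurable_cube (0 : 'rV[R]_d) rr.
elim=> [|n [c c0 IH]].
  exists b => // u cu u0 xi h; rewrite mul0r addr0 => hr.
  apply: le_trans (G2 u cu u0 xi).
  apply: lee_wpmul2l; first by rewrite lee_fin ltW.
  rewrite -(cube_translate h (f := fun t => (u (xi + t))%:E) r0'); last 2 first.
  - exact: measurable_shiftE.
  - by move=> t; rewrite lee_fin.
  apply: ge0_subset_integral => //.
  - exact: measurable_cube.
  - by apply: measurable_funTS; exact: measurable_shiftE.
  - by move=> t _; rewrite lee_fin.
  - move=> t; rewrite /cube /= subr0 => th.
    by rewrite -[t](subrK h) (le_trans (ler_normD _ _))//; lra.
exists (b * c * (r / 2) ^+ d).
  by rewrite !mulr_gt0// exprn_gt0// divr_gt0.
move=> u cu u0 xi h hr.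
pose v := iter n.+1.*2 G u.
have cv : cper v by exact: (continuous_periodic_iterG M).
have v0 : forall x, 0 <= v x by exact: (iterG_ge0 M).
rewrite doubleS -[iter _ _ _]/(G (G v)).
apply: le_trans (G2 v cv v0 xi).
pose lo := \row_i (if 0 <= h 0 i then r / 2 else - r) : 'rV[R]_d.
pose hi := \row_i (if 0 <= h 0 i then r else - (r / 2)) : 'rV[R]_d.
set K := (\int[leb]_(t in _) _)%E.
have K0 : (0 <= K)%E by apply: integral_ge0 => t _; rewrite lee_fin.
have low : (c%:E * K * leb (box lo hi) <= \int[leb]_(t in cube 0%R (2 * r)%R) (v (xi + t)%R)%:E)%E.
  apply: ge0_integral_lower => //.
  - exact: measurable_box.
  - move=> t tb; apply/rV_norm_leP => // i; have := tb i; rewrite !mxE ler_norml.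
    by case: ifP => _; lra.
  - by rewrite mule_ge0// lee_fin ltW.
  - by apply: measurable_funTS; exact: measurable_shiftE.
  - by move=> t; rewrite lee_fin.
  - move=> t tb; rewrite /K.
    under eq_integral => s _.
      have -> : (xi + (h + s) = xi + t + (h - t + s))%R.
        by rewrite -addrA; congr (_ + _)%R; rewrite addrA [(t + _)%R]addrC subrK.
      over.
    apply: IH => //.
    have nr : 0 <= r + n%:R * (r / 2) by rewrite addr_ge0// mulr_ge0// divr_ge0.
    apply/rV_norm_leP => // i; have := tb i; rewrite !mxE ler_norml.
    have n0 : 0 <= n%:R * (r / 2) by rewrite mulr_ge0// divr_ge0.
    have := le_trans (rV_coord_le h i) hr; rewrite ler_norml -natr1 mulrDl mul1r.
    by case: ifPn; rewrite -?ltNge; lra.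
rewrite [X in (_ * X <= _)%E]lebesgue_rV_box in low; last first.
  by move=> i; rewrite !mxE; case: ifP => _; lra.
rewrite (eq_bigr (fun=> r / 2)) in low; last by move=> i _; rewrite !mxE; case: ifP => _; lra.
rewrite prodr_const card_ord in low.
apply: (@le_trans _ _ (b%:E * (c%:E * K * ((r / 2) ^+ d)%:E))%E).
  by rewrite (muleC _ ((r / 2) ^+ d)%:E) !muleA -!EFinM (_ : b * c * (r / 2) ^+ d = b * (r / 2) ^+ d * c)//; ring.
by apply: lee_wpmul2l => //; rewrite lee_fin ltW.
Qed.

(** Every cube around [xi + h] with [h] in the torus is charged with the same constant. Averaging
    over [h] and exchanging the integrals, periodicity turns the integral over [h] into that of [u]
    for each [t], and the volume of the cube remains as a factor. *)
Lemma iterG_lower : exists (N : nat) (c : R), 0 < c /\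
  forall u, cper u -> (forall x, 0 <= u x) -> forall xi,
    c * \int[leb]_(x in @torus R d) u x <= iter N G u xi.
Proof.
have [r' [b [r'0 b0 G2]]] := G2_lower.
have r0 : 0 < r' / 2 by rewrite divr_gt0.
set r := r' / 2 in r0; have r0' := ltW r0.
have r2 : r' = 2 * r by rewrite /r; lra.
rewrite r2 in G2.
(* [n] steps of length [r / 2] cover the distance 1, the largest norm of a point of the torus. *)
have /archi_boundP := ltW (divr_gt0 (@ltr0Sn R 1) r0).
set n := Num.bound _ => n2.
have [c c0 low] := iterG_cube_lower r0 b0 G2 n.
have nr : 1 <= r + n%:R * (r / 2).
  by move: n2; rewrite ltr_pdivrMr// => n2; have := n2; nra.
exists n.+1.*2, (c * (2 * r) ^+ d); split; first by rewrite mulr_gt0// exprn_gt0// mulr_gt0.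
move=> u cu u0 xi; have mT := @measurable_torus R d.
have iu := continuous_periodic_integrable_torus cu.
rewrite -lee_fin EFinM -EFin_Rintegral//.
set v := iter _ _ _ _.
have mC := measurable_cube (0 : 'rV[R]_d) r0'.
pose F (p : 'rV[R]_d * 'rV[R]_d) : \bar R :=
  (\1_(cube 0 r) p.2 * u (xi + (p.1 + p.2)))%:E.
have mF : measurable_fun setT F.
  apply/measurable_EFinP; apply: measurable_funM.
    have mI : measurable_fun setT (\1_(cube 0 r) : 'rV[R]_d -> R) by exact: measurable_indic.
    exact: (measurableT_comp mI measurable_snd).
  apply/measurable_EFinP; have := measurableT_comp (measurable_shiftE xi cu) (@measurable_addp R d).
  exact.
have F0 p : (0 <= F p)%E by rewrite lee_fin mulr_ge0.
have FE h : (\int[leb]_(t in cube 0%R r) (u (xi + (h + t))%R)%:E = \int[leb]_t F (h, t))%E.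
  rewrite integral_mkcond; apply: eq_integral => t _.
  by rewrite patchE /F /= indicE; case: ifP => _; rewrite ?mul1r ?mul0r.
have up : (c%:E * \int[leb]_(h in @torus R d) \int[leb]_t F (h, t) <= v%:E)%E.
  rewrite -ge0_integralZl//; last 3 first.
  - by apply: measurable_funTS; exact: (measurable_fun_fubini_tonelli_F F mF F0).
  - by move=> h _; exact: integral_ge0.
  - exact: ltW.
  have -> : v%:E = (\int[leb]_(h in @torus R d) v%:E)%E.
    by rewrite integral_cst// [X in (_ * X)%E]lebesgue_torus mule1.
  apply: ge0_le_integral => //.
  - by move=> h _; rewrite mule_ge0 ?integral_ge0// lee_fin ltW.
  - by apply: measurable_funTS; apply: measurable_funeM; exact: (measurable_fun_fubini_tonelli_F F mF F0).
  - move=> h hT; rewrite -FE; apply: low => //.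
    by apply: le_trans nr; exact: torus_norm_le1.
apply: le_trans up; rewrite EFinM -muleA; apply: lee_wpmul2l; first by rewrite lee_fin ltW.
rewrite (torus_tonelli mF F0) muleC -(lebesgue_cube (0 : 'rV[R]_d) r0').
apply: ge0_integral_lower => //.
- by apply: integral_ge0 => x _; rewrite lee_fin.
- exact: measurable_torus_integral.
- by move=> t; exact: integral_ge0.
move=> t tr; apply: eq_le_of.
have pu : coord_periodic (EFin \o u).
  by move=> x i /=; rewrite (Zd_coord_periodic cu.2).
rewrite -[LHS](ge0_integral_torus_shift (xi + t) pu); last 2 first.
- by apply/measurable_EFinP; exact: continuous_periodic_measurable.
- by move=> x; rewrite lee_fin.
apply: eq_integral => h _; rewrite /F /= indicE mem_set// mul1r.
by congr (u _)%:E; rewrite addrCA.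
Qed.

Let minorization_le1 (N : nat) (c : R) :
  (forall u, cper u -> (forall x, 0 <= u x) -> forall xi,
    c * \int[leb]_(x in @torus R d) u x <= iter N G u xi) -> c <= 1.
Proof.
move=> low; have /= := low _ (continuous_periodic_cst d 1) (fun=> ler01) 0.
by rewrite (iterG_cst M) Rintegral_torus_cst mulr1.
Qed.

(** The minorization applied to [v - p] and to [p' - v] raises the lower bound by [c * (I - p)] and
    lowers the upper one by [c * (p' - I)], with [I] the mean of [v]; [I] cancels in the new gap,
    which is [(1 - c) * (p' - p)]. *)
Let iterG_oscillation (N : nat) (c : R) : 0 < c ->
  (forall u, cper u -> (forall x, 0 <= u x) -> forall xi,
    c * \int[leb]_(x in @torus R d) u x <= iter N G u xi) ->
  forall u (m m' : R), cper u -> (forall x, m <= u x <= m') -> forall k,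
  exists p p' : R, p' - p <= (1 - c) ^+ k * (m' - m) /\
    forall x, p <= iter (k * N) G u x <= p'.
Proof.
move=> c0 low u m m' cu um k; have mT := @measurable_torus R d.
elim: k => [|k [p [p' [pp IH]]]]; first by exists m, m'; rewrite mul1r.
set v := iter (k * N) G u in IH.
have cv : cper v by exact: (continuous_periodic_iterG M).
have cp := continuous_periodic_cst d p; have cp' := continuous_periodic_cst d p'.
have c1 := minorization_le1 low.
set I := \int[leb]_(x in @torus R d) v x.
have iv := continuous_periodic_integrable_torus cv.
have ip := continuous_periodic_integrable_torus cp.
have ip' := continuous_periodic_integrable_torus cp'.
exists (p + c * (I - p)), (p' - c * (p' - I)); split.
  have -> : p' - c * (p' - I) - (p + c * (I - p)) = (1 - c) * (p' - p) by ring.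
  by rewrite exprS -mulrA ler_wpM2l// subr_ge0.
move=> x; rewrite mulSn iterD -/v.
have := low _ (continuous_periodicB cv cp) (fun y => _) x.
have := low _ (continuous_periodicB cp' cv) (fun y => _) x.
rewrite !(iterGB M)// !(iterG_cst M) !RintegralB// !Rintegral_torus_cst -/I.
have h1 : forall x0, 0 <= p' - v x0 by move=> y; have /andP[] := IH y; lra.
have h2 : forall x0, 0 <= v x0 - p by move=> y; have /andP[] := IH y; lra.
by move=> /(_ h1) + /(_ h2); lra.
Qed.

(** The invariant mean of the iterates remains 0, so any interval containing their values contains 0
    and its length bounds the sup norm. *)
Lemma iterG_cvg0 u (eta : R) : cper u -> 0 < eta ->
  \int[leb]_(x in @torus R d) (u x * invariant_weight a mu x) = 0 ->
  exists n, forall x, `|iter n G u x| <= eta.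
Proof.
move=> cu eta0 u0; have [N [c [c0 low]]] := iterG_lower.
have mT := @measurable_torus R d.
have [B uB] := continuous_periodic_bounded cu.1 cu.2.
have B0 : 0 <= B by exact: le_trans (uB 0).
have uB' x : - B <= u x <= B by rewrite -ler_norml.
have c1 := minorization_le1 low.
have [k kB] : exists k, (1 - c) ^+ k * (B - - B) <= eta.
  have c'1 : `|1 - c| < 1 by rewrite ger0_norm; lra.
  have /cvgrPdist_le/(_ _ eta0)[k _ /(_ k (leqnn k))] := cvg_geometric (B - - B) c'1.
  rewrite /geometric /= sub0r normrN mulrC => kB; exists k.
  exact: le_trans (ler_norm _) kB.
have [p [p' [pp iterP]]] := iterG_oscillation c0 low cu uB' k.
have cv := continuous_periodic_iterG M (k * N) cu.
have cW := continuous_periodic_weight M.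
have W0 := invariant_weight_gt0 M.
have v0 := iterG_invariant M (k * N) cu; rewrite u0 in v0.
set v := iter _ _ _ in cv iterP v0.
have iW := continuous_periodic_integrable_torus cW.
have ivW := continuous_periodic_integrable_torus (continuous_periodicM cv cW).
have IW : 0 < \int[leb]_(x in @torus R d) invariant_weight a mu x.
  have : alpha1 * \int[leb]_z a z * alpha1 <= \int[leb]_(x in @torus R d) invariant_weight a mu x.
    rewrite -[leLHS](@Rintegral_torus_cst R d); apply: le_Rintegral => //.
      exact: (continuous_periodic_integrable_torus (continuous_periodic_cst d _)).
    move=> x _; apply: ler_pM.
    - by rewrite mulr_ge0// ltW.
    - exact: ltW.
    - by have /andP[] := J1_bounds M x.
    - by have /andP[] := mu_bounds x.
  by apply: lt_le_trans; rewrite !mulr_gt0.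
(* Integration of [r <= s * v] against the invariant weight; the signs [s = 1] and [s = - 1] treat
   the lower and the upper end. *)
have bound (r s : R) (s1 : `|s| = 1) : (forall x, r <= s * v x) -> r <= 0.
  move=> rv; rewrite -(pmulr_rle0 _ IW) mulrC.
  have <- : \int[leb]_(x in @torus R d) (s * (v x * invariant_weight a mu x)) = 0.
    by rewrite RintegralZl// v0 mulr0.
  rewrite -RintegralZl//; apply: le_Rintegral => //.
  - exact: (continuous_periodic_integrable_torus (continuous_periodicM (continuous_periodic_cst d r) cW)).
  - exact: (continuous_periodic_integrable_torus
      (continuous_periodicM (continuous_periodic_cst d s) (continuous_periodicM cv cW))).
  - by move=> x _; rewrite mulrA ler_wpM2r// ltW.
have p0 : p <= 0.
  by apply: (bound p 1 (normr1 _)) => x; rewrite mul1r; have /andP[] := iterP x.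
have p'0 : 0 <= p'.
  rewrite -oppr_le0; apply: (bound _ (-1) (normrN1 _)) => x.
  by rewrite mulN1r lerN2; have /andP[] := iterP x.
have ppe := le_trans pp kB; exists (k * N)%N => x.
rewrite -/v ler_norml; have /andP[pv vp] := iterP x; apply/andP; split.
  by apply: le_trans pv; lra.
by apply: le_trans vp _; lra.
Qed.

Lemma approximate_cell_solution (Phi : 'rV[R]_d -> R) (eta : R) : cper Phi -> 0 < eta ->
  \int[leb]_(x in @torus R d) (Phi x * (mu x / lambda x)) = 0 ->
  exists2 kappa2, cper kappa2 & forall xi,
    `|lambda xi * J xi (fun z => kappa2 (xi - z) - kappa2 xi) - Phi xi| <= eta.
Proof.
move=> cPhi eta0 Phi0; have J10 x : 0 < J1 a mu x by exact: (J1_gt0 M).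
have l0 x : 0 < lambda x by have /andP[+ _] := lambda_bounds x; apply: lt_le_trans.
pose L x := lambda x * J1 a mu x.
have cL : cper L by exact: continuous_periodicM (conj lambda_cont lambda_periodic) (continuous_periodic_J1 M).
have L0 x : 0 < L x by rewrite mulr_gt0.
have Ln0 x : L x != 0 by rewrite gt_eqF.
pose Psi x := Phi x * (L x)^-1.
have cPsi : cper Psi by exact: continuous_periodicM cPhi (continuous_periodicV cL Ln0).
have PsiW : \int[leb]_(x in @torus R d) (Psi x * invariant_weight a mu x) = 0.
  rewrite -[RHS]Phi0; apply: eq_Rintegral => x _.
  rewrite /Psi /invariant_weight /L.
  by field; rewrite !gt_eqF//; exact: J10.
have ia0 := integral_a_ge0 M.
(* The final defect is [L xi * iter n G Psi xi], and [L] is at most this denominator. *)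
have e0 : 0 < eta / (alpha2 * (alpha2 * \int[leb]_z a z)) by rewrite divr_gt0// !mulr_gt0.
have [n nP] := iterG_cvg0 cPsi e0 PsiW.
(* [k2] is minus the sum of the first [n] iterates, beginning with [Psi] itself, so that [G k2 - k2]
   telescopes. *)
have [k2 ck2 k2E] : exists2 k2, cper k2 & forall x, G k2 x - k2 x = Psi x - iter n G Psi x.
  elim: n {nP} => [|n [k2 ck2 k2E]].
    by exists (fun=> 0) => [|x]; [exact: continuous_periodic_cst|rewrite (G_cst M) !subrr].
  have cn := continuous_periodic_iterG M n cPsi.
  exists (fun x => k2 x - iter n G Psi x); first exact: continuous_periodicB.
  by move=> x; rewrite (GB M)//=; have := k2E x; lra.
exists k2 => // xi.
have JE : J xi (fun z => k2 (xi - z) - k2 xi) = J1 a mu xi * (G k2 xi - k2 xi).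
  rewrite (JB M); [|exact: admissible_periodic|exact: admissible_cst].
  rewrite (J_periodicE M)// mulrBr; congr (_ - _).
  by rewrite [LHS](J_cst M) mulrC.
have -> : lambda xi * J xi (fun z => k2 (xi - z) - k2 xi) - Phi xi = - (L xi * iter n G Psi xi).
  rewrite JE k2E mulrA -/(L xi) mulrBr /Psi mulrCA divff// mulr1; ring.
rewrite normrN normrM gtr0_norm//.
have Lb : L xi <= alpha2 * (alpha2 * \int[leb]_z a z).
  apply: ler_pM => //; first exact: ltW; first exact: ltW.
  - by have /andP[] := lambda_bounds xi.
  - by have /andP[] := J1_bounds M xi.
apply: le_trans (ler_pM (ltW (L0 xi)) (normr_ge0 _) Lb (nP xi)) _.
by rewrite mulrC divfK// gt_eqF// !mulr_gt0.
Qed.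

End doeblin.

(** * Taylor expansions from partial derivatives *)

Section real_taylor.
Context (R : realType).
Implicit Types phi : R -> R.

Lemma mean_value0 phi phi1 (b : R) : (forall t : R, is_derive t 1 phi (phi1 t)) ->
  exists2 c, `|c| <= `|b| & phi b - phi 0 = phi1 c * b.
Proof.
move=> dphi.
have cphi i : {within [set` (i : interval R)], continuous phi}.
  by apply: derivable_within_continuous => x _; exact: (@ex_derive _ _ _ _ _ _ _ (dphi x)).
have [b0|b0] := leP 0 b.
  have [c] := MVT_segment b0 (fun x _ => dphi x) (cphi _).
  rewrite in_itv/= => /andP[c0 cb] ->; exists c; last by rewrite subr0.
  by rewrite !ger0_norm// (le_trans c0).
have [c] := MVT_segment (ltW b0) (fun x _ => dphi x) (cphi _).
rewrite in_itv/= => /andP[bc c0] E; exists c.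
  by rewrite !ler0_norm ?lerN2// ?(ltW b0).
by rewrite -opprB E sub0r mulrN opprK.
Qed.

(** Two mean value steps, on the remainder [r] and then on [phi1], express the error through an
    increment of [phi2] from 0. *)
Lemma real_taylor2 phi phi1 phi2 (omega : R) :
  (forall t : R, is_derive t 1 phi (phi1 t)) -> (forall t : R, is_derive t 1 phi1 (phi2 t)) ->
  (forall t : R, `|t| <= 1 -> `|phi2 t - phi2 0| <= omega) ->
  `|phi 1 - phi 0 - phi1 0 - phi2 0 / 2| <= omega.
Proof.
move=> d1 d2 om.
pose r t := phi t - (phi1 0 * t + phi2 0 / 2 * t ^+ 2).
have dr (t : R) : is_derive t 1 r (phi1 t - (phi1 0 + phi2 0 * t)).
  rewrite /r; apply: is_derive_eq.
  by rewrite /GRing.scale /=; field.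
have [c c1 E] := mean_value0 1 dr.
have [c' c'c E'] := mean_value0 c d2.
have -> : phi 1 - phi 0 - phi1 0 - phi2 0 / 2 = r 1 - r 0 by rewrite /r; ring.
rewrite E mulr1; have -> : phi1 c - (phi1 0 + phi2 0 * c) = (phi2 c' - phi2 0) * c.
  by rewrite opprD addrA E'; ring.
rewrite normr1 in c1.
rewrite normrM -[leRHS]mulr1; apply: ler_pM => //.
by apply: om; exact: le_trans c'c c1.
Qed.

End real_taylor.

Section directional_derivative.
Context (R : realType) (d : nat).
Implicit Types (g : 'rV[R]_d -> R) (x h v : 'rV[R]_d).

Lemma is_derive_line g x v (t : R) : derivable g (t *: v + x) v ->
  is_derive t 1 (fun s : R => g (s *: v + x)) ('D_v g (t *: v + x)).
Proof.
have E : (fun h : R => h^-1 *: (((fun s : R => g (s *: v + x)) \o shift t) (h *: (1 : R)) - g (t *: v + x)))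
    = (fun h : R => h^-1 *: ((g \o shift (t *: v + x)) (h *: v) - g (t *: v + x))).
  by apply/funext => h; rewrite /= /shift /= scalerDl addrA [h *: 1]mulr1.
move=> dg; apply: DeriveDef.
  by rewrite /derivable E.
by rewrite /derive E.
Qed.

Variable g : 'rV[R]_d -> R.
Hypothesis g_derivable : forall y i, derivable g y (delta_mx 0 i).

(** Partial derivatives control moves along the axes, so the path from [x] to [x + h] changes one
    coordinate at a time; [p k] is its vertex after [k] of them. *)
Lemma coordinate_increment_bound x h (omega : R) :
  (forall y i, `|y - x| <= `|h| -> `|partial i g y - partial i g x| <= omega) ->
  `|g (x + h) - g x - \sum_i h 0 i * partial i g x| <= (\sum_i `|h 0 i|) * omega.
Proof.
move=> om.
pose p (k : nat) : 'rV[R]_d := \row_i (if (i < k)%N then x 0 i + h 0 i else x 0 i).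
have p0 : p 0%N = x by apply/rowP => i; rewrite mxE.
have pd : p d = x + h by apply/rowP => i; rewrite !mxE ltn_ord.
have -> : g (x + h) - g x = \sum_(i < d) (g (p i.+1) - g (p i)).
  by rewrite -(big_mkord xpredT (fun k => g (p k.+1) - g (p k))) telescope_sumr// pd p0.
rewrite -sumrB mulr_suml; apply: le_trans (ler_norm_sum _ _ _) _; apply: ler_sum => i _.
have pS : p i.+1 = h 0 i *: delta_mx 0 i + p i.
  apply/rowP => j; rewrite !mxE ltnS eqxx/=.
  have [<-|ij] := eqVneq i j; first by rewrite leqnn ltnn mulr1 addrC.
  have -> : (j <= i)%N = (j < i)%N by rewrite leq_eqVlt; case: eqVneq => // /val_inj ji; rewrite ji eqxx in ij.
  by rewrite mulr0 add0r.
have [c ch E] := mean_value0 (h 0 i) (fun t => @is_derive_line g (p i) (delta_mx 0 i) t (@g_derivable _ i)).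
rewrite scale0r add0r -pS in E; rewrite E mulrC -mulrBr normrM ler_wpM2l//.
apply: om; apply/rV_norm_leP => // j; rewrite !mxE eqxx/=.
have [<-|ij] := eqVneq i j.
  by rewrite ltnn mulr1 addrK (le_trans ch)// rV_coord_le.
rewrite mulr0 add0r; case: ifP => _; last by rewrite subrr normr0.
by rewrite addrAC subrr add0r rV_coord_le.
Qed.

Hypothesis g_continuous : forall i, continuous (partial i g).

(** [schwartz] speaks of partial derivatives, whereas the second-order expansion is taken along
    segments; continuity of the partials is the link. *)
Lemma is_derive_direction x h (t : R) :
  is_derive t 1 (fun s : R => g (s *: h + x)) (\sum_i h 0 i * partial i g (t *: h + x)).
Proof.
set l := \sum_i _; pose y := t *: h + x.
pose S := \sum_i `|h 0 i|; have S0 : 0 <= S by apply: sumr_ge0.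
suff L : (fun s : R => s^-1 *: (((fun s : R => g (s *: h + x)) \o shift t) (s *: (1 : R)) - g y)) @ 0^' --> l.
  by apply: DeriveDef; [apply/cvg_ex; exists l|exact: cvg_lim].
apply/cvgrPdist_le => e e0.
have eS : 0 < e / (S + 1) by rewrite divr_gt0// ltr_wpDl.
have Hi i : \forall z \near y, `|partial i g y - partial i g z| <= e / (S + 1).
  by move/cvgrPdist_le: (@g_continuous i y); exact.
have HF := filter_forall (nbhs_filter y) Hi.
have [r /= r0 Hr] := (nbhs_ballP _ _).1 HF.
have rh : 0 < r / (`|h| + 1) by rewrite divr_gt0// ltr_wpDl.
apply/nbhs_ballP; exists (r / (`|h| + 1)) => //= s; rewrite -ball_normE /= sub0r normrN => sr s0.
have shr : `|s *: h| < r.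
  rewrite normrZ; apply: (@le_lt_trans _ _ (`|s| * (`|h| + 1))).
    by rewrite ler_wpM2l// lerDl.
  by rewrite -ltr_pdivlMr// ltr_wpDl.
have -> : (s *: (1 : R) + t) *: h + x = y + s *: h.
  by rewrite [s *: 1]mulr1 scalerDl -addrA addrC.
have om z i : `|z - y| <= `|s *: h| -> `|partial i g z - partial i g y| <= e / (S + 1).
  move=> zy; rewrite distrC; apply: Hr; rewrite -ball_normE /= distrC.
  exact: le_lt_trans zy shr.
have := coordinate_increment_bound om.
have -> : \sum_i (s *: h) 0 i * partial i g y = s * l.
  by rewrite mulr_sumr; apply: eq_bigr => i _; rewrite mxE mulrA.
have -> : \sum_i `|(s *: h) 0 i| = `|s| * S.
  by rewrite mulr_sumr; apply: eq_bigr => i _; rewrite mxE normrM.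
move=> b; rewrite -(ler_pM2l (_ : 0 < `|s|)) ?normr_gt0// -normrM mulrBr.
rewrite [s * (s^-1 *: _)]mulrA divff// mul1r distrC.
apply: le_trans b _; rewrite -mulrA ler_wpM2l// mulrCA ler_piMr ?(ltW e0)//.
by rewrite ler_pdivrMr ?mul1r ?lerDl// ltr_wpDl.
Qed.

End directional_derivative.

Lemma common_bound (R : realType) (I : finType) (T : Type) (u : I -> T -> R) :
  (forall i, exists B, forall x, `|u i x| <= B) ->
  exists2 B, 0 <= B & forall i x, `|u i x| <= B.
Proof.
move=> /choice[b bP]; exists (\sum_i `|b i|); first exact: sumr_ge0.
move=> i x; rewrite (bigD1 i)//= (le_trans (bP i x))// (le_trans (ler_norm _))// lerDl.
exact: sumr_ge0.
Qed.

(** * Schwartz functions *)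

Section schwartz_functions.
Context (R : realType) (d : nat).
Implicit Types f : 'rV[R]_d -> R.

(** [foldr] applies the last index of the list first, whence [rcons]. *)
Lemma schwartz_partial f i : schwartz f -> schwartz (partial i f).
Proof. by move=> sf s; have := sf (rcons s i); rewrite /partials foldr_rcons. Qed.

Lemma schwartz_derivable f : schwartz f -> forall y i, derivable f y (delta_mx 0 i).
Proof. by move=> sf y i; have [+ _ _] := sf [::]; exact. Qed.

Lemma schwartz_continuous f : schwartz f -> continuous f.
Proof. by move=> sf; have [_ + _] := sf [::]. Qed.

Lemma schwartz_bounded f : schwartz f -> exists B, forall x, `|f x| <= B.
Proof.
move=> sf; have [_ _ /(_ 0%N)[B fB]] := sf [::].
by exists B => x; have := fB x; rewrite expr0 mul1r.
Qed.

Lemma schwartz_vanishing f : schwartz f -> vanishing_at_infinity f.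
Proof.
move=> sf e e0; have [_ _ /(_ 1%N)[B fB]] := sf [::].
have B0 : 0 <= B by apply: le_trans (fB 0); rewrite mulr_ge0// expr1 sqrtr_ge0.
exists (B / e) => x xB; rewrite -(ltr_pM2l (_ : 0 < `|x|)); last first.
  by apply: le_lt_trans xB; rewrite divr_ge0// ltW.
apply: (@le_lt_trans _ _ B); last by rewrite -ltr_pdivrMr.
apply: le_trans (fB x); rewrite expr1 ler_wpM2r//; exact: rV_norm_eucl.
Qed.

Lemma schwartz_taylor1 f x h (omega : R) : schwartz f -> 0 <= omega ->
  (forall y i, `|y - x| <= `|h| -> `|partial i f y - partial i f x| <= omega) ->
  `|f (x + h) - f x - \sum_i h 0 i * partial i f x| <= d%:R * `|h| * omega.
Proof.
move=> sf om0 om; apply: le_trans (coordinate_increment_bound (schwartz_derivable sf) om) _.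
apply: ler_wpM2r => //.
apply: (@le_trans _ _ (\sum_(i < d) `|h|)); last by rewrite sumr_const card_ord mulr_natl.
by apply: ler_sum => j _; exact: rV_coord_le.
Qed.

Lemma schwartz_taylor2 f x h (omega : R) : schwartz f ->
  (forall y i j, `|y - x| <= `|h| ->
     `|partial i (partial j f) y - partial i (partial j f) x| <= omega) ->
  `|f (x + h) - f x - \sum_i h 0 i * partial i f x
     - \sum_i \sum_j h 0 i * h 0 j * partial i (partial j f) x / 2| <=
  d%:R ^+ 2 * `|h| ^+ 2 * omega.
Proof.
move=> sf om.
pose phi (t : R) := f (t *: h + x).
pose phi1 (t : R) := \sum_j h 0 j * partial j f (t *: h + x).
pose phi2 (t : R) := \sum_j h 0 j * \sum_i h 0 i * partial i (partial j f) (t *: h + x).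
have sp i := schwartz_partial i sf.
have d1 (t : R) : is_derive t 1 phi (phi1 t).
  apply: is_derive_direction; first exact: schwartz_derivable.
  by move=> i; exact: schwartz_continuous.
have d2 (t : R) : is_derive t 1 phi1 (phi2 t).
  have -> : phi1 = \sum_(j < d) (h 0 j \*: (fun t : R => partial j f (t *: h + x))).
    by apply/funext => s; rewrite fct_sumE.
  apply: is_derive_sum => j; apply: is_deriveZ.
  apply: is_derive_direction; first exact: schwartz_derivable.
  by move=> i; exact: schwartz_continuous (schwartz_partial _ _).
have E2 (t : R) : phi2 t = \sum_i \sum_j h 0 i * h 0 j * partial i (partial j f) (t *: h + x).
  rewrite /phi2 [RHS]exchange_big /=; apply: eq_bigr => j _; rewrite mulr_sumr.
  by apply: eq_bigr => i _; rewrite mulrA (mulrC (h 0 j)).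
have om2 (t : R) : `|t| <= 1 -> `|phi2 t - phi2 0| <= d%:R ^+ 2 * `|h| ^+ 2 * omega.
  move=> t1; rewrite !E2 -sumrB.
  apply: le_trans (ler_norm_sum _ _ _) _.
  apply: (@le_trans _ _ (\sum_(i < d) \sum_(j < d) `|h| ^+ 2 * omega)).
    apply: ler_sum => i _; rewrite -sumrB; apply: le_trans (ler_norm_sum _ _ _) _.
    apply: ler_sum => j _; rewrite scale0r add0r -mulrBr normrM; apply: ler_pM => //.
      by rewrite normrM expr2; apply: ler_pM => //; exact: rV_coord_le.
    by apply: om; rewrite addrK normrZ ler_piMl.
  by rewrite !sumr_const card_ord -mulrnA -[leLHS]mulr_natl natrM -expr2 mulrA.
have := real_taylor2 d1 d2 om2.
rewrite /phi /phi1 scale1r !scale0r !add0r (addrC h) E2 scale0r add0r mulr_suml.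
by rewrite (eq_bigr _ (fun i _ => mulr_suml _ _ _ _)).
Qed.

(** Combines boundedness with a Lipschitz estimate. For second derivatives it produces the factor
    min(1, eps |z|) of the remainder. *)
Lemma schwartz_increment f : schwartz f -> exists2 K : R, 0 <= K & forall x y,
  `|f y - f x| <= K * Num.min 1 `|y - x|.
Proof.
move=> sf; have [B fB] := schwartz_bounded sf.
have B0 : 0 <= B by exact: le_trans (fB 0).
have [B' B'0 fB'] : exists2 B', 0 <= B' & forall i x, `|partial i f x| <= B'.
  by apply: common_bound => i; exact: schwartz_bounded (schwartz_partial i sf).
(* [2 * B'] from the remainder of the first-order expansion and [B'] from its linear part. *)
pose c := d%:R * (3 * B'); have c0 : 0 <= c by rewrite !mulr_ge0.
exists (2 * B + c) => [|x y]; first by rewrite addr_ge0// mulr_ge0.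
have h1 : `|f y - f x| <= 2 * B.
  by rewrite (le_trans (ler_normB _ _))// mulr_natl mulr2n lerD.
have h2 : `|f y - f x| <= c * `|y - x|.
  have om z i : `|z - x| <= `|y - x| -> `|partial i f z - partial i f x| <= 2 * B'.
    by move=> _; rewrite (le_trans (ler_normB _ _))// [leRHS]mulr_natl mulr2n lerD.
  have := schwartz_taylor1 sf (mulr_ge0 (ler0n _ 2) B'0) om; rewrite (addrC x) subrK => h.
  have s1 : `|\sum_i (y - x) 0 i * partial i f x| <= d%:R * B' * `|y - x|.
    apply: le_trans (ler_norm_sum _ _ _) _.
    apply: (@le_trans _ _ (\sum_(i < d) B' * `|y - x|)); last first.
      by rewrite sumr_const card_ord -[leLHS]mulr_natl mulrA.
    by apply: ler_sum => i _; rewrite normrM mulrC; apply: ler_pM => //; exact: rV_coord_le.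
  rewrite -[f y - f x](subrK (\sum_i (y - x) 0 i * partial i f x)).
  apply: le_trans (ler_normD _ _) _; apply: le_trans (lerD h s1) _.
  by apply: eq_le_of; rewrite /c; ring.
have [m|m] := leP 1 `|y - x|; first by rewrite mulr1; lra.
by apply: le_trans h2 _; rewrite ler_wpM2r//; lra.
Qed.

End schwartz_functions.

(** * The two cell problems *)

Section cell_integrands.
Context (R : realType) (d : nat).

Lemma admissible_half_coord2 (i j : 'I_d) : admissible (fun z : 'rV[R]_d => z 0 i * z 0 j / 2).
Proof.
have := admissibleZ 2^-1 (@admissible_coord2 R d i j).
by under eq_fun do rewrite mulrC.
Qed.

Lemma admissible_coordM_periodic (u : 'rV[R]_d -> R) xi i : continuous_periodic u ->
  admissible (fun z => z 0 i * u (xi - z)).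
Proof.
move=> cu; have [mc _] := admissible_periodic xi cu.
have [B uB] := continuous_periodic_bounded cu.1 cu.2.
have := @admissibleM_bounded R d (fun z => u (xi - z)) _ mc
  (ex_intro _ B (fun z => uB (xi - z))) (@admissible_coord R d i).
by under eq_fun do rewrite mulrC.
Qed.

Lemma admissible_cell (u : 'rV[R]_d -> R) xi i j : continuous_periodic u ->
  admissible (fun z => z 0 i * z 0 j / 2 - z 0 i * u (xi - z)).
Proof.
move=> cu; apply: admissibleB; first exact: admissible_half_coord2.
exact: admissible_coordM_periodic.
Qed.

Lemma admissible_tail (eps : R) : 0 <= eps ->
  admissible (fun z : 'rV[R]_d => (1 + `|z|) ^+ 2 * Num.min 1 (eps * `|z|)).
Proof.
move=> eps0; split.
  apply: measurable_funM; first exact: (@admissible_sqr_norm R d).1.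
  apply: measurable_minr => //; apply: measurable_funM => //.
  exact: measurable_norm_rV.
exists 1 => z; rewrite mul1r ger0_norm ?mulr_ge0 ?sqr_ge0// ?le_min ?ler01 ?mulr_ge0//.
by rewrite ler_piMr ?sqr_ge0// ge_min lexx.
Qed.

End cell_integrands.

Section cell_problems.
Context (R : realType) (d : nat) (a lambda mu : 'rV[R]_d -> R) (C delta alpha1 alpha2 : R).
Notation leb := (lebesgue_rV R d).
Hypothesis M : medium a lambda mu C delta alpha1 alpha2.
Let a_ge0 := medium_a_ge0 M.
Let lambda_cont := medium_lambda_cont M.
Let mu_cont := medium_mu_cont M.
Let lambda_periodic := medium_lambda_periodic M.
Let mu_periodic := medium_mu_periodic M.
Let alpha1_gt0 := medium_alpha1_gt0 M.
Let lambda_bounds := medium_lambda_bounds M.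
Local Notation J := (J a mu).
Local Notation cper := (@continuous_periodic R d).

Let ma : measurable_fun setT a. Proof. exact: measurable_a M. Qed.

Lemma kernel_tail (e : R) : 0 < e -> exists2 eps0, 0 < eps0 &
  forall eps, 0 < eps < eps0 ->
    \int[leb]_z (a z * ((1 + `|z|) ^+ 2 * Num.min 1 (eps * `|z|))) <= e.
Proof.
(* With [|v|] for [eps] the integral is defined for parameters of either sign, and the claim becomes
   its continuity at [v = 0]. *)
move=> e0; pose F (v : R) (z : 'rV[R]_d) := a z * ((1 + `|z|) ^+ 2 * Num.min 1 (`|v| * `|z|)).
have min0 (v : R) (z : 'rV[R]_d) : 0 <= Num.min 1 (`|v| * `|z|) by rewrite le_min ler01 mulr_ge0.
have cF : {for (0 : R), continuous (fun v : R => \int[leb]_(z in setT) F v z)}.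
  apply: (@continuous_Rintegral R _ _ leb R setT F (fun z => a z * (1 + `|z|) ^+ 2) 0 1) => //.
  - by move=> v; apply: measurable_funM => //; have [] := @admissible_tail R d _ (normr_ge0 v).
  - move=> z _; apply/continuous_atP => e' e'0.
    pose K := a z * (1 + `|z|) ^+ 2 * `|z|.
    have K0 : 0 <= K by rewrite !mulr_ge0// sqr_ge0.
    exists (e' / (K + 1)); first by rewrite divr_gt0// ltr_wpDl.
    move=> v; rewrite sub0r normrN => ve.
    rewrite /F normr0 mul0r (_ : Num.min 1 0 = 0 :> R); last by apply/min_idPr.
    rewrite !mulr0 sub0r normrN ger0_norm ?mulr_ge0 ?sqr_ge0//.
    apply: (@le_trans _ _ (K * `|v|)).
      rewrite /K -2!mulrA; apply: ler_wpM2l => //; apply: ler_wpM2l; first exact: sqr_ge0.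
      by rewrite (mulrC `|z|) ge_min lexx orbT.
    apply: (@le_trans _ _ ((K + 1) * `|v|)); first by rewrite ler_wpM2r// lerDl.
    by rewrite mulrC -ler_pdivlMr ?ltW// ltr_wpDl.
  - by have := integrable_kernelM M (@admissible_sqr_norm R d); exact.
  - move=> v z _ _; rewrite /F ger0_norm ?mulr_ge0 ?sqr_ge0//.
    by rewrite ler_wpM2l// ler_piMr ?sqr_ge0// ge_min lexx.
have [r r0 Hr] := (continuous_atP _ _).1 cF _ e0.
exists r => // eps /andP[eps0 epsr].
have /Hr : `|0 - eps| < r by rewrite sub0r normrN gtr0_norm.
have F0 : \int[leb]_(z in setT) F 0 z = 0.
  transitivity (\int[leb]_(z in setT) (0 : R)); last by rewrite Rintegral_cst// mul0r.
  apply: eq_Rintegral => z _; rewrite /F normr0 mul0r (_ : Num.min 1 0 = 0 :> R) ?mulr0//.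
  by apply/min_idPr.
rewrite F0 sub0r normrN => Fe; apply: le_trans (le_trans (ler_norm _) Fe).
apply: eq_le_of.
by apply: eq_Rintegral => z _; rewrite /F gtr0_norm.
Qed.

Variables (kappa : 'rV[R]_d -> 'rV[R]_d) (Theta : 'M[R]_d).
Hypotheses (kappaP : corrector a mu kappa) (ThetaP : effective_matrix a lambda mu kappa Theta).

(** The equation of [chi] is exact as it has to cancel a term of order [1 / eps]; that of [k] acts
    at order 1 and tolerates the error [eta]. *)
Lemma cell_solutions (eta : R) : 0 < eta ->
  exists (chi : 'I_d -> 'rV[R]_d -> R) (k : 'I_d * 'I_d -> 'rV[R]_d -> R),
  [/\ forall i, cper (chi i), forall p, cper (k p),
      forall i xi, J xi (fun z => chi i (xi - z) - chi i xi - z 0 i) = 0 &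
      forall p xi, `|lambda xi * (J xi (fun z => z 0 p.1 * z 0 p.2 / 2 - z 0 p.1 * chi p.2 (xi - z))
        + J xi (fun z => k p (xi - z) - k p xi)) - Theta p.1 p.2| <= eta].
Proof.
move=> eta0; have mT := @measurable_torus R d.
have [chi chiP] := choice (fun j => corrector_component M kappaP j).
have cchi i : cper (chi i) by have [] := chiP i.
have clambda : cper lambda by [].
have cmu : cper mu by [].
have lambdaN0 x : lambda x != 0.
  by have /andP[+ _] := lambda_bounds x; move/(lt_le_trans alpha1_gt0)/lt0r_neq0.
have a1 i j := @admissible_half_coord2 R d i j.
have a2 i j xi := admissible_coordM_periodic xi i (cchi j).
have c1 i j : cper (fun xi => J xi (fun z => z 0 i * z 0 j / 2)).
  have [mF [B FB]] := a1 i j.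
  by apply: (continuous_periodic_J M (F := fun _ z => z 0 i * z 0 j / 2) (B := B)) => // z; exact: cst_continuous.
have c2 i j : cper (fun xi => J xi (fun z => z 0 i * chi j (xi - z))).
  have [B cB] := continuous_periodic_bounded (cchi j).1 (cchi j).2.
  have B0 : 0 <= B by exact: le_trans (cB 0).
  apply: (continuous_periodic_J M (F := fun xi z => z 0 i * chi j (xi - z)) (B := B)).
  - by move=> z; apply: rV_continuousZ; apply: rV_continuous_shift; exact: (cchi j).1.
  - by move=> x; have [] := a2 i j x.
  - move=> x z; rewrite normrM mulrC; apply: ler_pM => //.
    apply: le_trans (rV_coord_le z i) _; have := normr_ge0 z; nra.
  - by move=> x k z; rewrite addrAC (cchi j).2.
(* The quantity to be compensated by the second corrector. The vanishing of its integral against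
   [mu / lambda] is the definition of [Theta], with [chi] in place of [kappa]. *)
pose Phi (p : 'I_d * 'I_d) xi := Theta p.1 p.2 - lambda xi *
  (J xi (fun z => z 0 p.1 * z 0 p.2 / 2) - J xi (fun z => z 0 p.1 * chi p.2 (xi - z))).
have cPhi p : cper (Phi p).
  apply: continuous_periodicB; first exact: continuous_periodic_cst.
  by apply: continuous_periodicM => //; apply: continuous_periodicB; [exact: c1|exact: c2].
have Phi0 p : \int[leb]_(x in @torus R d) (Phi p x * (mu x / lambda x)) = 0.
  case: p => i j; pose A xi := mu xi * J xi (fun z => z 0 i * z 0 j / 2).
  pose B xi := mu xi * J xi (fun z => z 0 i * chi j (xi - z)).
  have cA : cper A by exact: continuous_periodicM.
  have cB : cper B by exact: continuous_periodicM.
  have crat : cper (fun x => mu x / lambda x).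
    by apply: continuous_periodicM => //; exact: continuous_periodicV.
  have iA := continuous_periodic_integrable_torus cA.
  have iB := continuous_periodic_integrable_torus cB.
  have irat := continuous_periodic_integrable_torus crat.
  have iT := continuous_periodic_integrable_torus
    (continuous_periodicM (continuous_periodic_cst d (Theta i j)) crat).
  have iAB := continuous_periodic_integrable_torus (continuous_periodicB cA cB).
  have -> : \int[leb]_(x in @torus R d) (Phi (i, j) x * (mu x / lambda x)) =
      \int[leb]_(x in @torus R d) (Theta i j * (mu x / lambda x) - (A x - B x)).
    by apply: eq_Rintegral => x _; rewrite /Phi /A /B /=; field.
  rewrite RintegralB// RintegralZl// RintegralB// ThetaP.
  apply/eqP; rewrite subr_eq0; apply/eqP; congr (_ - _); apply: eq_Rintegral => xi _.
    rewrite /A -(JZ M); last exact: a1.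
    rewrite (J_convE M); last by have [] := admissibleZ (mu xi) (a1 i j).
    by apply: eq_Rintegral => q _; ring.
  by have [_ _ _ ->] := chiP j.
have /choice[k kP] p : exists k, cper k /\
    forall xi, `|lambda xi * J xi (fun z => k (xi - z) - k xi) - Phi p xi| <= eta.
  by have [k ck kE] := approximate_cell_solution M (cPhi p) eta0 (Phi0 p); exists k.
exists chi, k; split => //.
- by move=> p; have [] := kP p.
- by move=> i xi; have [_ _ ->] := chiP i.
move=> p xi; have [_ /(_ xi)] := kP p; congr (`|_| <= _).
by rewrite /Phi (JB M xi (a1 p.1 p.2) (a2 p.1 p.2 xi)); ring.
Qed.

End cell_problems.

(** * The two-scale ansatz and its Taylor remainder *)

Lemma quadratic_bound (R : realType) (B t : R) : 0 <= B -> 0 <= t ->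
  t ^+ 2 + B * t + B <= (1 + 2 * B) * (1 + t) ^+ 2.
Proof.
by move=> B0 t0; have := mulr_ge0 B0 t0; have := mulr_ge0 B0 (sqr_ge0 t); lra.
Qed.

(** The algebra of the expansion with all sums as opaque scalars: primes mark values at the shifted
    point, [m] is the main increment, and [r], [s0] to [s6] are [R0], [S0] to [S6] of
    [corrected_increment_bound]. *)
Lemma collect_increments (R : comNzRingType) (e F F' f f' A A' B B' m r s0 s1 s2 s3 s4 s5 s6 : R) :
  F' = f' + e * A' + e ^+ 2 * B' -> F = f + e * A + e ^+ 2 * B ->
  m = e * (s5 - s0) + e ^+ 2 * (s1 - s2 + s6) ->
  f' = f + r - e * s0 + e ^+ 2 * s1 -> A' = A + s5 + s3 - e * s2 -> B' = B + s6 + s4 ->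
  F' - F - m = r + e * s3 + e ^+ 2 * s4.
Proof. by move=> -> -> -> -> -> ->; ring. Qed.

Section corrected_function.
Context (R : realType) (d : nat).
Variables (chi : 'I_d -> 'rV[R]_d -> R) (k : 'I_d * 'I_d -> 'rV[R]_d -> R).
Variables (f : 'rV[R]_d -> R) (eps : R).
Hypothesis f_schwartz : schwartz f.
Hypothesis eps_gt0 : 0 < eps.
Implicit Types x z : 'rV[R]_d.

Definition second_partial (p : 'I_d * 'I_d) x := partial p.1 (partial p.2 f) x.

Definition corrected x := f x
  + eps * \sum_i chi i (eps^-1 *: x) * partial i f x
  + eps ^+ 2 * \sum_p k p (eps^-1 *: x) * second_partial p x.

(** The part that survives integration over the jumps: the cell equation of [chi] annihilates the
    order [eps], and the order [eps ^+ 2] yields [Theta]. The product [z 0 p.1 * chi p.2] arises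
    from expanding the gradient that multiplies [chi] at the shifted point. *)
Definition main_increment x z :=
  eps * \sum_i partial i f x * (chi i (eps^-1 *: x - z) - chi i (eps^-1 *: x) - z 0 i)
  + eps ^+ 2 * \sum_p second_partial p x *
      ((z 0 p.1 * z 0 p.2 / 2 - z 0 p.1 * chi p.2 (eps^-1 *: x - z))
       + (k p (eps^-1 *: x - z) - k p (eps^-1 *: x))).

(** [f] is expanded to second order, its gradient to first order with the factor [eps], its Hessian
    to order 0 with the factor [eps ^+ 2]. All three remainders are thus of order [eps ^+ 2] times
    the modulus [om] of the second derivatives. *)
Lemma corrected_increment_bound (B K : R) x z : 0 <= B -> 0 <= K ->
  (forall i y, `|chi i y| <= B) -> (forall p y, `|k p y| <= B) ->
  (forall p x y, `|second_partial p y - second_partial p x| <= K * Num.min 1 `|y - x|) ->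
  `|corrected (x - eps *: z) - corrected x - main_increment x z| <=
  eps ^+ 2 * (d%:R ^+ 2 * (1 + 2 * B) * K) * ((1 + `|z|) ^+ 2 * Num.min 1 (eps * `|z|)).
Proof.
move=> B0 K0 chiB kB K2.
have e0 : eps != 0 by rewrite gt_eqF.
pose xi := eps^-1 *: x; pose h := - (eps *: z); pose om := K * Num.min 1 (eps * `|z|).
have hn : `|h| = eps * `|z| by rewrite normrN normrZ gtr0_norm.
have om0 : 0 <= om by rewrite mulr_ge0// le_min ler01 mulr_ge0// ltW.
have om2 y p : `|y - x| <= `|h| -> `|second_partial p y - second_partial p x| <= om.
  move=> yx; apply: le_trans (K2 p x y) _; apply: ler_wpM2l => //.
  by rewrite le_min ge_min lexx/= -hn ge_min yx orbT.
pose R0 := f (x + h) - f x - \sum_i h 0 i * partial i f x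
  - \sum_i \sum_j h 0 i * h 0 j * partial i (partial j f) x / 2.
pose R1 i := partial i f (x + h) - partial i f x
  - \sum_j h 0 j * partial j (partial i f) x.
pose R2 p := second_partial p (x + h) - second_partial p x.
have R0b : `|R0| <= d%:R ^+ 2 * `|h| ^+ 2 * om.
  by apply: schwartz_taylor2 => // y i j; exact: (om2 y (i, j)).
have R1b i : `|R1 i| <= d%:R * `|h| * om.
  apply: schwartz_taylor1 => //; first exact: schwartz_partial.
  by move=> y j; exact: (om2 y (j, i)).
have R2b p : `|R2 p| <= om by apply: om2; rewrite (addrC x) addrK.
have hE i : h 0 i = - (eps * z 0 i) by rewrite !mxE.
pose S0 := \sum_i z 0 i * partial i f x.
pose S1 := \sum_p z 0 p.1 * z 0 p.2 / 2 * second_partial p x.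
pose S2 := \sum_p z 0 p.1 * chi p.2 (xi - z) * second_partial p x.
pose S3 := \sum_i chi i (xi - z) * R1 i.
pose S4 := \sum_p k p (xi - z) * R2 p.
pose S5 := \sum_i (chi i (xi - z) - chi i xi) * partial i f x.
pose S6 := \sum_p (k p (xi - z) - k p xi) * second_partial p x.
have E0 : f (x + h) = f x + R0 - eps * S0 + eps ^+ 2 * S1.
  have -> : - (eps * S0) = \sum_i h 0 i * partial i f x.
    by rewrite -mulNr mulr_sumr; apply: eq_bigr => i _; rewrite hE; ring.
  have -> : eps ^+ 2 * S1 = \sum_i \sum_j h 0 i * h 0 j * partial i (partial j f) x / 2.
    rewrite pair_bigA mulr_sumr; apply: eq_bigr => p _.
    by rewrite !hE /second_partial; ring.
  by rewrite /R0; ring.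
have E1 : \sum_i chi i (xi - z) * partial i f (x + h) =
    \sum_i chi i xi * partial i f x + S5 + S3 - eps * S2.
  have -> : - (eps * S2) = \sum_i chi i (xi - z) * \sum_j h 0 j * partial j (partial i f) x.
    under [RHS]eq_bigr do rewrite mulr_sumr.
    rewrite exchange_big pair_bigA -mulNr mulr_sumr; apply: eq_bigr => p _.
    by rewrite hE /second_partial; ring.
  by rewrite -!big_split; apply: eq_bigr => i _; rewrite /R1 /=; ring.
have E2 : \sum_p k p (xi - z) * second_partial p (x + h) =
    \sum_p k p xi * second_partial p x + S6 + S4.
  rewrite -!big_split; apply: eq_bigr => p _; rewrite /R2 /=.
  by move: (second_partial p (x + h)) (second_partial p x) => s s'; ring.
have E3 : \sum_i partial i f x * (chi i (xi - z) - chi i xi - z 0 i) = S5 - S0.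
  by rewrite -sumrB; apply: eq_bigr => i _; ring.
have E4 : \sum_p second_partial p x * ((z 0 p.1 * z 0 p.2 / 2 - z 0 p.1 * chi p.2 (xi - z))
    + (k p (xi - z) - k p xi)) = S1 - S2 + S6.
  by rewrite -sumrB -big_split; apply: eq_bigr => p _ /=; ring.
have xiE : eps^-1 *: (x + h) = xi - z.
  by rewrite scalerDr scalerN scalerA mulVf// scale1r.
have correctedE y v : eps^-1 *: y = v -> corrected y = f y
    + eps * (\sum_i chi i v * partial i f y) + eps ^+ 2 * (\sum_p k p v * second_partial p y).
  by move=> <-; reflexivity.
have CE : corrected (x - eps *: z) = _ := correctedE (x + h) (xi - z) xiE.
have ME : main_increment x z = eps * (S5 - S0) + eps ^+ 2 * (S1 - S2 + S6).
  by rewrite -E3 -E4.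
have -> := collect_increments CE (correctedE x xi erefl) ME E0 E1 E2.
have S3b : `|S3| <= d%:R ^+ 2 * B * `|h| * om.
  apply: le_trans (ler_norm_sum _ _ _) _.
  apply: (@le_trans _ _ (\sum_(i < d) B * (d%:R * `|h| * om))).
    by apply: ler_sum => i _; rewrite normrM; apply: ler_pM.
  rewrite sumr_const card_ord -[leLHS]mulr_natl.
  by apply: eq_le_of; ring.
have S4b : `|S4| <= d%:R ^+ 2 * B * om.
  apply: le_trans (ler_norm_sum _ _ _) _.
  apply: (@le_trans _ _ (\sum_(p : 'I_d * 'I_d) B * om)).
    by apply: ler_sum => i _; rewrite normrM; apply: ler_pM.
  rewrite sumr_const card_prod card_ord -[leLHS]mulr_natl natrM.
  by apply: eq_le_of; ring.
have e2 : 0 <= eps ^+ 2 by exact: sqr_ge0.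
apply: le_trans (ler_normD _ _) _; apply: le_trans (lerD (ler_normD _ _) (lexx _)) _.
rewrite 2!normrM (gtr0_norm eps_gt0) (ger0_norm e2).
apply: le_trans (lerD (lerD R0b (ler_wpM2l (ltW eps_gt0) S3b)) (ler_wpM2l e2 S4b)) _.
rewrite hn.
have -> : d%:R ^+ 2 * (eps * `|z|) ^+ 2 * om + eps * (d%:R ^+ 2 * B * (eps * `|z|) * om)
    + eps ^+ 2 * (d%:R ^+ 2 * B * om) =
    eps ^+ 2 * (d%:R ^+ 2 * om) * (`|z| ^+ 2 + B * `|z| + B) by ring.
have -> : eps ^+ 2 * (d%:R ^+ 2 * (1 + 2 * B) * K) * ((1 + `|z|) ^+ 2 * Num.min 1 (eps * `|z|)) =
    eps ^+ 2 * (d%:R ^+ 2 * om) * ((1 + 2 * B) * (1 + `|z|) ^+ 2) by rewrite /om; ring.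
apply: ler_wpM2l; first by apply: mulr_ge0 => //; apply: mulr_ge0 => //; exact: sqr_ge0.
exact: quadratic_bound.
Qed.

End corrected_function.

(** * Uniform consistency of the rescaled operators with the limit operator *)

Section consistency.
Context (R : realType) (d : nat) (a lambda mu : 'rV[R]_d -> R) (C delta alpha1 alpha2 : R).
Notation leb := (lebesgue_rV R d).
Hypothesis M : medium a lambda mu C delta alpha1 alpha2.
Let alpha1_gt0 := medium_alpha1_gt0 M.
Let lambda_bounds := medium_lambda_bounds M.
Local Notation J := (J a mu).
Local Notation cper := (@continuous_periodic R d).

Let alpha2_gt0 := medium_alpha2_gt0 M.

Let continuous_rescaled (u : 'rV[R]_d -> R) (c : R) : continuous u ->
  continuous (fun x : 'rV[R]_d => u (c *: x)).
Proof.
move=> /(@rV_continuous_affine R d _ c 0).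
by under [in X in X -> _]eq_fun do rewrite addr0.
Qed.

Lemma corrected_C0 (chi : 'I_d -> 'rV[R]_d -> R) (k : 'I_d * 'I_d -> 'rV[R]_d -> R) f eps :
  schwartz f -> (forall i, cper (chi i)) -> (forall p, cper (k p)) ->
  corrected chi k f eps \in @C0_pred R d.
Proof.
move=> sf cchi ck.
have sp i := schwartz_partial i sf; have spp p : schwartz (second_partial f p) by exact/schwartz_partial/sp.
have bnd (u : 'rV[R]_d -> R) : cper u -> exists B, forall x : 'rV[R]_d, `|u (eps^-1 *: x)| <= B.
  by move=> cu; have [B uB] := continuous_periodic_bounded cu.1 cu.2; exists B.
have vM (u v : 'rV[R]_d -> R) : cper u -> schwartz v -> vanishing_at_infinity (fun x : 'rV[R]_d => u (eps^-1 *: x) * v x).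
  move=> /bnd[B uB] sv; exact: vanishingM_bounded uB (schwartz_vanishing sv).
have cM (u v : 'rV[R]_d -> R) : cper u -> schwartz v -> continuous (fun x : 'rV[R]_d => u (eps^-1 *: x) * v x).
  move=> cu sv; apply: rV_continuousM; last exact: schwartz_continuous.
  exact: continuous_rescaled cu.1.
have vZ (c : R) (v : 'rV[R]_d -> R) : vanishing_at_infinity v -> vanishing_at_infinity (fun x => c * v x).
  by apply: (vanishingM_bounded (b := fun=> c) (B := `|c|)).
rewrite inE; split.
- apply: rV_continuousD; first apply: rV_continuousD; first exact: schwartz_continuous.
  + by apply: rV_continuousZ; apply: rV_continuous_sum => i; exact: cM.
  + by apply: rV_continuousZ; apply: rV_continuous_sum => p; exact: cM.
- apply: vanishingD; first apply: vanishingD; first exact: schwartz_vanishing.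
  + by apply: vZ; apply: vanishing_sum => i; exact: vM.
  + by apply: vZ; apply: vanishing_sum => p; exact: vM.
Qed.

Variables (kappa : 'rV[R]_d -> 'rV[R]_d) (Theta : 'M[R]_d).
Hypotheses (kappaP : corrector a mu kappa) (ThetaP : effective_matrix a lambda mu kappa Theta).

Let J_main_increment chi k f eps x : schwartz f -> (forall i, cper (chi i)) -> (forall p, cper (k p)) ->
  (forall i xi, J xi (fun z => chi i (xi - z) - chi i xi - z 0 i) = 0) ->
  let xi := eps^-1 *: x in
  admissible (main_increment chi k f eps x) /\
  J xi (main_increment chi k f eps x) = eps ^+ 2 * \sum_p second_partial f p x *
    (J xi (fun z => z 0 p.1 * z 0 p.2 / 2 - z 0 p.1 * chi p.2 (xi - z))
     + J xi (fun z => k p (xi - z) - k p xi)).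
Proof.
move=> sf cchi ck chi0 xi.
have ap u := @admissible_periodic R d u xi.
have a1 i : admissible (fun z => chi i (xi - z) - chi i xi - z 0 i).
  by apply: admissibleB; [apply: admissibleB; [exact: ap|exact: admissible_cst]|exact: (@admissible_coord R d i)].
have a2 p := admissible_cell xi p.1 p.2 (cchi p.2).
have a3 p : admissible (fun z => k p (xi - z) - k p xi).
  by apply: admissibleB; [exact: ap|exact: admissible_cst].
have a23 p := admissibleD (a2 p) (a3 p).
have [s1 JS1] := J_sum M xi (fun i => admissibleZ (partial i f x) (a1 i)).
have [s2 JS2] := J_sum M xi (fun p => admissibleZ (second_partial f p x) (a23 p)).
split; first exact: admissibleD (admissibleZ _ s1) (admissibleZ _ s2).
rewrite /main_increment -/xi (JD M xi (admissibleZ _ s1) (admissibleZ _ s2)).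
rewrite (JZ M xi _ s1) (JZ M xi _ s2) JS1 JS2 big1 ?mulr0 ?add0r.
  congr (_ * _); apply: eq_bigr => p _.
  by rewrite (JZ M xi _ (a23 p)) (JD M xi (a2 p) (a3 p)).
by move=> i _; rewrite (JZ M xi _ (a1 i)) chi0 mulr0.
Qed.

Lemma L0_approximation (p q : C0 R d) (eta : R) : L0_graph Theta (p, q) -> 0 < eta ->
  exists2 eps0, 0 < eps0 & forall eps, 0 < eps < eps0 -> exists p' q' : C0 R d,
    [/\ Leps_graph a lambda mu eps (p', q'), `|p' - p| <= eta & `|q' - q| <= eta].
Proof.
move=> [/= sp qE] eta0; have sg i := schwartz_partial i sp.
have sh i : schwartz (second_partial p i) by exact/schwartz_partial/sg.
have [Bg Bg0 gB] := common_bound (fun i => schwartz_bounded (sg i)).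
have [Bh Bh0 hB] := common_bound (fun i => schwartz_bounded (sh i)).
have [K K0 hK] : exists2 K, 0 <= K & forall i x y,
    `|second_partial p i y - second_partial p i x| <= K * Num.min 1 `|y - x|.
  have /choice[K KP] i : exists K, 0 <= K /\ forall x y,
      `|second_partial p i y - second_partial p i x| <= K * Num.min 1 `|y - x|.
    by have [K K0 KP] := schwartz_increment (sh i); exists K.
  exists (\sum_i K i) => [|i x y]; first by apply: sumr_ge0 => i _; have [] := KP i.
  have [_ h] := KP i; apply: le_trans (h x y) _; apply: ler_wpM2r.
    by rewrite le_min ler01 normr_ge0.
  by rewrite (bigD1 i)//= lerDl; apply: sumr_ge0 => j _; have [] := KP j.
have dd0 : 0 <= d%:R ^+ 2 * Bh by rewrite mulr_ge0 ?sqr_ge0.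
(* One half of [eta] goes to the defect of the second corrector, the other to the Taylor remainder.
   The defect comes first: it determines [k], whose bound enters [K'] and hence the threshold on
   [eps]. *)
have eta1 : 0 < eta / 2 / (d%:R ^+ 2 * Bh + 1) by rewrite !divr_gt0// ltr_wpDl.
have [chi [k [cchi ck chi0 kE]]] := cell_solutions M kappaP ThetaP eta1.
have [Bc Bc0 cB] := common_bound (fun i => continuous_periodic_bounded (cchi i).1 (cchi i).2).
have [Bk Bk0 kB] := common_bound (fun i => continuous_periodic_bounded (ck i).1 (ck i).2).
pose B := Bc + Bk; have B0 : 0 <= B by exact: addr_ge0.
have {}cB i y : `|chi i y| <= B by apply: le_trans (cB i y) _; rewrite lerDl.
have {}kB i y : `|k i y| <= B by apply: le_trans (kB i y) _; rewrite lerDr.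
pose K' := d%:R ^+ 2 * (1 + 2 * B) * K.
have K'0 : 0 <= K' by rewrite !mulr_ge0 ?sqr_ge0 ?addr_ge0 ?mulr_ge0.
have a20 := ltW alpha2_gt0.
have K'' : 0 <= alpha2 * alpha2 * K' by exact: mulr_ge0 (mulr_ge0 a20 a20) K'0.
have e1 : 0 < eta / 2 / (alpha2 * alpha2 * K' + 1) by rewrite !divr_gt0// ltr_wpDl.
have [eps1 eps10 tail] := kernel_tail M e1.
pose D := d%:R * B * Bg + d%:R ^+ 2 * B * Bh.
have D0 : 0 <= D by rewrite addr_ge0 ?mulr_ge0 ?sqr_ge0.
(* [eps < 1] gives [eps ^+ 2 <= eps], [eps1] controls the tail integral, and the last term keeps the
   correctors below [eta]. *)
exists (Num.min 1 (Num.min eps1 (eta / (D + 1)))).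
  by rewrite !lt_min ltr01 eps10 divr_gt0// ltr_wpDl.
move=> eps /andP[eps0]; rewrite !lt_min => /andP[epsl1 /andP[epsl epsD]].
pose p' := MkC0 (corrected_C0 eps sp cchi ck).
have Lp' := Leps_C0 M eps0 p'.
exists p', (MkC0 Lp'); split.
- by [].
- apply: C0_norm_le => x.
  rewrite [X in `|X|](_ : _ = corrected chi k p eps x - p x)//.
  have s1 : `|\sum_i chi i (eps^-1 *: x) * partial i p x| <= d%:R * B * Bg.
    apply: le_trans (ler_norm_sum _ _ _) _.
    apply: (@le_trans _ _ (\sum_(i < d) B * Bg)).
      by apply: ler_sum => i _; rewrite normrM; apply: ler_pM.
    by rewrite sumr_const card_ord -[leLHS]mulr_natl mulrA.
  have s2 : `|\sum_i k i (eps^-1 *: x) * second_partial p i x| <= d%:R ^+ 2 * B * Bh.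
    apply: le_trans (ler_norm_sum _ _ _) _.
    apply: (@le_trans _ _ (\sum_(i : 'I_d * 'I_d) B * Bh)).
      by apply: ler_sum => i _; rewrite normrM; apply: ler_pM.
    by rewrite sumr_const card_prod card_ord -[leLHS]mulr_natl natrM -expr2 mulrA.
  have -> : corrected chi k p eps x - p x = eps * \sum_i chi i (eps^-1 *: x) * partial i p x
      + eps ^+ 2 * \sum_i k i (eps^-1 *: x) * second_partial p i x by rewrite /corrected; ring.
  apply: le_trans (ler_normD _ _) _; rewrite 2!normrM (gtr0_norm eps0) (ger0_norm (sqr_ge0 _)).
  have ee : eps ^+ 2 <= eps by rewrite expr2 ler_piMr// ltW.
  apply: (@le_trans _ _ (eps * (D + 1))); last first.
    by rewrite -ler_pdivlMr ?ltr_wpDl// ltW.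
  apply: (@le_trans _ _ (eps * (d%:R * B * Bg) + eps * (d%:R ^+ 2 * B * Bh))).
    apply: lerD; first by rewrite ler_wpM2l// ltW.
    apply: ler_pM => //; exact: sqr_ge0.
  by rewrite -mulrDr ler_wpM2l ?lerDl// ltW.
apply: C0_norm_le => x.
rewrite [X in `|X|](_ : _ = Leps a lambda mu eps p' x - q x)//.
have [cp' _] := C0P p'; have p'B y : `|p' y| <= `|p'| := C0_normP p' y.
have mp' : measurable_fun setT p' by exact: continuous_measurable_rV.
rewrite (LepsE M eps0 x mp' p'B) qE.
set xi := eps^-1 *: x.
have ainc := admissible_increment eps x mp' p'B.
have [amain Jmain] := J_main_increment eps x sp cchi ck chi0.
rewrite -/xi in Jmain.
set inc := (fun z => p' (x - eps *: z) - p' x) in ainc *.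
pose rem z := inc z - main_increment chi k p eps x z.
have JE : J xi inc = J xi (main_increment chi k p eps x) + J xi rem.
  by rewrite /rem (JB M xi ainc amain) addrC subrK.
pose tailf (z : 'rV[R]_d) := eps ^+ 2 * K' * ((1 + `|z|) ^+ 2 * Num.min 1 (eps * `|z|)).
have remb z : `|rem z| <= tailf z by exact: corrected_increment_bound.
have a0 := @admissible_tail R d eps (ltW eps0).
have atail : admissible tailf by exact: admissibleZ.
have arem : admissible rem.
  split; first by apply: measurable_funB; [case: ainc|case: amain].
  by have [_ [B' tB]] := atail; exists B' => z; apply: le_trans (remb z) (le_trans (ler_norm _) (tB z)).
have Jrem : `|J xi rem| <= alpha2 * (eps ^+ 2 * K' * (eta / 2 / (alpha2 * alpha2 * K' + 1))).
  apply: le_trans (J_norm_le M xi arem atail remb) _.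
  apply: ler_wpM2l; first exact: ltW.
  under eq_Rintegral do rewrite mulrCA.
  have i0 := integrable_kernelM M a0.
  rewrite RintegralZl//.
  apply: ler_wpM2l; first by rewrite mulr_ge0// sqr_ge0.
  by apply: tail; rewrite eps0.
have L0E : L0 Theta p x = \sum_i Theta i.1 i.2 * second_partial p i x.
  by rewrite /L0 pair_bigA.
have e2 : eps ^+ 2 != 0 by rewrite expf_neq0// gt_eqF.
pose cell i := lambda xi * (J xi (fun z => z 0 i.1 * z 0 i.2 / 2 - z 0 i.1 * chi i.2 (xi - z))
  + J xi (fun z => k i (xi - z) - k i xi)) - Theta i.1 i.2.
have -> : (eps ^+ 2)^-1 * lambda xi * J xi inc - L0 Theta p x =
    \sum_i second_partial p i x * cell i + (eps ^+ 2)^-1 * (lambda xi * J xi rem).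
  rewrite JE Jmain L0E.
  rewrite [\sum_i second_partial p i x * cell i](_ : _ = lambda xi * (\sum_i second_partial p i x *
    (J xi (fun z => z 0 i.1 * z 0 i.2 / 2 - z 0 i.1 * chi i.2 (xi - z))
     + J xi (fun z => k i (xi - z) - k i xi))) - \sum_i Theta i.1 i.2 * second_partial p i x).
    by field; rewrite gt_eqF.
  by rewrite mulr_sumr -sumrB; apply: eq_bigr => i _; rewrite /cell; ring.
apply: le_trans (ler_normD _ _) _; rewrite [leRHS]splitr; apply: lerD.
  apply: le_trans (ler_norm_sum _ _ _) _.
  apply: (@le_trans _ _ (\sum_(i : 'I_d * 'I_d) Bh * (eta / 2 / (d%:R ^+ 2 * Bh + 1)))).
    by apply: ler_sum => i _; rewrite normrM; apply: ler_pM => //; exact: kE.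
  rewrite sumr_const card_prod card_ord -[leLHS]mulr_natl natrM -expr2 mulrA mulrA.
  by rewrite ler_pdivrMr ?ltr_wpDl// mulrC ler_wpM2l ?lerDl// divr_ge0// ltW.
rewrite 2!normrM normfV (ger0_norm (sqr_ge0 eps)).
have /andP[l1 l2] := lambda_bounds xi.
rewrite ger0_norm; last exact: le_trans (ltW alpha1_gt0) l1.
apply: (@le_trans _ _ ((eps ^+ 2)^-1 * (alpha2 * (alpha2 * (eps ^+ 2 * K' * (eta / 2 / (alpha2 * alpha2 * K' + 1))))))).
  apply: ler_wpM2l; first by rewrite invr_ge0 sqr_ge0.
  by apply: ler_pM => //; exact: le_trans (ltW alpha1_gt0) l1.
have -> : (eps ^+ 2)^-1 * (alpha2 * (alpha2 * (eps ^+ 2 * K' * (eta / 2 / (alpha2 * alpha2 * K' + 1))))) =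
    alpha2 * alpha2 * K' * (eta / 2) / (alpha2 * alpha2 * K' + 1).
  by field; rewrite gt_eqF ?ltr_wpDl//= gt_eqF.
by rewrite ler_pdivrMr ?ltr_wpDl// mulrC ler_wpM2l ?lerDl// divr_ge0// ltW.
Qed.

End consistency.

(** * Convergence of the semigroups, uniformly on bounded time intervals *)

Lemma uniform_cvg_at_right0 (R : realType) (X : normedModType R) (A : set R)
    (F : R -> R -> X) (G : R -> X) :
  (forall eta : R, 0 < eta -> exists2 eps0, 0 < eps0 &
    forall eps, 0 < eps < eps0 -> forall t, A t -> `|F eps t - G t| <= eta) ->
  {uniform A, F @ 0^'+ --> G}.
Proof.
move=> H P /uniform_nbhs[E [entE EP]].
move: entE; rewrite -entourage_ballE => -[eta /= eta0 etaE].
have eta20 : 0 < eta / 2 by rewrite divr_gt0.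
have [eps0 eps00 Heps] := H _ eta20.
exists eps0 => //= eps; rewrite /ball_ /= sub0r normrN => epsl epsp.
apply: EP => t At; apply: etaE; rewrite /= -ball_normE /= distrC.
apply: (@le_lt_trans _ _ (eta / 2)); last by rewrite ltr_pdivrMr// ltr_pMr// ltr1n.
by apply: Heps => //; rewrite epsp -(gtr0_norm epsp).
Qed.

Unset Implicit Arguments.

Theorem proposition5p1 (R : realType) (d : nat) (d_ge1 : (1 <= d)%N)
  (a lambda mu : 'rV[R]_d -> R) (C delta alpha1 alpha2 : R)
  (a_cont : continuous a)
  (a_even : forall x, a x = a (- x))
  (a_ge0 : forall x, 0 <= a x)
  (a_int_gt0 : 0 < \int[lebesgue_rV R d]_x a x)
  (delta_gt2 : 2 < delta)
  (a_decay : forall x, a x <= C / (1 + eucl_norm x `^ (d%:R + delta)))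
  (lambda_cont : continuous lambda) (mu_cont : continuous mu)
  (lambda_periodic : Zd_periodic lambda) (mu_periodic : Zd_periodic mu)
  (alpha1_gt0 : 0 < alpha1)
  (lambda_bounds : forall x, alpha1 <= lambda x <= alpha2)
  (mu_bounds : forall x, alpha1 <= mu x <= alpha2)
  (kappa : 'rV[R]_d -> 'rV[R]_d) (kappaP : corrector a mu kappa)
  (Theta : 'M[R]_d) (ThetaP : effective_matrix a lambda mu kappa Theta)
  (Teps : R -> R -> C0 R d -> C0 R d)
  (TepsP : forall eps, 0 < eps ->
    generated_by (Teps eps) (Leps_graph a lambda mu eps))
  (T0 : R -> C0 R d -> C0 R d)
  (T0P : generated_by T0 (closure (L0_graph Theta))) :
  forall f : C0 R d,
    (forall t, 0 <= t -> Teps eps t f @[eps --> 0^'+] --> T0 t f) /\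
    (forall tau, {uniform `[0, tau],
      (fun eps t => Teps eps t f) @ 0^'+ --> (fun t => T0 t f)}).
Proof.
move=> f.
have M : medium a lambda mu C delta alpha1 alpha2 by [].
have T0s := T0P.1; have T0g := T0P.2.
have converges : forall tau eta : R, 0 <= tau -> 0 < eta -> exists2 eps0, 0 < eps0 &
    forall eps, 0 < eps < eps0 -> forall t, 0 <= t <= tau ->
      `|Teps eps t f - T0 t f| <= eta.
  apply: (trotter_kato (A0 := L0_graph Theta) T0s T0g) => [eps e0|eps t u e0 t0|u eta eta0|p q eta pq eta0].
  - exact: (TepsP _ e0).1.
  - exact: (Leps_semigroup_contraction M e0 u (TepsP _ e0) t0).
  - exact: generator_domain_dense.
  have [eps0 eps00 app] := L0_approximation M kappaP ThetaP pq eta0.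
  exists eps0 => // eps epsP; have [p' [q' [p'q' pp' qq']]] := app eps epsP.
  exists p', q'; split => //.
  by have /andP[e0 _] := epsP; rewrite (TepsP _ e0).2.
split=> [t t0|tau].
  apply/dnbhs0_rightP => eta eta0.
  have [eps0 eps00 H] := converges t eta t0 eta0.
  by exists eps0 => // eps epsP; apply: H => //; rewrite t0 lexx.
apply: uniform_cvg_at_right0 => eta eta0.
(* A negative [tau] gives an empty interval, covered here by the horizon 0. *)
have t0 : 0 <= Num.max 0 tau by rewrite le_max lexx.
have [eps0 eps00 H] := converges _ eta t0 eta0.
exists eps0 => // eps epsP t; rewrite /= in_itv/= => /andP[t0' tt].
by apply: H => //; rewrite t0' le_max tt orbT.
Qed.
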